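(* Let $s_1,\dots,s_n\overset{\text{i.i.d.}}{\sim}\mathbb D_1$ and $d_1,\dots,d_m\overset{\text{i.i.d.}}{\sim}\mathbb D_2$ be mutually independent. Assume that $\mathbb D_1$ and $\mathbb D_2$ have densities $g_1$ and $g_2$ on $[0,1]$ that are both $\eta$-Lipschitz and take values in $[1/\eta,\eta]$, for some $\eta\ge1$. Let $\xi=m/n$. For any $\gamma\ge\max\{1,\xi^{-1}\}$ and any two service range vectors $\mathsf R,\mathsf R'\in[0,\gamma]^n$ satisfying $\mathsf R\succeq\mathsf R'$ and $\|\mathsf R^{\downarrow}-\mathsf R'^{\downarrow}\|_1>\theta n$ for some $\theta>0$, the expected matching size satisfies, for all $n\ge 8\gamma$, $$\mu_m(\mathsf R')-\mu_m(\mathsf R)\ \ge\ \alpha_{\xi,\gamma,\eta}\,\theta^3 n-\beta_{\xi,\gamma,\eta}\log n,$$ where $$\alpha_{\xi,\gamma,\eta}=\frac{7}{384}\left[1-\frac{\eta^4+1}{(\eta^2+1)^2}\right]e^{-(8+4\xi)\gamma\eta}(\gamma\eta)^{-3},\qquad \beta_{\xi,\gamma,\eta}=8e^{4\gamma\eta\xi}\gamma\eta+20\gamma\eta.$$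
   Context: Given $\mathsf R=(r_1,\dots,r_n)\in\mathbb R_{\ge0}^n$, $\mathbb G(m,\mathsf R)$ is the law of the random bipartite graph on $[n]\cup[m]$ in which supply $i$ and demand $j$ are adjacent iff $|s_i-d_j|\le r_i/n$, where the supply locations are i.i.d. from $\mathbb D_1$ and the demand locations are i.i.d. from $\mathbb D_2$. $M(G)$ is the size of a maximum matching of $G$ and $\mu_m(\mathsf R)=\mathbb E_{G\sim\mathbb G(m,\mathsf R)}[M(G)]$. For $\mathbf x\in\mathbb R^n$, $\mathbf x^{\downarrow}$ is its non-increasing rearrangement. $\mathbf x\succeq\mathbf y$ (majorization) means $\sum_{i=1}^{\ell}x_i^{\downarrow}\ge\sum_{i=1}^{\ell}y_i^{\downarrow}$ for $\ell=1,\dots,n-1$ and $\sum_{i=1}^n x_i^{\downarrow}=\sum_{i=1}^n y_i^{\downarrow}$. *)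

(* Defs.v *)
From mathcomp Require Import all_boot all_order all_algebra.
From mathcomp Require Import all_classical all_reals all_analysis.

Set Implicit Arguments.
Unset Strict Implicit.
Unset Printing Implicit Defensive.

Import Order.TTheory GRing.Theory Num.Theory.
Import numFieldNormedType.Exports.

Local Open Scope classical_set_scope.
Local Open Scope ring_scope.

(* A bipartite graph with sides [U] and [V] is given by its set of edges
   [E : {set U * V}]. *)

Definition is_matching (U V : finType) (E M : {set U * V}) : bool :=
  (M \subset E) &&
  [forall e1 in M, forall e2 in M,
     (e1 != e2) ==> (e1.1 != e2.1) && (e1.2 != e2.2)].

Definition matching_number (U V : finType) (E : {set U * V}) : nat :=
  \max_(M : {set U * V} | is_matching E M) #|M|.

Definition service_graph (R : realType) (n m : nat) (r : n.-tuple R)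
    (s : 'I_n -> R) (d : 'I_m -> R) : {set 'I_n * 'I_m} :=
  [set e : 'I_n * 'I_m | `|s e.1 - d e.2| <= tnth r e.1 / n%:R]%SET.

(* The expectation of [M(G)] under the law of the graph built from the random
   locations [s] and [d]; it depends on [P], [s] and [d] only through the joint
   law of the locations. *)
Definition expected_matching (R : realType) (disp : measure_display)
    (T : measurableType disp) (P : probability T R) (n m : nat)
    (s : 'I_n -> {RV P >-> R}) (d : 'I_m -> {RV P >-> R})
    (r : n.-tuple R) : \bar R :=
  ('E_P[fun w => (matching_number
                    (service_graph r (fun i => s i w) (fun j => d j w)))%:R])%E.

Definition mutually_independent (R : realType) (disp : measure_display)
    (T : measurableType disp) (P : probability T R) (I : finType)
    (X : I -> {RV P >-> R}) : Prop :=
  forall (J : {set I}) (A : I -> set R),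
    (forall i, i \in J -> measurable (A i)) ->
    P (\bigcap_(i in [set` J]) (X i @^-1` A i)) =
    (\prod_(i in J) P (X i @^-1` A i))%E.

Definition locations (R : realType) (disp : measure_display)
    (T : measurableType disp) (P : probability T R) (n m : nat)
    (s : 'I_n -> {RV P >-> R}) (d : 'I_m -> {RV P >-> R})
    (k : 'I_n + 'I_m) : {RV P >-> R} :=
  match k with inl i => s i | inr j => d j end.

(* Laws are compared on Borel sets only: a measure is a total function on
   [set R], with no constraint on its values outside measurable sets. *)
Definition has_law (R : realType) (disp : measure_display)
    (T : measurableType disp) (P : probability T R) (X : {RV P >-> R})
    (D : probability R R) : Prop :=
  forall A : set R, measurable A -> distribution P X A = D A.

Definition has_density01 (R : realType) (D : probability R R) (g : R -> R) :
    Prop :=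
  forall A : set R, measurable A ->
    D A = (\int[lebesgue_measure]_(x in A `&` `[0%R, 1%R]) (g x)%:E)%E.

Definition decreasing_rearrangement (R : realType) (n : nat) (x : n.-tuple R) :
    n.-tuple R :=
  [tuple of sort >=%R x].

Definition majorizes (R : realType) (n : nat) (x y : n.-tuple R) : Prop :=
  let xd := decreasing_rearrangement x in
  let yd := decreasing_rearrangement y in
  (forall l : nat, (1 <= l <= n.-1)%N ->
     \sum_(i < n | (i < l)%N) tnth yd i <= \sum_(i < n | (i < l)%N) tnth xd i) /\
  \sum_(i < n) tnth xd i = \sum_(i < n) tnth yd i.

Definition l1_dist (R : realType) (n : nat) (x y : n.-tuple R) : R :=
  \sum_(i < n) `|tnth x i - tnth y i|.

Definition alpha_const (R : realType) (xi gamma eta : R) : R :=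
  7%:R / 384%:R * (1 - (eta ^+ 4 + 1) / (eta ^+ 2 + 1) ^+ 2)
    * expR (- ((8%:R + 4%:R * xi) * gamma * eta)) * (gamma * eta) ^- 3.

Definition beta_const (R : realType) (xi gamma eta : R) : R :=
  8%:R * expR (4%:R * gamma * eta * xi) * gamma * eta
    + 20%:R * gamma * eta.

(* Main.v *)
(* The expected matching size does not decrease, up to a small error, when an amount [e]
   of service range is moved from a supply [i] to a supply [j] with
   [r i - r j >= 2 e]; a majorized vector is reached from a majorizing one by such
   transfers.

   Adding a supply [i] to a graph increases the matching number by one exactly when
   [i] reaches a demand missed by some maximum matching. Given the rest of the graph,
   the increment in mean due to a larger range of [i] is therefore the measure of an
   annulus around the finite set of these free demands. The measure of a neighbourhood
   of a finite set of the line is concave in the radius, up to the Lipschitz variation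
   of the density, and strictly so when two isolated consecutive demands lie at a
   distance between twice the two ranges; this happens with probability of order
   [r i - r j], so that the total gain of the transfers is of the order of the
   decrease of the sum of squared ranges, itself at least [theta ^ 2 n].

   The free demands seen by [i] and those seen by [j] differ from those of the graph
   without [i] and [j] only near [j], resp. [i]: inside a run of demands not
   interrupted by an empty block of length twice the maximal range. The second moment
   method bounds the probability that [t] consecutive blocks are all hit by a constant
   over [t], whence an expected size of the run, and a total error, of order [log n]. *)

Require Import Defs.
From HB Require Import structures.
From mathcomp Require Import all_boot all_order all_algebra.
From mathcomp Require Import all_classical all_reals all_analysis.
From mathcomp Require Import perm measurable_realfun ring lra.

Set Implicit Arguments.
Unset Strict Implicit.
Unset Printing Implicit Defensive.

Import Order.TTheory GRing.Theory Num.Theory.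
Import numFieldNormedType.Exports.

Local Open Scope classical_set_scope.
Local Open Scope ring_scope.

(** * Matchings *)

(** The obstacle is that the increments of [i] and of [j] live in different graphs: one contains
    [j], the other [i]. Both are compared with the graph lacking [i] and [j]. Its free demands are
    independent of the locations of [i] and [j], which have the same law, so the two increments
    become measures of two annuli around one random finite set. Scales: ranges are divided by [n],
    hence at most [lam = gamma / n], and the l1 distance [S] of the sorted vectors lies between
    [theta] and [gamma]. Each of the [m * m.-1] ordered pairs of demands forms an isolated gap with
    probability at least a constant times [r i - r j - 2 e], so the gain rate is of order n^2. By
    Cauchy-Schwarz the sum of squares drops by at least S^2 / n, which gives a gain of order n S^2,
    and S^2 >= theta^3 / gamma. The loss is of order log n per unit moved, and S / 2 units are moved
    in all. When n < 8 gamma eta, the term in [beta_const] alone exceeds 2n and the bound is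
    immediate. *)

Section Matching.
Variables U V : finType.
Implicit Types (E M : {set U * V}) (K : {set V}).
Local Open Scope nat_scope.

Lemma is_matchingP E M :
  reflect (M \subset E /\
           {in M &, forall e1 e2, e1 != e2 -> e1.1 != e2.1 /\ e1.2 != e2.2})
          (is_matching E M).
Proof.
apply: (iffP andP) => -[ME inj]; split=> //.
  move=> e1 e2 M1 M2 ne.
  by move/forall_inP/(_ _ M1)/forall_inP/(_ _ M2)/implyP/(_ ne)/andP: inj.
apply/forall_inP => e1 M1; apply/forall_inP => e2 M2; apply/implyP => ne.
by apply/andP; apply: inj.
Qed.

Lemma matching_number_geq E M : is_matching E M -> #|M| <= matching_number E.
Proof. by move=> mM; exact: leq_bigmax_cond. Qed.

Lemma matching_number_leq E k :
  (forall M, is_matching E M -> #|M| <= k) -> matching_number E <= k.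
Proof. by move=> h; apply/bigmax_leqP. Qed.

Lemma matching_number_witness E :
  exists2 M, is_matching E M & #|M| = matching_number E.
Proof.
have m0 : is_matching E finset.set0.
  by apply/is_matchingP; split; [exact: finset.sub0set|move=> e1 e2; rewrite inE].
have card_gt0 : 0 < #|[pred M | is_matching E M]|.
  by apply/card_gt0P; exists finset.set0; rewrite inE.
by have [M mM eM] := eq_bigmax_cond (fun M => #|M|) card_gt0; exists M.
Qed.

Lemma sub_matching E E' M : E \subset E' -> is_matching E M -> is_matching E' M.
Proof.
move=> sE /is_matchingP [ME inj]; apply/is_matchingP; split=> //.
exact: fintype.subset_trans sE.
Qed.

Lemma leq_matching_number E E' :
  E \subset E' -> matching_number E <= matching_number E'.
Proof.
move=> sE; apply: matching_number_leq => M /(sub_matching sE).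
exact: matching_number_geq.
Qed.

Lemma matching_number_leq_card E : matching_number E <= #|U|.
Proof.
apply: matching_number_leq => M /is_matchingP [_ inj].
have fst_inj : {in M &, injective fst}.
  move=> e1 e2 M1 M2 e12; apply/eqP/negPn/negP => /(inj _ _ M1 M2) [].
  by rewrite e12 eqxx.
by rewrite -(card_in_imset fst_inj) max_card.
Qed.

Definition delete_demand E k : {set U * V} := [set e in E | e.2 != k]%SET.
Definition delete_supply E i : {set U * V} := [set e in E | e.1 != i]%SET.

(* [k] is missed by some maximum matching. *)
Definition missable E k := matching_number (delete_demand E k) == matching_number E.

(** An edge at [i] extends a maximum matching that misses its other end, and no matching uses [i]
    twice, so the increment is at most one. Conversely, a matching using [(i, k)] leaves, once this
    edge is removed, a matching of the rest avoiding [k]; if [k] is not missable, this one is not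
    maximum. *)
Lemma matching_number_add_supply E i :
  matching_number E = matching_number (delete_supply E i)
    + [exists k, ((i, k) \in E) && missable (delete_supply E i) k].
Proof.
set E0 := delete_supply E i.
have sE0 : E0 \subset E by apply/fintype.subsetP => e; rewrite inE => /andP[].
case: (boolP [exists k, _]) => [/existsP [k /andP[ikE /eqP fk]]|/existsPn nofree] /=.
- rewrite addn1; apply/eqP; rewrite eqn_leq; apply/andP; split; last first.
    have [M mM cM] := matching_number_witness (delete_demand E0 k).
    have [sM inj] := is_matchingP _ _ mM.
    have M_off e : e \in M -> [&& e \in E, e.1 != i & e.2 != k].
      by move=> /(fintype.subsetP sM); rewrite !inE -andbA.
    rewrite -fk -cM -[X in X < _]add0n.
    have ikM : (i, k) \notin M.
      by apply/negP => /M_off /and3P[_]; rewrite eqxx.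
    have -> : (0 + #|M|).+1 = #|(i, k) |: M|%SET by rewrite cardsU1 ikM.
    apply: matching_number_geq; apply/is_matchingP; split.
      by rewrite finset.subUset finset.sub1set ikE; apply/fintype.subsetP => e /M_off /and3P[].
    move=> e1 e2; rewrite !inE => /orP[/eqP ->|M1] /orP[/eqP ->|M2].
    + by rewrite eqxx.
    + by move=> _; have /and3P[_ a b] := M_off _ M2; rewrite /= eq_sym a eq_sym b.
    + by move=> _; have /and3P[_ a b] := M_off _ M1; rewrite /= a b.
    + exact: inj.
  apply: matching_number_leq => M mM.
  have [sM inj] := is_matchingP _ _ mM.
  have mM0 : is_matching E0 [set e in M | e.1 != i]%SET.
    apply/is_matchingP; split.
      apply/fintype.subsetP => e; rewrite !inE => /andP[/(fintype.subsetP sM) -> ->] //.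
    by move=> e1 e2; rewrite !inE => /andP[M1 _] /andP[M2 _]; apply: inj.
  apply: leq_trans (_ : _ <= #|[set e in M | e.1 != i]%SET|.+1) _; last first.
    by rewrite ltnS; apply: matching_number_geq.
  rewrite -(cardsID [set e | e.1 != i]%SET M) -[X in _ <= X]addn1.
  have -> : M :&: [set e | e.1 != i]%SET = [set e in M | e.1 != i]%SET.
    by apply/finset.setP => e; rewrite !inE.
  rewrite leq_add2l; apply/card_le1_eqP => e1 e2; rewrite !inE !negbK.
  move=> /andP[/eqP a1 M1] /andP[/eqP a2 M2].
  apply: contrapT => /eqP ne; have [] := inj _ _ M2 M1 ne; by rewrite a1 a2 eqxx.
rewrite addn0; apply/eqP; rewrite eqn_leq (leq_matching_number sE0) andbT.
apply: matching_number_leq => M mM.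
have [sM inj] := is_matchingP _ _ mM.
have mM0 : is_matching E0 [set e in M | e.1 != i]%SET.
  apply/is_matchingP; split.
    apply/fintype.subsetP => e; rewrite !inE => /andP[/(fintype.subsetP sM) -> ->] //.
  by move=> e1 e2; rewrite !inE => /andP[M1 _] /andP[M2 _]; apply: inj.
case: (boolP [exists e in M, e.1 == i]) => [/exists_inP [[i' k] ikM /= /eqP ii]|/exists_inPn none].
  subst i'.
  have ikE := fintype.subsetP sM _ ikM.
  have nfree := nofree k; rewrite ikE /= in nfree.
  have lt : matching_number (delete_demand E0 k) < matching_number E0.
    rewrite ltn_neqAle nfree; apply: leq_matching_number.
    by apply/fintype.subsetP => e; rewrite inE => /andP[].
  apply: leq_trans lt.
  rewrite (cardsD1 (i, k)) ikM add1n ltnS.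
  apply: matching_number_geq; apply/is_matchingP; split.
    apply/fintype.subsetP => e; rewrite !inE => /andP[ne eM].
    have [a b] := inj _ _ eM ikM ne.
    by rewrite (fintype.subsetP sM _ eM) a b.
  by move=> e1 e2; rewrite !inE => /andP[_ M1] /andP[_ M2]; apply: inj.
suff -> : M = [set e in M | e.1 != i]%SET by apply: matching_number_geq.
apply/finset.setP => e; rewrite inE; case: (boolP (e \in M)) => //= eM.
by rewrite (none _ eM).
Qed.

(** The hypothesis says that no supply has neighbours both in [K] and outside: [K] collects whole
    connected components, so matchings of the two parts can be glued. *)
Lemma matching_number_split E K :
  (forall i k l, (i, k) \in E -> (i, l) \in E -> k \in K -> l \in K) ->
  matching_number E = matching_number [set e in E | e.2 \in K]%SET
    + matching_number [set e in E | e.2 \notin K]%SET.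
Proof.
move=> noncross; set E1 := [set e in E | _ \in _]%SET; set E2 := [set e in E | _]%SET.
apply/eqP; rewrite eqn_leq; apply/andP; split.
  apply: matching_number_leq => M mM.
  rewrite -(cardsID [set e | e.2 \in K]%SET M); apply: leq_add;
    apply: matching_number_geq; move/is_matchingP: mM => [/fintype.subsetP sM inj];
    apply/is_matchingP; split.
  - by apply/fintype.subsetP => e; rewrite !inE => /andP[/sM -> ->].
  - by move=> e1 e2; rewrite !inE => /andP[M1 _] /andP[M2 _]; apply: inj.
  - by apply/fintype.subsetP => e; rewrite !inE => /andP[-> /sM ->].
  - by move=> e1 e2; rewrite !inE => /andP[_ M1] /andP[_ M2]; apply: inj.
have [M1 mM1 <-] := matching_number_witness E1.
have [M2 mM2 <-] := matching_number_witness E2.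
move/is_matchingP: mM1 => [/fintype.subsetP sM1 inj1].
move/is_matchingP: mM2 => [/fintype.subsetP sM2 inj2].
have dis e1 e2 : e1 \in M1 -> e2 \in M2 -> e1.1 != e2.1 /\ e1.2 != e2.2.
  case: e1 e2 => [i1 k1] [i2 k2] /sM1 + /sM2; rewrite !inE /=.
  move=> /andP[E1e K1] /andP[E2e K2]; split.
    apply/eqP => ii; subst i2; move: K2; rewrite (noncross _ _ _ E1e E2e K1) //.
  by apply: contraNneq K2 => <-.
have <- : #|M1 :|: M2| = #|M1| + #|M2|.
  apply/eqP; rewrite (leq_card_setU M1 M2).2; apply/pred0P => e /=.
  by apply/negP => /andP[e1 e2]; have [] := dis _ _ e1 e2; rewrite eqxx.
apply: matching_number_geq; apply/is_matchingP; split.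
  rewrite finset.subUset; apply/andP; split; apply/fintype.subsetP => e.
    by move/sM1; rewrite inE => /andP[].
  by move/sM2; rewrite inE => /andP[].
move=> e1 e2; rewrite !inE => /orP[a|a] /orP[b|b].
- exact: inj1.
- by move=> _; apply: dis.
- by move=> _; have [] := dis _ _ b a; rewrite eq_sym => ->; rewrite eq_sym => ->.
- exact: inj2.
Qed.

(** The matching number is additive over the two sides of [K], and deleting [k] affects only the
    outer side. Applied with [E] and [E'] differing by one supply whose neighbours all lie in
    [K]. *)
Lemma missable_off_cluster E E' K k :
  (forall i k l, (i, k) \in E -> (i, l) \in E -> k \in K -> l \in K) ->
  (forall i k l, (i, k) \in E' -> (i, l) \in E' -> k \in K -> l \in K) ->
  (forall i l, l \notin K -> ((i, l) \in E) = ((i, l) \in E')) ->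
  k \notin K -> missable E k = missable E' k.
Proof.
have key (F : {set U * V}) : (forall i k l, (i, k) \in F -> (i, l) \in F -> k \in K -> l \in K) ->
    k \notin K -> missable F k = missable [set e in F | e.2 \notin K]%SET k.
  move=> noncross kK; rewrite /missable (@matching_number_split F K) //.
  rewrite (@matching_number_split (delete_demand F k) K); last first.
    by move=> i k1 k2; rewrite !inE => /andP[+ _] /andP[+ _]; apply: noncross.
  have -> : [set e in delete_demand F k | e.2 \in K]%SET = [set e in F | e.2 \in K]%SET.
    apply/finset.setP => e; rewrite !inE; case: (boolP (e.2 == k)) => [/eqP ->|]; last by rewrite andbT.
    by rewrite (negbTE kK) !andbF.
  rewrite eqn_add2l; congr (matching_number _ == _).
  by apply/finset.setP => e; rewrite !inE andbAC.
move=> nE nE' EE' kK; rewrite (key E) // (key E') //.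
congr missable; apply/finset.setP => -[i l]; rewrite !inE /=.
by case: (boolP (l \in K)) => [|lK]; rewrite ?andbF // EE'.
Qed.

Lemma missable_isolated E k : (forall i, (i, k) \notin E) -> missable E k.
Proof.
move=> iso; rewrite /missable; apply/eqP; congr matching_number.
apply/finset.setP => -[i l]; rewrite !inE /=; case: eqP => [->|]; last by rewrite andbT.
by rewrite (negbTE (iso i)).
Qed.

Lemma leq_matching_number_inj (f : U -> U) E : injective f ->
  matching_number [set e : U * V | (f e.1, e.2) \in E]%SET <= matching_number E.
Proof.
move=> f_inj; apply: matching_number_leq => M /is_matchingP [/fintype.subsetP sM inj].
pose F (e : U * V) := (f e.1, e.2).
have F_inj : injective F by move=> [i k] [i' k'] [/f_inj -> ->].
rewrite -(card_imset (mem M) F_inj); apply: matching_number_geq.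
apply/is_matchingP; split.
  by apply/fintype.subsetP => _ /imsetP [e /sM + ->]; rewrite inE.
move=> _ _ /imsetP [e1 M1 ->] /imsetP [e2 M2 ->].
by rewrite (inj_eq F_inj) => /(inj _ _ M1 M2) []; rewrite /= (inj_eq f_inj).
Qed.

(** Serves to permute the supplies, hence to sort the ranges. *)
Lemma matching_number_relabel (f g : U -> U) E : cancel f g -> cancel g f ->
  matching_number [set e : U * V | (f e.1, e.2) \in E]%SET = matching_number E.
Proof.
move=> fg gf; apply/eqP; rewrite eqn_leq leq_matching_number_inj /=; last exact: can_inj fg.
set E' := [set e | _]%SET.
rewrite (_ : E = [set e : U * V | (g e.1, e.2) \in E']%SET).
  by apply: leq_matching_number_inj; exact: can_inj gf.
by apply/finset.setP => -[i k]; rewrite !inE /= gf.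
Qed.
End Matching.

(** * Majorization by transfers *)

Section Transfers.
Variables (R : realFieldType) (n : nat).
Implicit Types p q : 'I_n -> R.

Definition transfer p (i j : 'I_n) (e : R) : 'I_n -> R :=
  fun k => if k == i then p i - e else if k == j then p j + e else p k.

Definition sqsum p : R := \sum_k p k ^+ 2.

(** [G] may depend on the index and [P] may select a prefix, so that this covers sums of squares,
    prefix sums and l1 distances to a fixed vector. *)
Lemma sum_transfer (A : comRingType) (G : R -> 'I_n -> A) p i j e (P : pred 'I_n) :
  i != j ->
  \sum_(k | P k) G (transfer p i j e k) k = \sum_(k | P k) G (p k) k
    + (G (p i - e) i - G (p i) i) *+ P i + (G (p j + e) j - G (p j) j) *+ P j.
Proof.
move=> ij.
have ev (f : 'I_n -> A) k : \sum_(l | P l) f l *+ (l == k) = f k *+ P k.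
  rewrite big_mkcond (bigD1 k) //= eqxx mulr1n big1 ?addr0; first by case: (P k).
  by move=> l /negbTE ->; rewrite mulr0n if_same.
rewrite -(ev (fun k => G (p k - e) k - G (p k) k)) -(ev (fun k => G (p k + e) k - G (p k) k)).
rewrite -!big_split /=; apply: eq_bigr => k _; rewrite /transfer.
case: eqP => [->|_]; first by rewrite (negbTE ij) mulr1n mulr0n addr0 addrC subrK.
by case: eqP => [->|_]; rewrite ?mulr1n ?mulr0n ?addr0 // addrC subrK.
Qed.

Lemma sqsum_transfer p i j e : i != j ->
  sqsum p - sqsum (transfer p i j e) = 2 * e * (p i - p j - e).
Proof.
move=> ij; rewrite /sqsum (@sum_transfer R (fun x _ => x ^+ 2)) //= !mulr1n.
ring.
Qed.

Lemma transfer_half p i j e : i != j ->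
  transfer (transfer p i j (e / 2)) i j (e / 2) = transfer p i j e.
Proof.
move=> ij; apply/funext => k; rewrite /transfer eqxx [j == i]eq_sym (negbTE ij) eqxx.
case: eqP => _; first by field.
by case: eqP => _ //; field.
Qed.

(** Induction on the number of coordinates where [p] and [q] differ. Each transfer of [e] brings [p]
    closer to [q] by exactly [2 * e] in l1 norm, whence the factor [b / 2]; the decreases of [sqsum]
    telescope. Only [q] is sorted, since a transfer may destroy the order of [p]. *)
Lemma transfer_majorized (F : ('I_n -> R) -> R) (a b lam : R) p q :
  (forall p (i j : 'I_n) (e : R), i != j -> 0 <= e -> (forall k, 0 <= p k <= lam) ->
     2 * e <= p i - p j ->
     F p + a * (sqsum p - sqsum (transfer p i j e)) - b * e
       <= F (transfer p i j e)) ->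
  (forall k, 0 <= p k <= lam) ->
  (forall i j : 'I_n, (i <= j)%N -> q j <= q i) ->
  (forall l, \sum_(k < n | (k < l)%N) q k <= \sum_(k < n | (k < l)%N) p k) ->
  \sum_k p k = \sum_k q k ->
  F p + a * (sqsum p - sqsum q) - b / 2 * \sum_k `|p k - q k| <= F q.
Proof.
move=> step + q_sorted.
have [N] := ubnP #|[pred k | p k != q k]|.
elim: N p => // N IH p; rewrite ltnS => cardN p_range dom tot.
case: (boolP [exists j, p j < q j]) => [ex|/existsPn none]; last first.
  suff -> : p = q by rewrite subrr mulr0 big1 ?mulr0 ?subr0 ?addr0 // => k _; rewrite subrr normr0.
  apply/funext => k.
  have /eqP : \sum_k (p k - q k) = 0 by rewrite big_split sumrN /= tot subrr.
  rewrite psumr_eq0 => [/allP /(_ k)|l _]; last by rewrite subr_ge0 leNgt none.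
  by rewrite mem_index_enum /= subr_eq0 => /(_ isT)/eqP.
have [j0 j0P] := existsP ex.
(* [j] is the first coordinate in deficit; domination of the prefix ending at [j] then forces a
   coordinate in excess before it. *)
have [j pqj jmin] := @arg_minnP _ j0 (fun j => p j < q j) (fun j => nat_of_ord j) j0P.
have below (k : 'I_n) : (k < j)%N -> q k <= p k.
  by move=> kj; rewrite leNgt; apply/negP => /jmin; rewrite leqNgt kj.
have [i /andP[ij pqi]] : exists i : 'I_n, (i < j)%N && (q i < p i).
  apply/existsP; apply: contraT => /existsPn none.
  have := dom j.+1; rewrite leNgt => /negP; case.
  rewrite (bigD1 j) //= [ltRHS](bigD1 j) //=; apply: ltr_leD => //.
  apply: ler_sum => k /andP[kj kneqj]; rewrite leNgt; apply/negP => pqk.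
  by have := none k; rewrite pqk andbT ltn_neqAle kneqj -ltnS kj.
have neij : i != j by rewrite -val_eqE neq_ltn ij.
(* The largest amount that overshoots neither target: one of the two coordinates becomes final.
   Since [q j <= q i], it is at most half of [p i - p j]. *)
pose e := Num.min (p i - q i) (q j - p j).
have e_gt0 : 0 < e by rewrite lt_min !subr_gt0 pqi pqj.
have ei : e <= p i - q i by rewrite ge_min lexx.
have ej : e <= q j - p j by rewrite ge_min lexx orbT.
have qij := q_sorted _ _ (ltnW ij).
have gap : 2 * e <= p i - p j by lra.
set p' := transfer p i j e.
have p'i : p' i = p i - e by rewrite /p' /transfer eqxx.
have p'j : p' j = p j + e by rewrite /p' /transfer eq_sym (negbTE neij) eqxx.
have p'k k : k != i -> k != j -> p' k = p k.
  by move=> /negbTE ki /negbTE kj; rewrite /p' /transfer ki kj.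
have /andP[pi0 pi1] := p_range i; have /andP[pj0 pj1] := p_range j.
have p'_range k : 0 <= p' k <= lam.
  have [->|ki] := eqVneq k i; first by rewrite p'i; lra.
  have [->|kj] := eqVneq k j; first by rewrite p'j; lra.
  by rewrite p'k.
have card' : (#|[pred k | p' k != q k]| < N)%N.
  apply: leq_trans cardN; apply: proper_card; apply/properP; split.
    apply/fintype.subsetP => k; rewrite !inE.
    have [->|ki] := eqVneq k i; first by rewrite (gt_eqF pqi).
    have [->|kj] := eqVneq k j; first by rewrite (lt_eqF pqj).
    by rewrite p'k.
  have [le|lt] := leP (p i - q i) (q j - p j).
    exists i; rewrite !inE; first by rewrite (gt_eqF pqi).
    by rewrite p'i /e (min_idPl le) negbK subKr.
  exists j; rewrite !inE; first by rewrite (lt_eqF pqj).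
  by rewrite p'j /e (min_idPr (ltW lt)) negbK addrC subrK.
have dom' l : \sum_(k < n | (k < l)%N) q k <= \sum_(k < n | (k < l)%N) p' k.
  rewrite (@sum_transfer R (fun x _ => x)) //=.
  rewrite (_ : p i - e - p i = - e); last by ring.
  rewrite (_ : p j + e - p j = e); last by ring.
  (* Only the prefixes containing [i] but not [j] lose [e]. Before [j] no coordinate is in deficit,
     so these are dominated term by term. *)
  have [jl|lj] := ltnP j l.
    by rewrite (ltn_trans ij jl) !mulr1n subrK dom.
  rewrite mulr0n addr0.
  have [il|] := ltnP i l; last by rewrite mulr0n addr0 dom.
  rewrite mulr1n (bigD1 i) //= [in leRHS](bigD1 i) //= addrAC.
  apply: lerD; first by lra.
  by apply: ler_sum => k /andP[kl _]; apply: below; apply: leq_trans lj.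
have tot' : \sum_k p' k = \sum_k q k.
  rewrite (@sum_transfer R (fun x _ => x)) //= tot; ring.
have := IH p' card' p'_range dom' tot'.
have := step p i j e neij (ltW e_gt0) p_range gap; rewrite -/p'.
suff -> : \sum_k `|p' k - q k| = \sum_k `|p k - q k| - 2 * e by lra.
rewrite (@sum_transfer R (fun x k => `|x - q k|)) //= !mulr1n.
rewrite (_ : `|p i - e - q i| = p i - e - q i); last by rewrite ger0_norm; lra.
rewrite (_ : `|p i - q i| = p i - q i); last by rewrite ger0_norm; lra.
rewrite (_ : `|p j + e - q j| = q j - p j - e); last by rewrite ler0_norm; lra.
rewrite (_ : `|p j - q j| = q j - p j); last by rewrite ler0_norm; lra.
ring.
Qed.

(** Summation by parts; the induction keeps the last weight times the current partial sum as a lower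
    bound. *)
Lemma abel_sum_ge0 (m : nat) (d w : nat -> R) :
  (forall l, (l <= m)%N -> 0 <= \sum_(k < l) d k) ->
  (forall k, (k.+1 < m)%N -> w k.+1 <= w k) -> (0 <= w m.-1) ->
  0 <= \sum_(k < m) w k * d k.
Proof.
case: m => [|m] Sd w_dec w_ge0; first by rewrite big_ord0.
suff gen l : (l <= m)%N ->
    w l * \sum_(k < l.+1) d k <= \sum_(k < l.+1) w k * d k.
  by apply: le_trans (gen m (leqnn m)); apply: mulr_ge0 => //; apply: Sd.
elim: l => [|l IH] lm; first by rewrite !big_ord1.
rewrite big_ord_recr [leRHS]big_ord_recr /= mulrDr lerD2r.
apply: le_trans (IH (ltnW lm)); apply: ler_wpM2r; first exact/Sd/ltnW.
exact: w_dec.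
Qed.

Lemma sqsum_majorized p q :
  (forall i j : 'I_n, (i <= j)%N -> q j <= q i) ->
  (forall l, \sum_(k < n | (k < l)%N) q k <= \sum_(k < n | (k < l)%N) p k) ->
  (forall k, 0 <= q k) ->
  (\sum_k `|p k - q k|) ^+ 2 <= n%:R * (sqsum p - sqsum q).
Proof.
move=> q_sorted dom q_ge0.
have cross : 0 <= \sum_k q k * (p k - q k).
  case: n p q q_sorted dom q_ge0 => [|N] p q q_sorted dom q_ge0; first by rewrite big_ord0.
  pose w k := q (inord k); pose d k := p (inord k) - q (inord k).
  rewrite (eq_bigr (fun k : 'I_N.+1 => w k * d k)); last first.
    by move=> k _; rewrite /w /d inord_val.
  apply: abel_sum_ge0 => [l lN|k kN|]; last exact: q_ge0.
    have := dom l; rewrite -subr_ge0 -sumrB.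
    rewrite (big_ord_widen_cond _ predT d lN) /=.
    by congr (_ <= _); apply: eq_bigr => k _; rewrite /d inord_val.
  by apply: q_sorted; rewrite !inordK // ltnW.
(* The two sides differ by twice the sum of [q k * (p k - q k)], nonnegative by summation by parts
   against the nonincreasing weights [q]. *)
have sq : \sum_k (p k - q k) ^+ 2 <= sqsum p - sqsum q.
  rewrite /sqsum -sumrB -subr_ge0 -sumrB.
  rewrite (eq_bigr (fun k => (q k * (p k - q k)) *+ 2)); last by move=> k _; ring.
  by rewrite sumrMnl mulrn_wge0.
apply: le_trans (ler_wpM2l (ler0n _ _) sq).
pose S := \sum_k `|p k - q k|.
(* Cauchy-Schwarz in the form of a nonnegative variance. *)
have : 0 <= \sum_k (n%:R * `|p k - q k| - S) ^+ 2 by apply: sumr_ge0 => k _; apply: sqr_ge0.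
rewrite (eq_bigr (fun k => n%:R ^+ 2 * (p k - q k) ^+ 2 - (2 * n%:R * S) * `|p k - q k| + S ^+ 2)); last first.
  by move=> k _; rewrite -(real_normK (num_real (p k - q k))); ring.
rewrite big_split /= sumr_const card_ord sumrB -!mulr_sumr -/S -mulr_natl.
set T := \sum_i _ ^+ 2; case: (posnP n) => [n0|n_gt0].
  have -> : S = 0.
    apply: big1 => k _; have : (0 < n)%N by apply: leq_ltn_trans (ltn_ord k).
    by rewrite n0.
  by rewrite expr0n /= mulr_ge0 // sumr_ge0 // => k _; exact: sqr_ge0.
have : 0 < n%:R :> R by rewrite ltr0n.
nra.
Qed.
End Transfers.

(** * Product laws *)

Section MeasurablePredicates.
Context d (T : measurableType d) (R : realType).
Implicit Types b : T -> bool.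

Lemma measurable_predP b : measurable_fun setT b <-> measurable [set x | b x].
Proof.
split=> [mb|mb].
  by rewrite -[X in measurable X]setTI; apply: (mb measurableT [set true]).
by apply: (@measurable_fun_bool _ _ _ _ true); rewrite setTI.
Qed.

Lemma measurable_fun_forall (J : finType) (b : J -> T -> bool) :
  (forall j, measurable_fun setT (b j)) ->
  measurable_fun setT (fun x => [forall j, b j x]).
Proof.
move=> mb; apply/measurable_predP.
rewrite (_ : [set x | _] = \bigcap_(j in [set: J]) [set x | b j x]); last first.
  apply/seteqP; split=> x /= h; first by move=> j _; apply: (forallP h).
  by apply/forallP => j; apply: h.
apply: fin_bigcap_measurable => [|j _]; first exact: finite_finset.
exact/measurable_predP.
Qed.

Lemma measurable_fun_exists (J : finType) (b : J -> T -> bool) :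
  (forall j, measurable_fun setT (b j)) ->
  measurable_fun setT (fun x => [exists j, b j x]).
Proof.
move=> mb; rewrite (_ : (fun x => _) = (fun x => ~~ [forall j, ~~ b j x])).
  by apply: measurable_neg; apply: measurable_fun_forall => j; apply: measurable_neg.
by apply/funext => x; rewrite negb_forall; apply: eq_existsb => j; rewrite negbK.
Qed.

Lemma measurable_fun_imply b1 b2 : measurable_fun setT b1 -> measurable_fun setT b2 ->
  measurable_fun setT (fun x => b1 x ==> b2 x).
Proof.
move=> m1 m2; rewrite (_ : (fun x => _) = (fun x => ~~ b1 x || b2 x)).
  by apply: measurable_or => //; apply: measurable_neg.
by apply/funext => x; rewrite implybE.
Qed.

(** A random finite set takes finitely many values, so any property of it is measurable as soon as
    memberships are. This reduces matching properties to single edges. *)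
Lemma measurable_fun_finset (J : finType) (E : T -> {set J}) (g : {set J} -> bool) :
  (forall j, measurable_fun setT (fun x => j \in E x)) ->
  measurable_fun setT (fun x => g (E x)).
Proof.
move=> mE.
rewrite (_ : (fun x => _) =
    (fun x => [exists A : {set J}, [forall j, (j \in E x) == (j \in A)] && g A])).
  apply: measurable_fun_exists => A; apply: measurable_and; last exact: measurable_cst.
  apply: measurable_fun_forall => j; case: (j \in A).
    by under eq_fun do rewrite eqb_id; exact: mE.
  by under eq_fun do rewrite eqbF_neg; apply: measurable_neg.
apply/funext => x; apply/idP/existsP => [gE|[A /andP[/forallP EA]]].
  by exists (E x); rewrite gE andbT; apply/forallP.
by rewrite (_ : E x = A) //; apply/finset.setP => j; apply/eqP.
Qed.
End MeasurablePredicates.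

(** * Expectations of bounded measurable functions *)

Section BoundedExpectation.
Context d (T : measurableType d) (R : realType) (P : probability T R).
Implicit Types (f g : T -> R) (b : T -> bool).

Definition pr (A : set T) : R := fine (P A).

Lemma prE A : measurable A -> P A = (pr A)%:E.
Proof. by move=> mA; rewrite fineK // fin_num_measure. Qed.

Lemma pr_ge0 A : 0 <= pr A.
Proof. exact/fine_ge0/measure_ge0. Qed.

Lemma pr_le1 A : measurable A -> pr A <= 1.
Proof. by move=> mA; rewrite -lee_fin -prE // probability_le1. Qed.

Lemma pr_setC A : measurable A -> pr (~` A) = 1 - pr A.
Proof.
move=> mA; apply: EFin_inj; rewrite -prE; last exact: measurableC.
by rewrite EFinB -prE // probability_setC.
Qed.

Lemma le_pr A B : measurable A -> measurable B -> A `<=` B -> pr A <= pr B.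
Proof. by move=> mA mB AB; rewrite -lee_fin -!prE // le_measure // inE. Qed.

Definition bounded_measurable f :=
  measurable_fun setT f /\ exists C, forall x, `|f x| <= C.

Lemma bounded_measurable_integrable (D : set T) f :
  measurable D -> bounded_measurable f -> P.-integrable D (EFin \o f).
Proof.
move=> mD [mf [C fC]]; apply: measurable_bounded_integrable => //.
- by apply: (le_lt_trans (probability_le1 _ mD)); rewrite ltry.
- exact: measurable_funTS.
- by exists C; split; rewrite ?num_real // => y Cy x _; apply: le_trans (fC x) (ltW Cy).
Qed.

Lemma bounded_measurableD f g : bounded_measurable f -> bounded_measurable g ->
  bounded_measurable (fun x => f x + g x).
Proof.
move=> [mf [C fC]] [mg [C' gC]]; split; first exact: measurable_funD.
by exists (C + C') => x; apply: le_trans (ler_normD _ _) (lerD _ _).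
Qed.

Lemma bounded_measurableZ c f : bounded_measurable f ->
  bounded_measurable (fun x => c * f x).
Proof.
move=> [mf [C fC]]; split; first exact: measurable_funM.
by exists (`|c| * C) => x; rewrite normrM ler_wpM2l.
Qed.

Lemma bounded_measurable_cst c : bounded_measurable (fun=> c).
Proof. by split; [exact: measurable_cst|exists `|c|]. Qed.

Lemma bounded_measurableB f g : bounded_measurable f -> bounded_measurable g ->
  bounded_measurable (fun x => f x - g x).
Proof.
move=> bf bg; rewrite (_ : (fun x => _) = (fun x => f x + (-1) * g x)).
  exact/bounded_measurableD/bounded_measurableZ.
by apply/funext => x; rewrite mulN1r.
Qed.

Lemma bounded_measurable_sum (J : Type) (s : seq J) (F : J -> T -> R) :
  (forall j, bounded_measurable (F j)) ->
  bounded_measurable (fun x => \sum_(j <- s) F j x).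
Proof.
move=> bF; elim: s => [|j s IH].
  by under eq_fun do rewrite big_nil; exact: bounded_measurable_cst.
by under eq_fun do rewrite big_cons; exact: bounded_measurableD.
Qed.

Lemma bounded_measurable_bool b : measurable_fun setT b ->
  bounded_measurable (fun x => (b x)%:R).
Proof.
move=> /measurable_predP mb; rewrite (_ : (fun x => _) = \1_[set x | b x]); last first.
  by apply/funext => x; rewrite indicE; congr (nat_of_bool _)%:R; apply/idP/idP; rewrite in_setE.
split; first exact: measurable_indic.
by exists 1 => x; rewrite indicE normr_nat; case: (_ \in _).
Qed.

Variables (D : set T) (mD : measurable D) (PD : P D = 1%E).

(** Integrating over a set [D] of full measure allows pointwise comparisons that hold on [D] only;
    below, [D] is the cube where all locations lie in [0, 1]. *)
Definition Ex f : R := \int[P]_(x in D) f x.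

Lemma ExD f g : bounded_measurable f -> bounded_measurable g ->
  Ex (fun x => f x + g x) = Ex f + Ex g.
Proof. by move=> bf bg; apply: RintegralD => //; apply: bounded_measurable_integrable. Qed.

Lemma ExB f g : bounded_measurable f -> bounded_measurable g ->
  Ex (fun x => f x - g x) = Ex f - Ex g.
Proof. by move=> bf bg; apply: RintegralB => //; apply: bounded_measurable_integrable. Qed.

Lemma ExZ c f : bounded_measurable f -> Ex (fun x => c * f x) = c * Ex f.
Proof. by move=> bf; apply: RintegralZl => //; apply: bounded_measurable_integrable. Qed.

Lemma Ex_cst c : Ex (fun=> c) = c.
Proof.
transitivity (c * fine (P D)); first exact: Rintegral_cst.
by rewrite PD mulr1.
Qed.

Lemma Ex_le f g : bounded_measurable f -> bounded_measurable g ->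
  (forall x, D x -> f x <= g x) -> Ex f <= Ex g.
Proof. by move=> bf bg; apply: le_Rintegral => //; apply: bounded_measurable_integrable. Qed.

Lemma Ex_sum (J : Type) (s : seq J) (F : J -> T -> R) :
  (forall j, bounded_measurable (F j)) ->
  Ex (fun x => \sum_(j <- s) F j x) = \sum_(j <- s) Ex (F j).
Proof.
move=> bF; elim: s => [|j s IH].
  by rewrite big_nil; under eq_fun do rewrite big_nil; rewrite Ex_cst.
rewrite big_cons -IH; under eq_fun do rewrite big_cons.
by rewrite ExD //; exact: bounded_measurable_sum.
Qed.

Lemma pr_setI A : measurable A -> P (A `&` D) = P A.
Proof.
move=> mA; have PAD : P (A `\` D) = 0%E.
  apply/eqP; rewrite -measure_le0.
  have -> : 0%E = P (~` D) by rewrite probability_setC // PD subee.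
  by apply: le_measure; rewrite ?inE; [exact: measurableD|exact: measurableC|move=> x []].
transitivity (P (A `\` D) + P (A `&` D))%E; first by rewrite PAD add0e.
exact/esym/measureDI.
Qed.

Lemma Ex_bool b : measurable_fun setT b -> Ex (fun x => (b x)%:R) = pr [set x | b x].
Proof.
move=> /measurable_predP mb; rewrite /Ex /Rintegral /pr -(pr_setI mb) -integral_indic //.
congr fine; apply: eq_integral => x _; congr (_%:E); rewrite indicE.
by congr (nat_of_bool _)%:R; apply/idP/idP; rewrite in_setE.
Qed.

Lemma pr_le_sum (J : Type) (s : seq J) b (c : J -> T -> bool) :
  measurable_fun setT b -> (forall j, measurable_fun setT (c j)) ->
  (forall x, D x -> b x -> has (c ^~ x) s) ->
  pr [set x | b x] <= \sum_(j <- s) pr [set x | c j x].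
Proof.
move=> mb mc bc; rewrite -(Ex_bool mb).
under eq_bigr do rewrite -(Ex_bool (mc _)).
rewrite -Ex_sum => [|j]; last exact: bounded_measurable_bool.
apply: Ex_le; first exact: bounded_measurable_bool.
  by apply: bounded_measurable_sum => j; exact: bounded_measurable_bool.
move=> x Dx; case: (boolP (b x)) => [bx|_]; last by apply: sumr_ge0 => j _; exact: ler0n.
move: (bc x Dx bx); elim: (s) => //= j s' IH; rewrite big_cons.
case: (c j x) => [_|/= /IH h]; last by rewrite add0r.
by rewrite lerDl; apply: sumr_ge0 => i _; exact: ler0n.
Qed.

Lemma pr_le_pred b (c : T -> bool) : measurable_fun setT b -> measurable_fun setT c ->
  (forall x, D x -> b x -> c x) -> pr [set x | b x] <= pr [set x | c x].
Proof.
move=> mb mc bc.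
have := @pr_le_sum bool [:: true] b (fun=> c) mb (fun=> mc).
by rewrite big_seq1; apply=> x Dx /(bc x Dx) /= ->.
Qed.

Lemma pr_neg b : measurable_fun setT b ->
  pr [set x | ~~ b x] = 1 - pr [set x | b x].
Proof.
move=> mb; rewrite -(Ex_bool (measurable_neg mb)) -(Ex_bool mb).
transitivity (Ex (fun x => 1 - (b x)%:R)).
  by congr Ex; apply/funext => x; case: (b x); rewrite ?subrr ?subr0.
rewrite ExB ?Ex_cst //; first exact: bounded_measurable_cst.
exact: bounded_measurable_bool.
Qed.

Lemma Ex_setT f : bounded_measurable f -> Ex f = \int[P]_x f x.
Proof.
move=> bf; rewrite /Ex /Rintegral; congr fine.
rewrite [RHS](@negligible_integral _ _ _ P setT (~` D)) ?setTD ?setCK //.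
- exact: measurableC.
- exact: bounded_measurable_integrable.
- by transitivity (1 - P D)%E; [exact: probability_setC|rewrite PD subee].
Qed.
End BoundedExpectation.

(** * Product laws on finite families of reals and resampling of one coordinate *)

Section ProductLaw.
Variables (R : realType) (I : finType).

Definition box (A : I -> set R) : set (I -> R) := [set x | forall k, A k (x k)].

Definition boxes : set (set (I -> R)) :=
  [set B | exists2 A, (forall k, measurable (A k)) & B = box A].

(** The product sigma-algebra on [I -> R]. Boxes are closed under intersection, so a finite measure
    is determined by its values on them. *)
Definition locspace := g_sigma_algebraType boxes.
HB.instance Definition _ := Measurable.on locspace.

Lemma measurable_box (A : I -> set R) :
  (forall k, measurable (A k)) -> measurable (box A : set locspace).
Proof. by move=> mA; apply: sub_sigma_algebra; exists A. Qed.

Lemma boxes_setI : setI_closed boxes.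
Proof.
move=> _ _ [A mA ->] [B mB ->]; exists (fun k => A k `&` B k).
  by move=> k; apply: measurableI.
apply/seteqP; split=> x; first by move=> [h1 h2] k; split.
by move=> h; split=> k; have [] := h k.
Qed.

Lemma boxes_setT : boxes setT.
Proof. exists (fun=> setT); first by [].
by apply/seteqP; split. Qed.

Lemma measurable_coordinate k : measurable_fun setT (fun x : locspace => x k).
Proof.
move=> _ A mA; rewrite setTI.
rewrite (_ : _ @^-1` _ = box (fun l => if l == k then A else setT)).
  by apply: measurable_box => l; case: ifP.
apply/seteqP; split=> x /= => [h l|/(_ k)]; last by rewrite eqxx.
by case: eqP => // ->.
Qed.

Lemma measurable_fun_locspace d (T : measurableType d) (f : T -> locspace) :
  (forall k, measurable_fun setT (fun t => f t k)) -> measurable_fun setT f.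
Proof.
move=> mf; apply: (@measurability _ _ T locspace setT f boxes) => // _ [_ [A mA ->] <-].
rewrite setTI (_ : _ @^-1` _ = \bigcap_(k in [set: I]) ((fun t => f t k) @^-1` A k)).
  apply: fin_bigcap_measurable => [|k _]; first exact: finite_finset.
  by rewrite -[X in measurable X]setTI; apply: mf.
by apply/seteqP; split=> x /= h => [k _|k]; apply: h.
Qed.

Definition update (x : I -> R) k z : I -> R := fun l => if l == k then z else x l.

Variable D : I -> probability R R.

Definition product_law (L : probability locspace R) :=
  forall A : I -> set R, (forall k, measurable (A k)) ->
    L (box A) = (\prod_k D k (A k))%E.

Lemma product_law_unique (L L' : {measure set locspace -> \bar R}) :
  (forall A : I -> set R, (forall k, measurable (A k)) -> L (box A) = L' (box A)) ->
  (L setT < +oo)%E -> forall A, measurable A -> L A = L' A.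
Proof.
move=> LL' Lfin; apply: (@measure_unique _ R locspace boxes (fun=> setT)) => //.
- exact: boxes_setI.
- by move=> _; exact: boxes_setT.
- by rewrite bigcup_const //; exists 0%N.
- by move=> _ [A mA ->]; apply: LL'.
Qed.

Variables (L : probability locspace R) (HL : product_law L).

Lemma pr_box (A : I -> set R) : (forall k, measurable (A k)) ->
  pr L (box A) = \prod_k pr (D k) (A k).
Proof.
move=> mA; rewrite /pr HL // (eq_bigr (fun k => (pr (D k) (A k))%:E)); last first.
  by move=> k _; apply: prE.
by rewrite -(big_morph EFin (@EFinM R) (erefl _)).
Qed.

Lemma measurable_fun_update k :
  measurable_fun setT (fun p : locspace * R => update p.1 k p.2 : locspace).
Proof.
apply: measurable_fun_locspace => l; rewrite /update; case: eqP => _.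
  exact: measurable_snd.
apply: (measurableT_comp (measurable_coordinate l)); exact: measurable_fst.
Qed.

Lemma measurable_section_loc (B : set locspace) k z : measurable B ->
  measurable [set x : locspace | B (update x k z)].
Proof.
move=> mB; have := measurable_fun_update k; move=> /(_ measurableT _ mB).
rewrite setTI => /measurable_ysection => /(_ z).
by congr measurable; apply/seteqP; split=> x /=; rewrite /ysection /= inE.
Qed.

Lemma measurable_section_val (B : set locspace) k (x : I -> R) : measurable B ->
  measurable [set z : R | B (update x k z)].
Proof.
move=> mB; have := measurable_fun_update k; move=> /(_ measurableT _ mB).
rewrite setTI => /measurable_xsection => /(_ x).
by congr measurable; apply/seteqP; split=> z /=; rewrite /xsection /= inE.
Qed.

Lemma update_preimage_box (A : I -> set R) k :
  (fun p : locspace * R => update p.1 k p.2) @^-1` (box A) =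
  box (fun l => if l == k then setT else A l) `*` A k.
Proof.
apply/seteqP; split=> -[x z] /=.
  move=> h; split=> [l|]; last by have := h k; rewrite /update eqxx.
  by have := h l; rewrite /update; case: eqP.
by move=> [h Az] l; have := h l; rewrite /update; case: eqP => // ->.
Qed.

Lemma product_law_box_split (A : I -> set R) k : (forall l, measurable (A l)) ->
  (L (box (fun l => if l == k then setT else A l)) * D k (A k))%E = L (box A).
Proof.
move=> mA; rewrite !HL // => [|l]; last by case: ifP.
rewrite (bigD1 k) //= eqxx probability_setT mul1e [RHS](bigD1 k) //= muleC.
by congr (_ * _)%E; apply: eq_bigr => l /negbTE ->.
Qed.

(** Replacing coordinate [k] by an independent draw from [D k] preserves the law, as seen on boxes;
    this is then Fubini with the new draw integrated first. [resample_loc] is the other order, that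
    is, conditioning on coordinate [k]. *)
Lemma resample_val k (B : set locspace) : measurable B ->
  L B = (\int[L]_x D k [set z | B (update x k z)])%E.
Proof.
move=> mB; pose f p : locspace := update p.1 k p.2.
have mf : measurable_fun [set: locspace * R] f := measurable_fun_update k.
transitivity (pushforward (L \x D k)%E f B); last first.
  by apply: eq_integral => x _; congr (D k _); apply/seteqP; split=> z /=;
    rewrite /xsection /= inE.
apply: product_law_unique => //; last by apply: (le_lt_trans (probability_le1 _ _)); rewrite ?ltry.
move=> A mA; rewrite /= /pushforward update_preimage_box product_measure1E //.
  by rewrite product_law_box_split.
by apply: measurable_box => l; case: ifP.
Qed.

Lemma resample_loc k (B : set locspace) : measurable B ->
  L B = (\int[D k]_z L [set x | B (update x k z)])%E.
Proof.
move=> mB; pose f p : locspace := update p.1 k p.2.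
have mf : measurable_fun [set: locspace * R] f := measurable_fun_update k.
transitivity (pushforward (L \x^ D k)%E f B); last first.
  by apply: eq_integral => z _; congr (L _); apply/seteqP; split=> x /=;
    rewrite /ysection /= inE.
apply: product_law_unique => //; last by apply: (le_lt_trans (probability_le1 _ _)); rewrite ?ltry.
move=> A mA; rewrite /= /pushforward update_preimage_box product_measure2E //.
  by rewrite product_law_box_split.
by apply: measurable_box => l; case: ifP.
Qed.

Hypothesis D01 : forall k, D k `[0, 1]%classic = 1%E.

Definition cube : set locspace := box (fun=> `[0, 1]%classic).

Lemma measurable_cube : measurable cube.
Proof. by apply: measurable_box => k; exact: measurable_itv. Qed.

Lemma pr_cube : L cube = 1%E.
Proof.
rewrite HL => [|k]; last exact: measurable_itv.
by rewrite big1.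
Qed.

Implicit Types b : locspace -> bool.

Lemma measurable_pred_val b k (x : I -> R) : measurable_fun setT b ->
  measurable [set z : R | b (update x k z)].
Proof. by move=> /measurable_predP mb; exact: (@measurable_section_val [set x : locspace | b x]). Qed.

Lemma measurable_pred_loc b k (z : R) : measurable_fun setT b ->
  measurable_fun setT (fun x : locspace => b (update x k z)).
Proof.
move=> /measurable_predP mb; apply/measurable_predP.
exact: (@measurable_section_loc [set x : locspace | b x]).
Qed.

Lemma bounded_measurable_section k b : measurable_fun setT b ->
  bounded_measurable (fun x : locspace => pr (D k) [set z | b (update x k z)]).
Proof.
move=> mb; have /measurable_predP mB := mb; split; last first.
  exists 1 => x; rewrite ger0_norm ?pr_ge0 // pr_le1 //.
  exact: measurable_pred_val.
apply: (measurableT_comp (@fine_measurable R setT measurableT)).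
have := measurable_fun_update k; move=> /(_ measurableT _ mB); rewrite setTI.
move=> /(measurable_fun_xsection (D k)); congr measurable_fun.
by apply/funext => x /=; congr (D k _); apply/seteqP; split=> z /=;
  rewrite /xsection /= inE.
Qed.

Lemma Ex_resample k b : measurable_fun setT b ->
  pr L [set x : locspace | b x] = Ex L cube (fun x => pr (D k) [set z | b (update x k z)]).
Proof.
move=> mb; have /measurable_predP mB := mb.
have bm := bounded_measurable_section k mb.
rewrite (Ex_setT measurable_cube pr_cube bm).
transitivity (fine (\int[L]_x D k [set z | b (update x k z)])%E).
  by congr fine; exact: (resample_val k mB).
congr fine.
apply: eq_integral => x _; apply: prE; exact: measurable_pred_val.
Qed.

Lemma resample_lower k b (Z : set R) c : measurable_fun setT b -> measurable Z ->
  0 <= c -> (forall z, Z z -> c <= pr L [set x : locspace | b (update x k z)]) ->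
  c * pr (D k) Z <= pr L [set x : locspace | b x].
Proof.
move=> mb mZ c0 hc; have /measurable_predP mB := mb.
have mb' z := iffLR (measurable_predP _) (measurable_pred_loc k z mb).
rewrite -lee_fin -prE // (resample_loc k mB) EFinM -prE //.
apply: (@le_trans _ _ (\int[D k]_(z in Z) (cst c%:E z))%E).
  by rewrite integral_cst.
rewrite integral_mkcond; apply: ge0_le_integral => //=.
- by move=> z _; rewrite patchE; case: ifP; rewrite // lee_fin.
- by apply: (iffLR (measurable_restrictT _ mZ)); exact: measurable_cst.
- have := measurable_fun_update k; move=> /(_ measurableT _ mB); rewrite setTI.
  move=> /(measurable_fun_ysection L); congr measurable_fun.
  by apply/funext => z /=; congr (L _); apply/seteqP; split=> x /=;
    rewrite /ysection /= inE.
- move=> z _; rewrite patchE; case: ifPn => [|_]; last exact: measure_ge0.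
  by rewrite inE => /hc; rewrite -lee_fin -prE.
Qed.

(** The lower bound applied to the complementary event, with [Z] the unit interval. *)
Lemma resample_upper k b c : measurable_fun setT b ->
  (forall z, 0 <= z <= 1 -> pr L [set x : locspace | b (update x k z)] <= c) ->
  pr L [set x : locspace | b x] <= c.
Proof.
move=> mb hc; have /measurable_predP mB := mb.
have [c1|c1] := leP 1 c; first by apply: le_trans c1; apply: pr_le1.
have := @resample_lower k (fun x => ~~ b x) `[0, 1]%classic (1 - c).
have compl (b' : locspace -> bool) : measurable_fun setT b' ->
    pr L [set x : locspace | ~~ b' x] = 1 - pr L [set x : locspace | b' x].
  exact: pr_neg measurable_cube pr_cube _.
rewrite compl // /pr D01 mulr1 => h.
suff : 1 - c <= 1 - fine (L [set x : locspace | b x]) by lra.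
apply: h.
- exact: measurable_neg.
- exact: measurable_itv.
- by lra.
- move=> z /=; rewrite in_itv /= => /hc hz.
  have E := compl (fun x : locspace => b (update x k z)) (measurable_pred_loc k z mb).
  suff : 1 - c <= 1 - pr L [set x : locspace | b (update x k z)] by rewrite -E.
  by lra.
Qed.

End ProductLaw.

(** * Neighbourhoods of a finite set *)

Section Density.
Variables (R : realType) (D : probability R R) (g : R -> R) (eta : R).
Hypothesis eta_ge1 : 1 <= eta.
Hypothesis D_density : has_density01 D g.
Hypothesis g_lip : eta.-lipschitz_`[0, 1] g.
Hypothesis g_bounds : forall x : R, x \in `[0%R, 1%R] -> eta^-1 <= g x <= eta.

Let g_ge0 x : x \in `[0%R, 1%R] -> 0 <= g x.
Proof.
move=> /g_bounds /andP[+ _]; apply: le_trans; rewrite invr_ge0.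
exact: le_trans eta_ge1.
Qed.

Lemma lipschitz01 x y : 0 <= x <= 1 -> 0 <= y <= 1 -> `|g x - g y| <= eta * `|x - y|.
Proof.
move=> hx hy; have := g_lip; rewrite /dominated_by /globally /= => /(_ (x, y)).
by apply; split; rewrite /= in_itv.
Qed.

(** [g] is controlled on [0, 1] only; composed with the clamping map [c], it becomes continuous on
    the whole line without changing on [0, 1]. *)
Lemma measurable_density : measurable_fun (`[0%R, 1%R]%classic : set R) g.
Proof.
pose c (x : R) := Num.max 0 (Num.min 1 x).
have c01 x : 0 <= c x <= 1 by rewrite /c le_max lexx ge_max ler01 ge_min lexx.
have c_lip x y : `|c x - c y| <= `|x - y|.
  have := ler_norm (x - y); have := ler_norm (y - x); rewrite (distrC y) ler_norml.
  rewrite /c !maxEle !minEle; case: (leP 1 x) => ?; case: (leP 1 y) => ?;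
    rewrite ?ler01; case: (leP 0 x) => ?; case: (leP 0 y) => ?; lra.
have cont : continuous (g \o c).
  move=> x; apply/cvgrPdist_lt => e e0.
  have eta0 : 0 < eta by apply: lt_le_trans eta_ge1.
  near=> y.
  apply: (@le_lt_trans _ _ (eta * `|x - y|)).
    apply: le_trans (lipschitz01 (c01 x) (c01 y)) _.
    by rewrite ler_pM2l.
  rewrite mulrC -ltr_pdivlMr //.
  near: y; apply: cvgr_dist_lt; [exact: cvg_id|exact: divr_gt0].
apply: (@eq_measurable_fun _ _ _ _ _ (g \o c)).
  move=> x; rewrite inE /= in_itv /= => /andP[x0 x1].
  by rewrite /c (min_idPr x1) (max_idPr x0).
by apply: measurable_funTS; apply: continuous_measurable_fun.
Unshelve. all: by end_near.
Qed.

Lemma density_support : D `[0%R, 1%R]%classic = 1%E.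
Proof.
rewrite -(probability_setT D) !D_density //; congr (integral _ _ _).
by rewrite setTI setIid.
Qed.

Lemma density_upper (A : set R) hi : measurable A -> 0 <= hi ->
  (forall x, A x -> 0 <= x <= 1 -> g x <= hi) ->
  (D A <= hi%:E * lebesgue_measure A)%E.
Proof.
move=> mA hi0 ghi; rewrite D_density //.
have m01 : measurable (A `&` `[0%R, 1%R]%classic) by apply: measurableI => //; exact: measurable_itv.
have le1 : (\int[lebesgue_measure]_(x in A `&` `[0%R, 1%R]%classic) (g x)%:E <= \int[lebesgue_measure]_(x in A `&` `[0%R, 1%R]%classic) (cst hi%:E x))%E.
  apply: ge0_le_integral => //.
  - by move=> x [_ /=]; rewrite lee_fin => /g_ge0.
  - apply/measurable_EFinP; apply: measurable_funS measurable_density => //.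
  - move=> x [Ax /=]; rewrite in_itv /= lee_fin; exact: ghi.
apply: (le_trans le1).
rewrite integral_cst //; apply: lee_wpmul2l => //.
by apply: le_measure; rewrite ?inE.
Qed.

Lemma density_lower (A : set R) lo : measurable A ->
  (forall x, A x -> 0 <= x <= 1 /\ lo <= g x) ->
  (lo%:E * lebesgue_measure A <= D A)%E.
Proof.
move=> mA glo; have [lo0|lo0] := leP lo 0.
  apply: (@le_trans _ _ 0%E); last exact: measure_ge0.
  by rewrite mule_le0_ge0.
rewrite D_density //.
have -> : A `&` `[0%R, 1%R]%classic = A.
  by apply/setIidPl => x /glo [+ _] /=; rewrite in_itv.
rewrite -integral_cst //; apply: ge0_le_integral => //.
- by move=> x _; rewrite lee_fin ltW.
- apply/measurable_EFinP; apply: measurable_funS measurable_density => //.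
  by move=> x /glo [+ _] /=; rewrite in_itv.
- by move=> x /glo [_]; rewrite lee_fin.
Qed.

Definition side (s : bool) (p b e : R) : interval R :=
  if s then `]p + b, p + b + e] else `[p - b - e, p - b[.

Lemma in_side s p b e x :
  (x \in side s p b e) = (b < (-1) ^+ (~~ s) * (x - p) <= b + e).
Proof.
case: s; rewrite in_itv /= ?expr0 ?expr1 ?mul1r ?mulN1r.
  by congr andb; apply/idP/idP; lra.
by rewrite andbC; congr andb; apply/idP/idP; lra.
Qed.

Lemma lebesgue_side s p b e : 0 <= e ->
  lebesgue_measure [set` side s p b e] = e%:E.
Proof.
move=> e0; case: s; rewrite lebesgue_measure_itv /= lte_fin; case: ltP => h;
  by rewrite -?EFinB; congr (_%:E); lra.
Qed.

Lemma pr_side_upper s p b e hi : 0 <= e -> 0 <= hi ->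
  (forall x, x \in side s p b e -> 0 <= x <= 1 -> g x <= hi) ->
  pr D [set` side s p b e] <= hi * e.
Proof.
move=> e0 hi0 h; rewrite -lee_fin -prE; last by case: s h => _; exact: measurable_itv.
rewrite EFinM -(lebesgue_side s p b e0); exact: density_upper.
Qed.

Lemma pr_side_lower s p b e lo : 0 <= e ->
  (forall x, x \in side s p b e -> 0 <= x <= 1 /\ lo <= g x) ->
  lo * e <= pr D [set` side s p b e].
Proof.
move=> e0 h; rewrite -lee_fin -prE; last by case: s h => _; exact: measurable_itv.
rewrite EFinM -(lebesgue_side s p b e0); exact: density_lower.
Qed.

Lemma pr_itv_upper p e : 0 <= e -> pr D `[p, p + e]%classic <= eta * e.
Proof.
move=> e0; rewrite -lee_fin -prE; last exact: measurable_itv.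
apply: le_trans (@density_upper `[p, p + e]%classic eta _ _ _) _.
- exact: measurable_itv.
- exact: le_trans eta_ge1.
- by move=> x _ x01; have /andP[] := g_bounds x01.
rewrite EFinM lebesgue_measure_itv /= lte_fin; case: ltP => h.
  by rewrite -EFinB -!EFinM lee_fin addrAC subrr add0r.
by rewrite mule0 -EFinM lee_fin mulr_ge0 //; apply: le_trans eta_ge1.
Qed.

Section Annuli.
Variable ps : seq R.
Hypothesis ps_uniq : uniq ps.
Hypothesis ps01 : forall p, p \in ps -> 0 <= p <= 1.

Definition hit (c x : R) := has (fun p => `|x - p| <= c) ps.

Definition annulus (b e x : R) := ~~ hit b x && hit (b + e) x.

(** Closed Voronoi cells cover the line and open ones are disjoint. Upper bounds on an annulus use
    the former, lower bounds the latter, so ties need no separate treatment. *)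
Definition nearest p x := all (fun q => `|x - p| <= `|x - q|) ps.

Definition strictly_nearest p x :=
  all (fun q => (q == p) || (`|x - p| < `|x - q|)) ps.

Definition isolated_gap b e k p :=
  has (fun q => (2 * (b + e) < q - p <= 2 * (b + k)) &&
    all (fun t => ~~ (p < t < q)) ps) ps.

Lemma norm_side s p b e x : 0 <= b -> x \in side s p b e -> b < `|x - p| <= b + e.
Proof.
move=> b0; rewrite in_side => /andP[h1 h2].
suff -> : `|x - p| = (-1) ^+ (~~ s) * (x - p) by rewrite h1.
by rewrite -[LHS](normrMsign (~~ s)) ger0_norm //; lra.
Qed.

Lemma side_norm p b e x : b < `|x - p| <= b + e ->
  (x \in side true p b e) || (x \in side false p b e).
Proof.
rewrite !in_side /= expr0 expr1 mul1r mulN1r.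
by case: (ger0P (x - p)) => _ ->; rewrite ?orbT.
Qed.

(** Since [e <= k], [x] lies strictly between [p] and [y]; moving from [y] towards [p] makes any tie
    strict. *)
Lemma nearest_strictly s p b e k x y : 0 <= b -> e <= k ->
  x \in side s p b e -> y \in side s p (b + k) e ->
  nearest p y -> strictly_nearest p x.
Proof.
move=> b0 ek xs ys /allP near; apply/allP => q qps.
have /andP[px1 px2] := norm_side b0 xs.
have b1 : 0 <= b + k.
  by move: xs; rewrite in_side => /andP[]; lra.
have /andP[py1 py2] := norm_side b1 ys.
have [//|/= qp] := eqVneq q p.
have := near q qps; rewrite ler_normr => hy.
rewrite ltr_normr; move: xs ys; rewrite !in_side.
have qp' : q < p \/ p < q by move: qp; rewrite neq_lt => /orP.
case: s => /=; rewrite ?expr0 ?expr1 ?mul1r ?mulN1r => /andP[x1 x2] /andP[y1 y2].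
- have ex : `|x - p| = x - p by rewrite ger0_norm //; lra.
  have ey : `|y - p| = y - p by rewrite ger0_norm //; lra.
  rewrite ex; rewrite ey in hy; case/orP: hy => hy; apply/orP; case: qp' => ?; lra.
- have ex : `|x - p| = - (x - p) by rewrite ler0_norm //; lra.
  have ey : `|y - p| = - (y - p) by rewrite ler0_norm //; lra.
  rewrite ex; rewrite ey in hy; case/orP: hy => hy; apply/orP; case: qp' => ?; lra.
Qed.

Lemma nearest_exists x : ps != [::] -> exists2 p, p \in ps & nearest p x.
Proof.
rewrite /nearest; elim: ps => // p [|p' s] IH _.
  by exists p; rewrite ?inE //= lexx.
have [//|q qs /allP near] := IH.
have [le|lt] := leP `|x - p| `|x - q|.
  exists p; first by rewrite inE eqxx.
  by apply/allP => t; rewrite inE => /predU1P[->|/near]; [|apply: le_trans].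
exists q; first by rewrite inE qs orbT.
apply/allP => t; rewrite inE => /predU1P[->|/near //]; exact: ltW.
Qed.

Lemma annulus_covered b e x : 0 <= b -> annulus b e x ->
  ((annulus b e x)%:R <= \sum_(p <- ps) \sum_(s : bool)
     ((x \in side s p b e) && nearest p x)%:R :> R).
Proof.
move=> b0 ax; rewrite ax; move/andP: ax => [/hasPn nh hx].
have ps0 : ps != [::] by move: hx; rewrite /hit; case: (ps).
have [p pps near] := nearest_exists x ps0.
rewrite (bigD1_seq p) //=.
have nn (q : R) : 0 <= \sum_(s : bool) ((x \in side s q b e) && nearest q x)%:R :> R.
  by apply: sumr_ge0 => s _; exact: ler0n.
apply: (@le_trans _ _ (\sum_(s : bool) ((x \in side s p b e) && nearest p x)%:R)).
  rewrite big_bool /= near !andbT -natrD ler1n.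
  suff : (x \in side true p b e) || (x \in side false p b e) by do 2 case: (_ \in _).
  apply: side_norm; rewrite ltNge nh //=.
  have /hasP [q qps hq] := hx.
  by apply: le_trans hq; exact: (allP near).
by rewrite lerDl sumr_ge0.
Qed.

Lemma annulus_packed b e x : 0 <= b ->
  \sum_(p <- ps) \sum_(s : bool)
    ((x \in side s p b e) && strictly_nearest p x)%:R <= (annulus b e x)%:R :> R.
Proof.
move=> b0.
case: (boolP (has (fun p => [exists s, (x \in side s p b e) && strictly_nearest p x]) ps)); last first.
  move=> /hasPn none; rewrite big_seq big1 ?ler0n // => p /none /existsPn h.
  by rewrite big1 // => s _; rewrite (negbTE (h s)).
move=> /hasP [p pps /existsP [s /andP[xs sn]]].
have /andP[px1 px2] := norm_side b0 xs.
have sn' := allP sn.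
rewrite (bigD1_seq p) //= [X in _ + X](_ : _ = 0); last first.
  rewrite big_seq_cond big1 // => q /andP[qps qp].
  have := sn' q qps; rewrite (negbTE qp) /= => lt.
  rewrite big1 // => s' _; case: (boolP (strictly_nearest q x)); rewrite ?andbF // => /allP.
  by move=> /(_ p pps); rewrite eq_sym (negbTE qp) /= ltNge ltW.
rewrite addr0 sn (bigD1 s) //= xs big1 => [|s' s's]; last first.
  suff -> : (x \in side s' p b e) = false by [].
  apply: contraNF (negbT (erefl false)) => xs'; move: xs xs' s's; rewrite !in_side; case: s; case: s' => //=;
    rewrite ?expr0 ?expr1 ?mul1r ?mulN1r => /andP[? _] /andP[? _] _; lra.
rewrite addr0 ler_nat lt0b; apply/andP; split; last by apply/hasP; exists p.
apply/hasPn => q qps; rewrite -ltNge.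
by have := sn' q qps; case/orP => [/eqP -> //|]; apply: lt_trans.
Qed.

Lemma measurable_norm_sub p : measurable_fun setT (fun x : R => `|x - p|).
Proof. by apply: measurableT_comp => //; apply: measurable_funB. Qed.

Lemma measurable_fun_has (J : Type) (T : R -> J -> bool) (s : seq J) :
  (forall j, measurable_fun setT (T ^~ j)) -> measurable_fun setT (fun x => has (T x) s).
Proof.
move=> mT; elim: s => [|j s IH] /=; first exact: measurable_cst.
exact: measurable_or.
Qed.

Lemma measurable_fun_all (J : Type) (T : R -> J -> bool) (s : seq J) :
  (forall j, measurable_fun setT (T ^~ j)) -> measurable_fun setT (fun x => all (T x) s).
Proof.
move=> mT; elim: s => [|j s IH] /=; first exact: measurable_cst.
exact: measurable_and.
Qed.

Lemma measurable_hit c : measurable_fun setT (hit c).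
Proof.
apply: measurable_fun_has => p; apply: measurable_fun_ler; last exact: measurable_cst.
exact: measurable_norm_sub.
Qed.

Lemma measurable_annulus b e : measurable_fun setT (annulus b e).
Proof. by apply: measurable_and; [apply: measurable_neg|]; apply: measurable_hit. Qed.

Lemma measurable_side s p b e : measurable_fun setT (fun x => x \in side s p b e).
Proof. by apply/measurable_predP; case: s; exact: measurable_itv. Qed.

Lemma measurable_nearest p : measurable_fun setT (nearest p).
Proof.
by apply: measurable_fun_all => q; apply: measurable_fun_ler; apply: measurable_norm_sub.
Qed.

Lemma measurable_strictly_nearest p : measurable_fun setT (strictly_nearest p).
Proof.
apply: measurable_fun_all => q; apply: measurable_or; first exact: measurable_cst.
by apply: measurable_fun_ltr; apply: measurable_norm_sub.
Qed.

Let pr1 s p b e := pr D [set x | (x \in side s p b e) && strictly_nearest p x].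
Let pr2 s p b e := pr D [set x | (x \in side s p b e) && nearest p x].

Lemma measurable_pr1 s p b e :
  measurable_fun setT (fun x => (x \in side s p b e) && strictly_nearest p x).
Proof. by apply: measurable_and; [exact: measurable_side|exact: measurable_strictly_nearest]. Qed.

Lemma measurable_pr2 s p b e :
  measurable_fun setT (fun x => (x \in side s p b e) && nearest p x).
Proof. by apply: measurable_and; [exact: measurable_side|exact: measurable_nearest]. Qed.

Lemma pr_annulus_packed b e : 0 <= b ->
  \sum_(p <- ps) \sum_(s : bool) pr1 s p b e <= pr D [set x | annulus b e x].
Proof.
move=> b0; have m01 : measurable (`[0%R, 1%R]%classic : set R) by exact: measurable_itv.
rewrite -(Ex_bool m01 density_support (measurable_annulus b e)).
rewrite (eq_bigr (fun p => Ex D `[0%R, 1%R]%classic (fun x => \sum_(s : bool)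
    ((x \in side s p b e) && strictly_nearest p x)%:R))); last first.
  move=> p _; rewrite (Ex_sum m01 density_support); last first.
    by move=> s; exact: bounded_measurable_bool (measurable_pr1 _ _ _ _).
  by apply: eq_bigr => s _; rewrite (Ex_bool m01 density_support (measurable_pr1 _ _ _ _)).
have bm p : bounded_measurable (fun x => \sum_(s : bool)
    ((x \in side s p b e) && strictly_nearest p x)%:R : R).
  by apply: bounded_measurable_sum => s; exact: bounded_measurable_bool (measurable_pr1 _ _ _ _).
rewrite -(Ex_sum m01 density_support) //; apply: (Ex_le D m01) => //.
- exact: bounded_measurable_sum.
- exact: bounded_measurable_bool (measurable_annulus _ _).
- by move=> x _; exact: annulus_packed.
Qed.

Lemma pr_annulus_covered b e : 0 <= b ->
  pr D [set x | annulus b e x] <= \sum_(p <- ps) \sum_(s : bool) pr2 s p b e.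
Proof.
move=> b0; have m01 : measurable (`[0%R, 1%R]%classic : set R) by exact: measurable_itv.
rewrite -(Ex_bool m01 density_support (measurable_annulus b e)).
rewrite (eq_bigr (fun p => Ex D `[0%R, 1%R]%classic (fun x => \sum_(s : bool)
    ((x \in side s p b e) && nearest p x)%:R))); last first.
  move=> p _; rewrite (Ex_sum m01 density_support); last first.
    by move=> s; exact: bounded_measurable_bool (measurable_pr2 _ _ _ _).
  by apply: eq_bigr => s _; rewrite (Ex_bool m01 density_support (measurable_pr2 _ _ _ _)).
have bm p : bounded_measurable (fun x => \sum_(s : bool)
    ((x \in side s p b e) && nearest p x)%:R : R).
  by apply: bounded_measurable_sum => s; exact: bounded_measurable_bool (measurable_pr2 _ _ _ _).
rewrite -(Ex_sum m01 density_support) //; apply: (Ex_le D m01) => //.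
- exact: bounded_measurable_bool (measurable_annulus _ _).
- exact: bounded_measurable_sum.
move=> x _; case: (boolP (annulus b e x)) => [ax|_].
  by have := annulus_covered b0 ax; rewrite ax.
by apply: sumr_ge0 => p _; apply: sumr_ge0 => s _; exact: ler0n.
Qed.

Lemma le_pr_pred (b1 b2 : R -> bool) : measurable_fun setT b1 -> measurable_fun setT b2 ->
  (forall x, 0 <= x <= 1 -> b1 x -> b2 x) -> pr D [set x | b1 x] <= pr D [set x | b2 x].
Proof.
move=> m1 m2 h; have m01 : measurable (`[0%R, 1%R]%classic : set R) by exact: measurable_itv.
apply: (pr_le_pred m01 density_support) => // x; rewrite /= in_itv /=; exact: h.
Qed.

(** Either the outer side has no point of [0, 1] in the cell of [p] and contributes nothing, or the
    whole inner side lies in [0, 1] and in the open cell. The densities are then compared with the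
    one at [z], at an error [eta * e] inside and [eta * (k + e)] outside; [e <= k] yields the
    constant 3. *)
Lemma side_difference s p b e k : p \in ps -> 0 <= b -> 0 <= e -> e <= k ->
  - (3 * eta * e * k) <= pr1 s p b e - pr2 s p (b + k) e.
Proof.
move=> pps b0 e0 ek; have eta0 : 0 < eta by apply: lt_le_trans eta_ge1.
have /andP[p0 p1] := ps01 pps.
have k0 : 0 <= k by exact: le_trans ek.
have rhs0 : 0 <= 3 * eta * e * k by rewrite !mulr_ge0 // ltW.
have mside b' : measurable_fun setT (fun x : R => x \in side s p b' e).
  exact: measurable_side.
case: (pselect (exists y, [/\ 0 <= y <= 1, y \in side s p (b + k) e & nearest p y]))
  => [[y [y01 ys ny]]|none]; last first.
  have -> : pr2 s p (b + k) e = 0.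
    apply/eqP; rewrite eq_le pr_ge0 andbT.
    apply: (@le_trans _ _ (pr D [set x | (fun=> false) x])); last first.
      by rewrite /pr (_ : [set x | _] = set0) ?measure0 //; apply/seteqP; split.
    apply: le_pr_pred; [exact: measurable_pr2|exact: measurable_cst|].
    by move=> x x01 /andP[xs nx]; case: none; exists x.
  by have := pr_ge0 D [set x | (x \in side s p b e) && strictly_nearest p x]; rewrite /pr1; lra.
have full : pr D [set x | x \in side s p b e] <= pr1 s p b e.
  apply: le_pr_pred; [exact: mside|exact: measurable_pr1|].
  by move=> x _ xs; rewrite xs (nearest_strictly b0 ek xs ys).
have sub : pr2 s p (b + k) e <= pr D [set x | x \in side s p (b + k) e].
  by apply: le_pr_pred; [exact: measurable_pr2|exact: mside|move=> x _ /andP[]].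
pose z := p + (-1) ^+ (~~ s) * b.
have z01 : 0 <= z <= 1.
  move: ys; rewrite in_side /z; case: (s) => /=;
    rewrite ?expr0 ?expr1 ?mul1r ?mulN1r => /andP[? ?]; lra.
have lower : (g z - eta * e) * e <= pr D [set x | x \in side s p b e].
  apply: pr_side_lower => // x xs.
  have x01 : 0 <= x <= 1.
    move: ys xs; rewrite !in_side; case: (s) => /=;
      rewrite ?expr0 ?expr1 ?mul1r ?mulN1r => /andP[? ?] /andP[? ?]; lra.
  split=> //.
  have : `|z - x| <= e.
    rewrite ler_norml /z; move: xs; rewrite in_side; case: (s) => /=;
      rewrite ?expr0 ?expr1 ?mul1r ?mulN1r => /andP[? ?]; lra.
  have := lipschitz01 z01 x01; rewrite ler_norml => /andP[_ hl] zx.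
  have : eta * `|z - x| <= eta * e by rewrite ler_pM2l.
  by lra.
have upper : pr D [set x | x \in side s p (b + k) e] <= (g z + eta * (k + e)) * e.
  apply: pr_side_upper => //.
    apply: addr_ge0; first exact: g_ge0.
    by rewrite mulr_ge0 ?addr_ge0 // ltW.
  move=> x xs x01.
  have : `|z - x| <= k + e.
    rewrite ler_norml /z; move: xs; rewrite in_side; case: (s) => /=;
      rewrite ?expr0 ?expr1 ?mul1r ?mulN1r => /andP[? ?]; lra.
  have := lipschitz01 z01 x01; rewrite ler_norml => /andP[hl _] zx.
  have : eta * `|z - x| <= eta * (k + e) by rewrite ler_pM2l.
  by lra.
have : eta * e * e <= eta * e * k by rewrite ler_wpM2l // mulr_ge0 // ltW.
by nra.
Qed.

(** Half of the gap exceeds [b + e], so the inner right side belongs wholly to [p]; it is at most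
    [b + k], so every point of the outer right side is closer to [q]. *)
Lemma side_gain p b e k : p \in ps -> 0 <= b -> 0 <= e -> e <= k ->
  isolated_gap b e k p -> e / eta <= pr1 true p b e - pr2 true p (b + k) e.
Proof.
move=> pps b0 e0 ek /hasP [q qps /andP[/andP[pq1 pq2] /allP between]].
have /andP[p0 p1] := ps01 pps; have /andP[q0 q1] := ps01 qps.
have -> : pr2 true p (b + k) e = 0.
  apply/eqP; rewrite eq_le pr_ge0 andbT.
  apply: (@le_trans _ _ (pr D [set x | (fun=> false) x])); last first.
    by rewrite /pr (_ : [set x | _] = set0) ?measure0 //; apply/seteqP; split.
  apply: le_pr_pred; [exact: measurable_pr2|exact: measurable_cst|].
  move=> x x01; rewrite in_side /= expr0 mul1r => /andP[/andP[x1 x2] /allP /(_ q qps)].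
  by rewrite ler_normr ger0_norm => [/orP[|]|]; lra.
rewrite subr0; apply: (@le_trans _ _ (pr D [set x | x \in side true p b e])).
  rewrite mulrC; apply: pr_side_lower => // x; rewrite in_itv /= => /andP[x1 x2].
  have x01 : 0 <= x <= 1 by lra.
  by split=> //; have /andP[] := g_bounds x01.
apply: le_pr_pred; [exact: measurable_side|exact: measurable_pr1|].
move=> x x01 xs; rewrite xs /=; apply/allP => r rps.
have [//|/= rp] := eqVneq r p.
move: xs; rewrite in_itv /= => /andP[x1 x2].
rewrite [X in X < _]ger0_norm; last by lra.
rewrite ltr_normr; apply/orP.
have := between r rps; rewrite negb_and -!leNgt => /orP[rp'|qr]; last by right; lra.
by left; move: rp rp'; rewrite le_eqVlt => /negbTE -> /=; lra.
Qed.

(* The measure of the [c]-neighbourhood of a finite set is concave in [c], up to the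
   variation of the density, since each side of a point stops contributing at half the
   gap to the next point; a gap whose half-length lies in [(b + e, b + k]] is seen by
   the first annulus only. *)
Lemma annulus_second_difference b e k : 0 <= b -> 0 <= e -> e <= k ->
  e / eta * (count (isolated_gap b e k) ps)%:R - 6 * eta * e * k * (size ps)%:R
    <= pr D [set x | annulus b e x] - pr D [set x | annulus (b + k) e x].
Proof.
move=> b0 e0 ek; have bk : 0 <= b + k by lra.
have := pr_annulus_packed e b0; have := pr_annulus_covered e bk.
suff : e / eta * (count (isolated_gap b e k) ps)%:R - 6 * eta * e * k * (size ps)%:R
    <= \sum_(p <- ps) \sum_(s : bool) (pr1 s p b e - pr2 s p (b + k) e).
  under eq_bigr do rewrite sumrB; rewrite sumrB; lra.
rewrite -sum1_count -sum1_size !natr_sum !mulr_sumr [X in X - _]big_mkcond -sumrB.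
rewrite big_seq [leRHS]big_seq; apply: ler_sum => p pps; rewrite big_bool !mulr1 /=.
have := side_difference false pps b0 e0 ek; have := side_difference true pps b0 e0 ek.
case: (boolP (isolated_gap b e k p)) => [/(side_gain pps b0 e0 ek)|_]; last by lra.
have : 0 <= eta * e * k by rewrite !mulr_ge0 //; [apply: le_trans eta_ge1|apply: le_trans ek].
by lra.
Qed.
End Annuli.
End Density.

(** * Effect of a transfer on the matching number *)

Section Geometry.
Variables (R : realType) (n m : nat).
Implicit Types (x : 'I_n + 'I_m -> R) (r : 'I_n -> R) (A : {set 'I_m}).

Definition demand x (k : 'I_m) : R := x (inr k).

Definition range_graph r x : {set 'I_n * 'I_m} :=
  [set e : 'I_n * 'I_m | `|x (inl e.1) - demand x e.2| <= r e.1]%SET.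

Definition missable_demands r x : {set 'I_m} := [set k | missable (range_graph r x) k]%SET.

Definition reaches A x c z := [exists k in A, `|z - demand x k| <= c].

Definition newly_reaches A x c e z := ~~ reaches A x c z && reaches A x (c + e) z.

(* A supply of range [-1] has no neighbour: this is how a supply is removed. *)
Lemma delete_supply_range r x i :
  delete_supply (range_graph r x) i = range_graph (update r i (-1)) x.
Proof.
apply/finset.setP => -[l k]; rewrite !inE /= /update; case: eqP => [->|_]; last by rewrite andbT.
rewrite /= andbF; apply/esym/negbTE; rewrite -ltNge; apply: lt_le_trans (normr_ge0 _); lra.
Qed.

Lemma update_update (J : finType) (f : J -> R) i c c' :
  update (update f i c) i c' = update f i c'.
Proof. by apply/funext => l; rewrite /update; case: (l == i). Qed.

Lemma updateC (J : finType) (f : J -> R) i j c c' : i != j ->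
  update (update f i c) j c' = update (update f j c') i c.
Proof.
move=> ij; apply/funext => l; rewrite /update; case: eqP => [->|//].
by rewrite eq_sym (negbTE ij).
Qed.

Lemma update_same (J : finType) (f : J -> R) i : update f i (f i) = f.
Proof. by apply/funext => l; rewrite /update; case: eqP => [->|]. Qed.

Lemma matching_number_update r x i c :
  matching_number (range_graph (update r i c) x) =
  (matching_number (range_graph (update r i (-1)) x)
    + reaches (missable_demands (update r i (-1)) x) x c (x (inl i)))%N.
Proof.
rewrite (matching_number_add_supply _ i) delete_supply_range update_update.
congr (_ + nat_of_bool _)%N; apply: eq_existsb => k.
by rewrite !inE /= /update eqxx andbC.
Qed.

Lemma reachesD A x c e z : 0 <= e ->
  (reaches A x (c + e)%R z = reaches A x c z + newly_reaches A x c e z :> nat)%N.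
Proof.
move=> e0; rewrite /newly_reaches; case: (boolP (reaches A x c z)) => //= h.
suff -> : reaches A x (c + e) z by [].
have /exists_inP [k kA hk] := h; apply/exists_inP; exists k => //.
by apply: le_trans hk _; rewrite lerDl.
Qed.

Lemma matching_number_increase r x i c e : 0 <= e ->
  matching_number (range_graph (update r i (c + e)) x) =
  (matching_number (range_graph (update r i c) x)
    + newly_reaches (missable_demands (update r i (-1)) x) x c e (x (inl i)))%N.
Proof. by move=> e0; rewrite (matching_number_update _ _ _ (c + e)) reachesD // addnA -matching_number_update. Qed.

(* Cut the line into blocks of width [w] starting from [z]: the run of [z]
   contains the demands that are separated from [z] by no empty block. *)
Definition in_run N w z x k :=
  [forall t : 'I_N,
    ((z + t.+1%:R * w < demand x k) ==>
       [exists l, z + t%:R * w < demand x l <= z + t.+1%:R * w]) &&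
    ((demand x k < z - t.+1%:R * w) ==>
       [exists l, z - t.+1%:R * w <= demand x l < z - t%:R * w])].

Definition run N w z x : {set 'I_m} := [set k | in_run N w z x k]%SET.

(** A block between [z] and [l] is either also between [z] and [k], hence hit, or contains [k]
    itself, as [k] is within one block width of [l]. *)
Lemma run_closed N w z x k l : 0 <= w -> `|demand x k - demand x l| <= w ->
  k \in run N w z x -> l \in run N w z x.
Proof.
move=> w0; rewrite ler_norml !inE => /andP[kl1 kl2] /forallP kr; apply/forallP => t.
have /andP[/implyP kr1 /implyP kr2] := kr t.
have e1 : t.+1%:R * w = t%:R * w + w by rewrite -natr1 mulrDl mul1r.
apply/andP; split; apply/implyP => hl.
  have [hk|hk] := ltP (z + t.+1%:R * w) (demand x k); first exact: kr1.
  by apply/existsP; exists k; rewrite hk andbT; rewrite e1 in hl *; lra.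
have [hk|hk] := ltP (demand x k) (z - t.+1%:R * w); first exact: kr2.
by apply/existsP; exists k; rewrite hk /=; rewrite e1 in hl *; lra.
Qed.

Lemma run_near N w z x k : `|z - demand x k| <= w -> k \in run N w z x.
Proof.
rewrite ler_norml inE => /andP[h1 h2]; apply/forallP => t.
have : w <= t.+1%:R * w.
  have : 0 <= t%:R * w by rewrite mulr_ge0 //; lra.
  by rewrite -natr1 mulrDl mul1r lerDr.
by move=> hw; apply/andP; split; apply/implyP; lra.
Qed.

(** Demands sharing a supply are within [2 * lam], so with blocks of this width no supply has
    neighbours both inside and outside the run, and supply [j] reaches only demands of its own
    run. *)
Lemma missable_demands_off_run N lam r x j c k :
  (forall i, r i <= lam) -> c <= lam -> 0 <= lam ->
  k \notin run N (2 * lam) (x (inl j)) x ->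
  (k \in missable_demands (update r j c) x) = (k \in missable_demands (update r j (-1)) x).
Proof.
move=> r_lam c_lam lam0 kK; rewrite !inE.
have noncross r1 : (forall i, r1 i <= lam) -> forall i k l,
    (i, k) \in range_graph r1 x -> (i, l) \in range_graph r1 x ->
    k \in run N (2 * lam) (x (inl j)) x -> l \in run N (2 * lam) (x (inl j)) x.
  move=> r1_lam i k1 k2 h1 h2; apply: run_closed; first by lra.
  rewrite !inE /= in h1 h2.
  have := r1_lam i; move: h1 h2; rewrite !ler_norml => /andP[? ?] /andP[? ?] ?; lra.
apply: (missable_off_cluster (K := run N (2 * lam) (x (inl j)) x)) => //.
- by apply: noncross => i; rewrite /update; case: ifP.
- by apply: noncross => i; rewrite /update; case: ifP => // _; lra.
move=> i l lK; rewrite !inE /= /update; case: eqP => // ->.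
have lam_lt : lam < `|x (inl j) - demand x l|.
  rewrite ltNge; apply: contra lK => h; apply: run_near; lra.
by rewrite !leNgt (le_lt_trans _ lam_lt) // (le_lt_trans _ lam_lt) //; lra.
Qed.

(** If the newly reached demand [p] is outside [K], every demand within [c + e] of [z] is within [w]
    of [p], hence outside [K] too, where [U1] and [U2] agree. The sum pays for the case [p] in
    [K]. *)
Lemma newly_reaches_agree (U1 U2 K : {set 'I_m}) x c e z w :
  2 * (c + e) <= w -> 0 <= e ->
  (forall k l, `|demand x k - demand x l| <= w -> k \in K -> l \in K) ->
  (forall k, k \notin K -> (k \in U1) = (k \in U2)) ->
  ((newly_reaches U1 x c e z)%:R <= (newly_reaches U2 x c e z)%:R
     + \sum_k ((k \in K) && (c < `|z - demand x k| <= c + e))%:R :> R).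
Proof.
move=> cw e0 closed agree.
have S0 : 0 <= \sum_k ((k \in K) && (c < `|z - demand x k| <= c + e))%:R :> R.
  by apply: sumr_ge0 => k _; exact: ler0n.
case: (boolP (newly_reaches U1 x c e z)) => [/andP[/exists_inPn far /exists_inP [p pU1 hp]]|_]; last first.
  by rewrite addr_ge0 ?ler0n.
have hp' : c < `|z - demand x p| <= c + e by rewrite hp andbT ltNge far.
have [pK|pK] := boolP (p \in K).
  rewrite (bigD1 p) //= pK hp' /=; rewrite addrCA lerDl addr_ge0 ?ler0n //.
  by apply: sumr_ge0 => k _; exact: ler0n.
suff -> : newly_reaches U2 x c e z by rewrite lerDl.
apply/andP; split; last by apply/exists_inP; exists p; rewrite // -agree.
apply/exists_inPn => q qU2; apply/negP => hq.
have [qK|qK] := boolP (q \in K); last first.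
  by have := far q; rewrite agree // => /(_ qU2) /negP; apply.
move/negP: pK; apply; apply: closed qK.
move: hq hp; rewrite !ler_norml => /andP[? ?] /andP[? ?]; lra.
Qed.

Lemma transfer_update r i j e : i != j ->
  transfer r i j e = update (update r i (r i - e)) j (r j + e).
Proof.
move=> ij; apply/funext => k; rewrite /transfer /update.
by case: (eqVneq k i) => [->|_]; rewrite ?(negbTE ij).
Qed.

Lemma transfer_gain N lam r x i j e :
  i != j -> 0 <= e -> (forall k, 0 <= r k <= lam) -> 2 * e <= r i - r j ->
  forall U0, U0 = missable_demands (update (update r i (-1)) j (-1)) x ->
  (newly_reaches U0 x (r j) e (x (inl j)))%:R
  - (newly_reaches U0 x (r i - e) e (x (inl i)))%:R
  - (\sum_k ((k \in run N (2 * lam) (x (inl i)) x) &&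
       (r j < `|x (inl j) - demand x k| <= r j + e))%:R)
  - (\sum_k ((k \in run N (2 * lam) (x (inl j)) x) &&
       (r i - e < `|x (inl i) - demand x k| <= r i - e + e))%:R)
  <= (matching_number (range_graph (transfer r i j e) x))%:R
     - (matching_number (range_graph r x))%:R :> R.
Proof.
move=> ij e0 r_range gap U0 U0E.
have lam0 : 0 <= lam by have /andP[] := r_range i; exact: le_trans.
have /andP[i0 i1] := r_range i; have /andP[j0 j1] := r_range j.
pose U1 := missable_demands (update (update r i (r i - e)) j (-1)) x.
pose U2 := missable_demands (update (update r j (r j)) i (-1)) x.
(* Both vectors are reached from [mid] by raising one range by [e]: that of [j] for the transferred
   vector, that of [i] for [r]. *)
pose mid := update (update r i (r i - e)) j (r j).
have e1 : (matching_number (range_graph (transfer r i j e) x))%:R =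
    (matching_number (range_graph mid x))%:R
    + (newly_reaches U1 x (r j) e (x (inl j)))%:R :> R.
  by rewrite transfer_update // matching_number_increase // natrD.
have e2 : (matching_number (range_graph r x))%:R =
    (matching_number (range_graph mid x))%:R
    + (newly_reaches U2 x (r i - e) e (x (inl i)))%:R :> R.
  rewrite /mid updateC // -natrD -matching_number_increase // subrK update_same.
  by rewrite update_same.
rewrite e1 e2.
have closed z : forall k l, `|demand x k - demand x l| <= 2 * lam ->
    k \in run N (2 * lam) z x -> l \in run N (2 * lam) z x.
  by move=> k l; apply: run_closed; lra.
have c1 : (newly_reaches U0 x (r j) e (x (inl j)))%:R
    <= (newly_reaches U1 x (r j) e (x (inl j)))%:R
       + \sum_k ((k \in run N (2 * lam) (x (inl i)) x) &&
            (r j < `|x (inl j) - demand x k| <= r j + e))%:R :> R.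
  apply: (@newly_reaches_agree _ _ _ _ _ _ _ (2 * lam) _ e0 (closed _)); first by lra.
  move=> k kK; rewrite U0E /U1 updateC // [in RHS]updateC //; apply/esym.
  apply: missable_demands_off_run kK => //; last by lra.
  by move=> l; rewrite /update; case: ifP => _; [lra|have /andP[] := r_range l].
have c2 : (newly_reaches U2 x (r i - e) e (x (inl i)))%:R
    <= (newly_reaches U0 x (r i - e) e (x (inl i)))%:R
       + \sum_k ((k \in run N (2 * lam) (x (inl j)) x) &&
            (r i - e < `|x (inl i) - demand x k| <= r i - e + e))%:R :> R.
  apply: (@newly_reaches_agree _ _ _ _ _ _ _ (2 * lam) _ e0 (closed _)); first by lra.
  move=> k kK; rewrite U0E /U2 -updateC //.
  apply: missable_demands_off_run kK => //.
  by move=> l; rewrite /update; case: ifP => _; [lra|have /andP[] := r_range l].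
by lra.
Qed.
End Geometry.

(** * Measurability in the locations and the mean effect of a transfer *)

Section Model.
Variables (R : realType) (n m : nat).
Local Notation idx := ('I_n + 'I_m)%type.
Local Notation loc := (locspace R idx).

Lemma measurable_loc_dist (a b : idx) :
  measurable_fun setT (fun x : loc => `|x a - x b|).
Proof.
apply: measurableT_comp => //.
exact: measurable_funB (@measurable_coordinate R idx a) (@measurable_coordinate R idx b).
Qed.

Lemma measurable_range_graph r (e : 'I_n * 'I_m) :
  measurable_fun setT (fun x : loc => e \in range_graph r x).
Proof.
rewrite (_ : (fun x => _) = (fun x : loc => `|x (inl e.1) - x (inr e.2)| <= r e.1)); last first.
  by apply/funext => x; rewrite inE.
by apply: measurable_fun_ler; [exact: measurable_loc_dist|exact: measurable_cst].
Qed.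

Lemma measurable_missable r k :
  measurable_fun setT (fun x : loc => k \in missable_demands r x).
Proof.
rewrite (_ : (fun x => _) = (fun x : loc => missable (range_graph r x) k)); last first.
  by apply/funext => x; rewrite inE.
apply: (@measurable_fun_finset _ loc _ (range_graph r) (fun E => missable E k)).
exact: measurable_range_graph.
Qed.

Lemma measurable_newly_reaches r c e a :
  measurable_fun setT
    (fun x : loc => newly_reaches (missable_demands r x) x c e (x a)).
Proof.
have mr b : measurable_fun setT
    (fun x : loc => reaches (missable_demands r x) x b (x a)).
  apply: measurable_fun_exists => k; apply: measurable_and.
    exact: measurable_missable.
  by apply: measurable_fun_ler; [exact: measurable_loc_dist|exact: measurable_cst].
by apply: measurable_and; [exact: measurable_neg|exact: mr].
Qed.

Lemma measurable_demand k : measurable_fun setT (fun x : loc => demand x k).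
Proof. exact: measurable_coordinate. Qed.

Lemma measurable_in_run N w a k :
  measurable_fun setT (fun x : loc => k \in run N w (x a) x).
Proof.
rewrite (_ : (fun x => _) = (fun x : loc => in_run N w (x a) x k)); last first.
  by apply/funext => x; rewrite inE.
have mD c : measurable_fun setT (fun x : loc => x a + c).
  by apply: measurable_funD; [exact: measurable_coordinate|exact: measurable_cst].
have mB c : measurable_fun setT (fun x : loc => x a - c).
  by apply: measurable_funB; [exact: measurable_coordinate|exact: measurable_cst].
apply: measurable_fun_forall => t; apply: measurable_and; apply: measurable_fun_imply.
- exact: measurable_fun_ltr (mD _) (measurable_demand _).
- apply: measurable_fun_exists => l; apply: measurable_and.
    exact: measurable_fun_ltr (mD _) (measurable_demand _).
  exact: measurable_fun_ler (measurable_demand _) (mD _).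
- exact: measurable_fun_ltr (measurable_demand _) (mB _).
- apply: measurable_fun_exists => l; apply: measurable_and.
    exact: measurable_fun_ler (mB _) (measurable_demand _).
  exact: measurable_fun_ltr (measurable_demand _) (mB _).
Qed.

Lemma bounded_measurable_graph r (h : {set 'I_n * 'I_m} -> R) :
  bounded_measurable (fun x : loc => h (range_graph r x)).
Proof.
rewrite (_ : (fun x => _) =
    (fun x : loc => \sum_(E <- enum {set 'I_n * 'I_m}) h E * (range_graph r x == E)%:R)).
  apply: bounded_measurable_sum => E; apply: bounded_measurableZ.
  apply: bounded_measurable_bool.
  apply: (@measurable_fun_finset _ loc _ (range_graph r) (fun F => F == E)).
  exact: measurable_range_graph.
apply/funext => x; rewrite (bigD1_seq (range_graph r x)) ?enum_uniq ?mem_enum //=.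
by rewrite eqxx mulr1 big1 ?addr0 // => E; rewrite eq_sym => /negbTE ->; rewrite mulr0.
Qed.

Variables (D1 D2 : probability R R).

Definition loc_law (k : idx) : probability R R :=
  match k with inl _ => D1 | inr _ => D2 end.

Variable L : probability loc R.
Hypothesis HL : product_law loc_law L.
Hypothesis loc01 : forall k, loc_law k `[0%R, 1%R]%classic = 1%E.

Let Pcube : L (@cube R idx) = 1%E := pr_cube HL loc01.
Let mcube := @measurable_cube R idx.

Definition mean_matching r : R :=
  Ex L (@cube R idx) (fun x => (matching_number (range_graph r x))%:R).

Lemma mean_transfer N lam r i j e :
  i != j -> 0 <= e -> (forall k, 0 <= r k <= lam) -> 2 * e <= r i - r j ->
  forall r0, r0 = update (update r i (-1)) j (-1) ->
  pr L [set x : loc | newly_reaches (missable_demands r0 x) x (r j) e (x (inl j))]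
  - pr L [set x : loc | newly_reaches (missable_demands r0 x) x (r i - e) e (x (inl i))]
  - \sum_k pr L [set x : loc | (k \in run N (2 * lam) (x (inl i)) x) &&
       (r j < `|x (inl j) - demand x k| <= r j + e)]
  - \sum_k pr L [set x : loc | (k \in run N (2 * lam) (x (inl j)) x) &&
       (r i - e < `|x (inl i) - demand x k| <= r i - e + e)]
  <= mean_matching (transfer r i j e) - mean_matching r.
Proof.
move=> ij e0 r_range gap r0 r0E.
have mn c a := @measurable_newly_reaches r0 c e a.
have mr a a' k c : measurable_fun setT (fun x : loc =>
    (k \in run N (2 * lam) (x a) x) && (c < `|x a' - demand x k| <= c + e)).
  apply: measurable_and; first exact: measurable_in_run.
  apply: measurable_and.
    by apply: measurable_fun_ltr; [exact: measurable_cst|exact: measurable_loc_dist].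
  by apply: measurable_fun_ler; [exact: measurable_loc_dist|exact: measurable_cst].
have bg r' := @bounded_measurable_graph r' (fun E => (matching_number E)%:R).
have bn c a := bounded_measurable_bool R (mn c a).
have br a a' k c := bounded_measurable_bool R (mr a a' k c).
have bs a a' c : bounded_measurable (fun x : loc => \sum_k
    ((k \in run N (2 * lam) (x a) x) && (c < `|x a' - demand x k| <= c + e))%:R : R).
  by apply: bounded_measurable_sum => k; exact: br.
rewrite /mean_matching -(ExB L mcube (bg _) (bg _)).
rewrite -!(Ex_bool mcube Pcube (mn _ _)).
under eq_bigr do rewrite -(Ex_bool mcube Pcube (mr _ _ _ _)).
under [X in _ - X]eq_bigr do rewrite -(Ex_bool mcube Pcube (mr _ _ _ _)).
rewrite -!(Ex_sum mcube Pcube) => [|k|k]; try exact: br.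
rewrite -(ExB L mcube (bn _ _) (bn _ _)).
have b1 := bounded_measurableB (bn (r j) (inl j)) (bn (r i - e) (inl i)).
rewrite -(ExB L mcube b1 (bs _ _ _)).
have b2 := bounded_measurableB b1 (bs (inl i) (inl j) (r j)).
rewrite -(ExB L mcube b2 (bs _ _ _)).
apply: (Ex_le L mcube (bounded_measurableB b2 (bs _ _ _)) (bounded_measurableB (bg _) (bg _))).
move=> x _; apply: (transfer_gain N ij e0 r_range gap); by rewrite r0E.
Qed.
End Model.

(** * Size of the run of a supply *)

Section RunBound.
Variables (R : realType) (n m : nat).
Local Notation idx := ('I_n + 'I_m)%type.
Local Notation loc := (locspace R idx).
Variables (D1 D2 : probability R R) (L : probability loc R).
Hypothesis HL : product_law (loc_law D1 D2) L.
Hypothesis loc01 : forall k : idx, loc_law D1 D2 k `[0%R, 1%R]%classic = 1%E.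

Let Pcube : L (@cube R idx) = 1%E := pr_cube HL loc01.
Let mcube := @measurable_cube R idx.

(** Demand [k0] is left out so that the event stays independent of its location. *)
Lemma pr_avoid (C : R -> bool) (k0 : 'I_m) : measurable_fun setT C ->
  pr L [set x : loc | [forall l, (l != k0) ==> ~~ C (x (inr l))]]
  = \prod_(l | l != k0) (1 - pr D2 [set z | C z]).
Proof.
move=> mC; pose A (k : idx) : set R :=
  match k with inl _ => setT | inr l => if l == k0 then setT else [set z | ~~ C z] end.
have mA k : measurable (A k).
  case: k => [i|l] //=; case: ifP => // _.
  by apply/measurable_predP; exact: measurable_neg.
rewrite (_ : [set x : loc | _] = box A); last first.
  apply/seteqP; split=> x /=.
    move=> /forallP h [i|l] //=; case: eqP => // /eqP lk.
    by have := h l; rewrite lk.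
  move=> h; apply/forallP => l; apply/implyP => lk.
  by have := h (inr l); rewrite /= (negbTE lk).
rewrite (pr_box HL mA) big_sumType /= big1 => [|i _]; last by rewrite /pr probability_setT.
rewrite mul1r (bigID (fun l => l == k0)) /= big1 => [|l /eqP ->]; last first.
  by rewrite eqxx /pr probability_setT.
rewrite mul1r; apply: eq_bigr => l /negbTE ->.
have m01 : measurable (`[0%R, 1%R]%classic : set R) by exact: measurable_itv.
exact: (pr_neg m01 (loc01 (inr k0)) mC).
Qed.

(* Second moment method: the events that a block is left empty are pairwise negatively
   correlated. *)
Lemma pr_all_blocks_hit (k0 : 'I_m) (T : nat) (B : 'I_T -> R -> bool) (q : R) :
  (forall t, measurable_fun setT (B t)) ->
  (forall s t z, s != t -> B s z -> ~~ B t z) ->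
  (0 < T)%N -> 0 < q ->
  (forall t, q <= \prod_(l : 'I_m | l != k0) (1 - pr D2 [set z | B t z])) ->
  pr L [set x : loc | [forall t, [exists l, (l != k0) && B t (x (inr l))]]]
    <= (T%:R * q)^-1.
Proof.
move=> mB disj T0 q0 qB.
have m01 : measurable (`[0%R, 1%R]%classic : set R) by exact: measurable_itv.
have P01 := loc01 (inr k0); rewrite /= in P01.
pose N (C : R -> bool) (x : loc) := [forall l, (l != k0) ==> ~~ C (x (inr l))].
have mN C : measurable_fun setT C -> measurable_fun setT (N C).
  move=> mC; apply: measurable_fun_forall => l; apply: measurable_fun_imply.
    exact: measurable_cst.
  apply: measurable_neg; apply: (measurableT_comp mC); exact: measurable_coordinate.
pose Q t := \prod_(l : 'I_m | l != k0) (1 - pr D2 [set z | B t z]).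
have prN t : pr L [set x : loc | N (B t) x] = Q t by exact: pr_avoid.
pose mu := \sum_t Q t.
have mu_ge : T%:R * q <= mu.
  by rewrite -[T in T%:R]card_ord mulr_natl -sumr_const; apply: ler_sum => t _; exact: qB.
have Tq0 : 0 < T%:R * q by rewrite mulr_gt0 // ltr0n.
have mu0 : 0 < mu by apply: lt_le_trans mu_ge.
(* Given two disjoint blocks of masses a and b, one demand avoids both with probability 1 - a - b <=
   (1 - a)(1 - b). *)
have prNN s t : s != t ->
    pr L [set x : loc | N (B s) x && N (B t) x] <= Q s * Q t.
  move=> st; pose C z := B s z || B t z.
  have mC : measurable_fun setT C by exact: measurable_or.
  rewrite (_ : [set x : loc | _] = [set x : loc | N C x]); last first.
    apply/seteqP; split=> x /=.
      move=> /andP[/forallP h1 /forallP h2]; apply/forallP => l; apply/implyP => lk.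
      by have := h1 l; have := h2 l; rewrite lk /= /C negb_or => -> ->.
    move=> /forallP h; apply/andP; split; apply/forallP => l; apply/implyP => lk;
      by have := h l; rewrite lk /= negb_or => /andP[].
  rewrite pr_avoid // -big_split /=; apply: ler_prod => l _.
  have prC : pr D2 [set z | C z] = pr D2 [set z | B s z] + pr D2 [set z | B t z].
    rewrite -!(Ex_bool m01 P01) // -ExD; try exact: bounded_measurable_bool.
      congr Ex; apply/funext => z; rewrite /C; case: (boolP (B s z)) => [Bs|_]; last by rewrite add0r.
      by rewrite (negbTE (disj _ _ _ st Bs)) addr0.
    exact: m01.
  have C1 : pr D2 [set z | C z] <= 1 by apply: pr_le1; exact/measurable_predP.
  rewrite prC in C1 *.
  have := pr_ge0 D2 [set z | B s z]; have := pr_ge0 D2 [set z | B t z].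
  by rewrite subr_ge0 C1 /= => p1 p2; have := mulr_ge0 p1 p2; nra.
(* With X the number of empty blocks, [f] is (1 - X / mu)^2, which is 1 when all blocks are hit. Its
   mean is at most 1 - 2 + (mu + mu^2) / mu^2 = 1 / mu. *)
pose f (x : loc) := 1 - 2 / mu * \sum_t (N (B t) x)%:R
  + (mu ^- 2) * \sum_s \sum_t (N (B s) x && N (B t) x)%:R.
have b1 : bounded_measurable (fun x : loc => \sum_t (N (B t) x)%:R : R).
  by apply: bounded_measurable_sum => t; apply: bounded_measurable_bool; exact: mN.
have bb s t : bounded_measurable (fun x : loc => (N (B s) x && N (B t) x)%:R : R).
  by apply: bounded_measurable_bool; apply: measurable_and; exact: mN.
have b2s s : bounded_measurable (fun x : loc => \sum_t (N (B s) x && N (B t) x)%:R : R).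
  by apply: bounded_measurable_sum => t; exact: bb.
have b2 : bounded_measurable (fun x : loc =>
    \sum_s \sum_t (N (B s) x && N (B t) x)%:R : R) by exact: bounded_measurable_sum.
have bc := bounded_measurable_cst loc (1 : R).
have b1' := bounded_measurableZ (2 / mu) b1.
have b2' := bounded_measurableZ (mu ^- 2) b2.
have mb : measurable_fun setT (fun x : loc =>
    [forall t, [exists l, (l != k0) && B t (x (inr l))]]).
  apply: measurable_fun_forall => t; apply: measurable_fun_exists => l.
  apply: measurable_and; first exact: measurable_cst.
  apply: (measurableT_comp (mB t)); exact: measurable_coordinate.
rewrite -(Ex_bool mcube Pcube mb).
apply: (@le_trans _ _ (Ex L (@cube R idx) f)).
  apply: (Ex_le L mcube); first exact: bounded_measurable_bool.
    by apply: bounded_measurableD b2'; exact: bounded_measurableB.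
  move=> x _.
  have -> : f x = (1 - mu^-1 * \sum_t (N (B t) x)%:R) ^+ 2.
    rewrite /f (_ : \sum_s \sum_t _ = (\sum_t (N (B t) x)%:R) ^+ 2); last first.
      rewrite expr2 big_distrlr /=; apply: eq_bigr => s _; apply: eq_bigr => t _.
      by rewrite -mulnb natrM.
    by field; lra.
  case: (boolP [forall t, _]) => [/forallP h|_]; last exact: sqr_ge0.
  rewrite big1 ?mulr0 ?subr0 ?expr1n // => t _.
  have /existsP [l /andP[lk Bl]] := h t.
  by case: (boolP (N (B t) x)) => // /forallP /(_ l); rewrite lk Bl.
rewrite /f ExD //; last by exact: bounded_measurableB.
rewrite ExB // !ExZ // (Ex_cst mcube Pcube).
rewrite (Ex_sum mcube Pcube) => [|t]; last by apply: bounded_measurable_bool; exact: mN.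
rewrite (eq_bigr Q); last by move=> t _; rewrite (Ex_bool mcube Pcube) //; exact: mN.
rewrite (Ex_sum mcube Pcube) //.
have E2 : \sum_s Ex L (@cube R idx) (fun x : loc => \sum_t (N (B s) x && N (B t) x)%:R)
    <= mu + mu ^+ 2.
  rewrite expr2 {2}/mu mulr_suml -big_split /=; apply: ler_sum => s _.
  rewrite (Ex_sum mcube Pcube) // (bigD1 s) //= /mu [X in Q s * X](bigD1 s) //= mulrDr.
  rewrite (Ex_bool mcube Pcube); last by apply: measurable_and; exact: mN.
  rewrite (_ : [set x : loc | _ && _] = [set x : loc | N (B s) x]); last first.
    by apply/seteqP; split=> x /=; rewrite andbb.
  rewrite prN lerD2l; apply: ler_wpDl; first by rewrite -expr2 sqr_ge0.
  rewrite mulr_sumr; apply: ler_sum => t ts.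
  rewrite (Ex_bool mcube Pcube); last by apply: measurable_and; exact: mN.
  by apply: prNN; rewrite eq_sym.
rewrite -/mu.
apply: (@le_trans _ _ (1 - 2 / mu * mu + mu ^- 2 * (mu + mu ^+ 2))).
  by rewrite lerD2l ler_pM2l // invr_gt0 exprn_gt0.
rewrite (_ : _ + _ = mu^-1); last by field; lra.
by rewrite lef_pV2 ?posrE.
Qed.
End RunBound.

Section RunSize.
Variables (R : realType) (n m : nat).
Local Notation idx := ('I_n + 'I_m)%type.
Local Notation loc := (locspace R idx).
Variables (D1 D2 : probability R R) (L : probability loc R).
Hypothesis HL : product_law (loc_law D1 D2) L.
Hypothesis loc01 : forall k : idx, loc_law D1 D2 k `[0%R, 1%R]%classic = 1%E.
Variable eta : R.
Hypothesis eta_ge0 : 0 <= eta.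
Hypothesis D1_itv : forall p e, 0 <= e -> pr D1 `[p, p + e]%classic <= eta * e.
Hypothesis D2_itv : forall p e, 0 <= e -> pr D2 `[p, p + e]%classic <= eta * e.

Let Pcube : L (@cube R idx) = 1%E := pr_cube HL loc01.
Let mcube := @measurable_cube R idx.

(** The run of [i] does not involve the location of [j]. Given everything else, [j] must fall in one
    of two intervals of length [e] around demand [k]. *)
Lemma pr_run_annulus N w i j k c e : 0 <= e -> i != j ->
  pr L [set x : loc | (k \in run N w (x (inl i)) x) &&
                      (c < `|x (inl j) - demand x k| <= c + e)]
  <= 2 * eta * e * pr L [set x : loc | k \in run N w (x (inl i)) x].
Proof.
move=> e0 ij.
have mrun := @measurable_in_run R n m N w (inl i) k.
have mb : measurable_fun setT (fun x : loc => (k \in run N w (x (inl i)) x) &&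
    (c < `|x (inl j) - demand x k| <= c + e)).
  apply: measurable_and => //; apply: measurable_and.
    by apply: measurable_fun_ltr; [exact: measurable_cst|exact: measurable_loc_dist].
  by apply: measurable_fun_ler; [exact: measurable_loc_dist|exact: measurable_cst].
rewrite (Ex_resample HL loc01 (inl j) mb) -(Ex_bool mcube Pcube mrun) -ExZ //; last first.
  exact: bounded_measurable_bool.
apply: (Ex_le L mcube).
- exact: (bounded_measurable_section (loc_law D1 D2) (inl j) mb).
- by apply: bounded_measurableZ; exact: bounded_measurable_bool.
move=> x _.
have e_i z : update x (inl j) z (inl i) = x (inl i).
  by rewrite /update; case: eqP => // -[ii]; rewrite ii eqxx in ij.
have e_j z : update x (inl j) z (inl j) = z by rewrite /update eqxx.
have e_run z : (k \in run N w (update x (inl j) z (inl i)) (update x (inl j) z))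
    = (k \in run N w (x (inl i)) x) by rewrite e_i.
have e_d z : demand (update x (inl j) z) k = demand x k by [].
set p := demand x k.
rewrite (_ : [set z | _] = [set z | (k \in run N w (x (inl i)) x) && (c < `|z - p| <= c + e)]); last first.
  by apply/seteqP; split=> z /=; rewrite e_run e_j e_d.
case: (k \in _); last first.
  by rewrite mulr0 (_ : [set z | _] = set0) ?/pr ?measure0 //; apply/seteqP; split.
rewrite mulr1 /=.
have m01 : measurable (`[0%R, 1%R]%classic : set R) by exact: measurable_itv.
pose B (s : bool) (z : R) := if s then p + c <= z <= p + c + e else p - c - e <= z <= p - c - e + e.
have BE s : [set z | B s z] = (if s then `[p + c, p + c + e] else `[p - c - e, p - c - e + e])%classic.
  by case: s; apply/seteqP; split=> z /=; rewrite in_itv.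
have mB s : measurable_fun setT (B s).
  by apply/measurable_predP; rewrite BE; case: s; exact: measurable_itv.
apply: (@le_trans _ _ (\sum_(s <- [:: true; false]) pr D1 [set z | B s z])).
  apply: (pr_le_sum m01 (loc01 (inl j))) => //.
    have mz : measurable_fun setT (fun z : R => `|z - p|).
      by apply: measurableT_comp => //; apply: measurable_funB.
    apply: measurable_and; first exact: measurable_fun_ltr (measurable_cst _) mz.
    exact: measurable_fun_ler mz (measurable_cst _).
  move=> z _ /=; rewrite orbF /B; case: (ger0P (z - p)) => _ /andP[? ?]; apply/orP;
    [left|right]; lra.
rewrite !big_cons big_nil addr0.
rewrite !BE; have := D1_itv (p + c) e0; have := D1_itv (p - c - e) e0; lra.
Qed.

Definition block (w : R) (s : bool) (t : nat) (z y : R) : bool :=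
  if s then z + t%:R * w < y <= z + t.+1%:R * w
  else z - t.+1%:R * w <= y < z - t%:R * w.

(** Half-open blocks are disjoint, as the second moment bound requires; closed ones also catch a
    demand located exactly at [z]. *)
Definition block_closure (w : R) (s : bool) (t : nat) (z y : R) : bool :=
  if s then z + t%:R * w <= y <= z + t.+1%:R * w
  else z - t.+1%:R * w <= y <= z - t%:R * w.

Lemma block_closureE w s t z : [set y | block_closure w s t z y] =
  let p := (if s then z + t%:R * w else z - t.+1%:R * w) in `[p, p + w]%classic.
Proof.
apply/seteqP; split=> y /=; rewrite in_itv /block_closure; case: s => /=;
  rewrite -natr1 mulrDl mul1r; lra.
Qed.

Lemma measurable_block_closure w s t z : measurable_fun setT (block_closure w s t z).
Proof. by apply/measurable_predP; rewrite block_closureE; exact: measurable_itv. Qed.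

Lemma measurable_block w s t z : measurable_fun setT (block w s t z).
Proof.
by rewrite /block; case: s; apply: measurable_and;
  (apply: measurable_fun_ltr || apply: measurable_fun_ler); try exact: measurable_cst;
  exact: measurable_id.
Qed.

Lemma block_sub w s t z y : block w s t z y -> block_closure w s t z y.
Proof. by rewrite /block /block_closure; case: s => /andP[? ?]; apply/andP; split => //; exact: ltW. Qed.

Lemma pr_block_closure w s t z : 0 <= w ->
  pr D2 [set y | block_closure w s t z y] <= eta * w.
Proof. by move=> w0; rewrite block_closureE; exact: D2_itv. Qed.

Lemma pr_block (k0 : 'I_m) w s t z : 0 <= w -> pr D2 [set y | block w s t z y] <= eta * w.
Proof.
move=> w0; apply: le_trans (pr_block_closure s t z w0).
have m01 : measurable (`[0%R, 1%R]%classic : set R) by exact: measurable_itv.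
apply: (pr_le_pred m01 (loc01 (inr k0))) => [||y _]; last exact: block_sub.
  exact: measurable_block.
exact: measurable_block_closure.
Qed.

Lemma block_disjoint w s t t' z y : 0 <= w -> t != t' -> block w s t z y -> ~~ block w s t' z y.
Proof.
move=> w0; wlog lt : t t' / (t < t')%N.
  by move=> wl; rewrite neq_ltn => /orP[] lt; last first; [|by apply: wl; rewrite // neq_ltn lt];
    move=> bt; apply/negP => bt'; have := wl _ _ lt; rewrite neq_ltn lt bt bt' => /(_ isT isT).
move=> _; have : t.+1%:R * w <= t'%:R * w by rewrite ler_wpM2r // ler_nat.
by rewrite /block; case: s => h /andP[h1 h2]; apply/negP => /andP[]; lra.
Qed.

Definition blocks_hit w s t (k : 'I_m) (z : R) (x : loc) :=
  [forall t' : 'I_t, [exists l, (l != k) && block w s t' z (demand x l)]].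

(** [t] is the index of the first block that reaches [k] on its side, below [N] because [N] blocks
    span the unit interval. The earlier blocks end strictly before [k], so they are hit by demands
    other than [k]. *)
Lemma in_run_blocks N w k z x : 0 < w -> 1 <= N%:R * w ->
  0 <= z <= 1 -> 0 <= demand x k <= 1 -> k \in run N w z x ->
  exists s, exists t : 'I_N, block_closure w s t z (demand x k) && blocks_hit w s t k z x.
Proof.
move=> w0 Nw z01 d01; rewrite inE => /forallP krun.
have step t : t.+1%:R * w = t%:R * w + w by rewrite -natr1 mulrDl mul1r.
have mono (t t' : nat) : (t < t')%N -> t.+1%:R * w <= t'%:R * w.
  by move=> tt; rewrite ler_pM2r // ler_nat.
have [zd|dz] := leP z (demand x k).
  have exN : exists t, demand x k <= z + t.+1%:R * w.
    by exists N; rewrite step; lra.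
  have [T dT Tmin] := ex_minnP exN.
  have TN : (T < N)%N.
    rewrite ltnNge; apply/negP => NT.
    case: N Nw krun NT => [|N'] Nw krun NT; first by rewrite mul0r in Nw; lra.
    have /Tmin : demand x k <= z + N'.+1%:R * w by lra.
    by rewrite leqNgt NT.
  exists true, (Ordinal TN); rewrite /block_closure /= dT andbT; apply/andP; split.
    case: T dT Tmin TN => [|T] dT Tmin TN; first by rewrite mul0r addr0.
    by rewrite leNgt; apply/negP => /ltW /Tmin; rewrite ltnn.
  apply/forallP => -[t' tT] /=.
  have lt : z + t'.+1%:R * w < demand x k.
    by rewrite ltNge; apply/negP => /Tmin; rewrite leqNgt tT.
  have /andP[/implyP /(_ lt) /existsP [l hl] _] := krun (Ordinal (ltn_trans tT TN)).
  apply/existsP; exists l; rewrite /block hl andbT.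
  by apply/eqP => lk; move: hl lt; rewrite lk /= => /andP[_]; lra.
have exN : exists t, z - t.+1%:R * w <= demand x k.
  by exists N; rewrite step; lra.
have [T dT Tmin] := ex_minnP exN.
have TN : (T < N)%N.
  rewrite ltnNge; apply/negP => NT.
  case: N Nw krun NT => [|N'] Nw krun NT; first by rewrite mul0r in Nw; lra.
  have /Tmin : z - N'.+1%:R * w <= demand x k by lra.
  by rewrite leqNgt NT.
exists false, (Ordinal TN); rewrite /block_closure /= dT /=; apply/andP; split.
  case: T dT Tmin TN => [|T] dT Tmin TN; first by rewrite mul0r subr0 ltW.
  by rewrite leNgt; apply/negP => /ltW /Tmin; rewrite ltnn.
apply/forallP => -[t' tT] /=.
have lt : demand x k < z - t'.+1%:R * w.
  by rewrite ltNge; apply/negP => /Tmin; rewrite leqNgt tT.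
have /andP[_ /implyP /(_ lt) /existsP [l hl]] := krun (Ordinal (ltn_trans tT TN)).
apply/existsP; exists l; rewrite /block hl andbT.
by apply/eqP => lk; move: hl lt; rewrite lk /= => /andP[+ _]; lra.
Qed.

Lemma measurable_blocks_hit w s t k i :
  measurable_fun setT (fun x : loc => blocks_hit w s t k (x (inl i)) x).
Proof.
apply: measurable_fun_forall => t'; apply: measurable_fun_exists => l.
apply: measurable_and; first exact: measurable_cst.
have mD c : measurable_fun setT (fun x : loc => x (inl i) + c).
  by apply: measurable_funD; [exact: measurable_coordinate|exact: measurable_cst].
have mB c : measurable_fun setT (fun x : loc => x (inl i) - c).
  by apply: measurable_funB; [exact: measurable_coordinate|exact: measurable_cst].
have md := @measurable_demand R n m l.
rewrite /block; case: s; apply: measurable_and.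
- exact: measurable_fun_ltr (mD _) md.
- exact: measurable_fun_ler md (mD _).
- exact: measurable_fun_ler (mB _) md.
- exact: measurable_fun_ltr md (mB _).
Qed.

Lemma measurable_closure_loc w s t k i :
  measurable_fun setT (fun x : loc => block_closure w s t (x (inl i)) (demand x k)).
Proof.
have mD c : measurable_fun setT (fun x : loc => x (inl i) + c).
  by apply: measurable_funD; [exact: measurable_coordinate|exact: measurable_cst].
have mB c : measurable_fun setT (fun x : loc => x (inl i) - c).
  by apply: measurable_funB; [exact: measurable_coordinate|exact: measurable_cst].
have md := @measurable_demand R n m k.
rewrite /block_closure; case: s; apply: measurable_and.
- exact: measurable_fun_ler (mD _) md.
- exact: measurable_fun_ler md (mD _).
- exact: measurable_fun_ler (mB _) md.
- exact: measurable_fun_ler md (mB _).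
Qed.

Lemma pr_blocks_hit w s (t : nat) k i q : 0 <= w -> eta * w <= 1 -> 0 < q ->
  q <= (1 - eta * w) ^+ m -> (0 < t)%N ->
  pr L [set x : loc | blocks_hit w s t k (x (inl i)) x] <= (t%:R * q)^-1.
Proof.
move=> w0 w1 q0 qle t0.
apply: (@resample_upper _ _ _ _ HL loc01 (inl i) _ _ (measurable_blocks_hit w s t k i)) => z z01.
rewrite (_ : [set x : loc | _] = [set x : loc |
    [forall t' : 'I_t, [exists l, (l != k) && block w s t' z (x (inr l))]]]); last first.
  by apply/seteqP; split=> x; rewrite /= /blocks_hit /update eqxx.
apply: (@pr_all_blocks_hit R n m D1 D2 L HL loc01 k t (fun t' => block w s t' z) q) => //.
- by move=> t'; exact: measurable_block.
- by move=> t1 t2 y; rewrite -val_eqE; exact: block_disjoint.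
move=> t'; apply: le_trans qle _.
rewrite big_mkcond /= -[m in _ ^+ m]card_ord -prodr_const; apply: ler_prod => l _.
rewrite subr_ge0 w1 /=; case: ifP => _; last by rewrite lerBlDr lerDl mulr_ge0.
by rewrite lerD2l lerN2; exact: (pr_block k).
Qed.

(** Union bound over the side and the index [t] of the block of [k]; the location of [k] is
    independent of the other demands hitting the first [t] blocks. The term [t = 0] is set apart
    because [(0 * q)^-1] is 0 by convention, whereas the probability of hitting no block at all is
    1. *)
Lemma pr_in_run N w i k q : 0 < w -> 1 <= N%:R * w -> eta * w <= 1 -> 0 < q ->
  q <= (1 - eta * w) ^+ m ->
  pr L [set x : loc | k \in run N w (x (inl i)) x] <=
    2 * (eta * w) * \sum_(t < N) (if t == 0%N :> nat then 1 else (t%:R * q)^-1).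
Proof.
move=> w0 Nw w1 q0 qle.
pose b s (t : 'I_N) (x : loc) :=
  block_closure w s t (x (inl i)) (demand x k) && blocks_hit w s t k (x (inl i)) x.
have mb s t : measurable_fun setT (b s t).
  by apply: measurable_and; [exact: measurable_closure_loc|exact: measurable_blocks_hit].
have le1 : pr L [set x : loc | k \in run N w (x (inl i)) x] <=
    \sum_(st <- enum {: bool * 'I_N}) pr L [set x : loc | b st.1 st.2 x].
  apply: (pr_le_sum mcube Pcube); first exact: measurable_in_run.
    by move=> st; exact: mb.
  move=> x cx krun.
  have z01 : 0 <= x (inl i) <= 1 by have := cx (inl i); rewrite /= in_itv.
  have d01 : 0 <= demand x k <= 1 by have := cx (inr k); rewrite /= in_itv.
  have [s [t st]] := in_run_blocks w0 Nw z01 d01 krun.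
  by apply/hasP; exists (s, t); rewrite ?mem_enum.
apply: (le_trans le1).
rewrite big_enum /= -(pair_bigA _ (fun s t => pr L [set x : loc | b s t x])) /= exchange_big /=.
rewrite mulr_sumr; apply: ler_sum => t _.
rewrite -mulrA mulr_natl -[X in _ *+ X]card_bool -sumr_const; apply: ler_sum => s _.
have mh := measurable_blocks_hit w s t k i.
apply: (@le_trans _ _ (eta * w * pr L [set x : loc | blocks_hit w s t k (x (inl i)) x])); last first.
  apply: ler_wpM2l; first by rewrite mulr_ge0 // ltW.
  case: eqP => [_|/eqP t0].
    by apply: pr_le1; exact/measurable_predP.
  by apply: pr_blocks_hit; rewrite ?lt0n // ltW.
rewrite (Ex_resample HL loc01 (inr k) (mb s t)) -(Ex_bool mcube Pcube mh) -ExZ //; last first.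
  exact: bounded_measurable_bool.
apply: (Ex_le L mcube).
- exact: (bounded_measurable_section (loc_law D1 D2) (inr k) (mb s t)).
- by apply: bounded_measurableZ; exact: bounded_measurable_bool.
move=> x _.
have e_b z : b s t (update x (inr k) z) =
    block_closure w s t (x (inl i)) z && blocks_hit w s t k (x (inl i)) x.
  rewrite /b /demand [in X in X && _]/update eqxx; congr (_ && _).
  rewrite /blocks_hit; apply: eq_forallb => t'; apply: eq_existsb => l.
  rewrite /demand /update (_ : (inr l == inr k :> idx) = (l == k)) //.
  by case: (l == k).
rewrite (_ : [set z | _] = [set z | block_closure w s t (x (inl i)) z &&
    blocks_hit w s t k (x (inl i)) x]); last first.
  by apply/seteqP; split=> z /=; rewrite e_b.
case: (blocks_hit _ _ _ _ _ _); last first.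
  rewrite mulr0 (_ : [set z | _] = set0) ?/pr ?measure0 //.
  by apply/seteqP; split => // z /=; rewrite andbF.
rewrite mulr1 (_ : [set z | _] = [set z | block_closure w s t (x (inl i)) z]); last first.
  by apply/seteqP; split => z /=; rewrite andbT.
by apply: pr_block_closure; exact: ltW.
Qed.
End RunSize.

(** * Isolated gaps between free demands *)

Section GoodGaps.
Variables (R : realType) (n m : nat).
Implicit Types (x : 'I_n + 'I_m -> R) (r : 'I_n -> R) (U : {set 'I_m}).

Definition positions x U : seq R := undup [seq demand x k | k <- enum U].

Lemma positionsP x U p :
  reflect (exists2 k, k \in U & p = demand x k) (p \in positions x U).
Proof.
rewrite mem_undup; apply: (iffP mapP) => -[k kU ->]; exists k => //.
  by rewrite mem_enum in kU.
by rewrite mem_enum.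
Qed.

Lemma size_positions x U : (size (positions x U) <= m)%N.
Proof.
apply: leq_trans (size_undup _) _; rewrite size_map -cardE.
by apply: leq_trans (max_card _) _; rewrite card_ord.
Qed.

Lemma reaches_hit x U c z : reaches U x c z = hit (positions x U) c z.
Proof.
apply/exists_inP/hasP => [[k kU h]|[p /positionsP [k kU ->] h]]; last by exists k.
by exists (demand x k) => //; apply/positionsP; exists k.
Qed.

Lemma newly_reaches_annulus x U c e z :
  newly_reaches U x c e z = annulus (positions x U) c e z.
Proof. by rewrite /newly_reaches /annulus !reaches_hit. Qed.

(* Ranges are at most [lam], so [k] and [l] are isolated in the graph without the
   supplies [i] and [j], and no other demand lies between them. *)
Definition good_gap i j lam a b k l x : bool :=
  [&& k != l, 2 * a < demand x l - demand x k <= 2 * b,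
      [forall q, (q != k) && (q != l) ==>
         ~~ (demand x k <= demand x q <= demand x k + 2 * lam)] &
      [forall i', (i' != i) && (i' != j) ==>
         ~~ (demand x k - lam <= x (inl i') <= demand x k + 3 * lam)]].

Variables (r : 'I_n -> R) (lam : R) (i j : 'I_n).
Hypothesis r_lam : forall l, r l <= lam.
Hypothesis ri : r i = -1.
Hypothesis rj : r j = -1.

(** Both demands lie within [2 * lam] to the right of [k], and the window emptied of supplies
    exceeds this by [lam] on each side. They have no neighbour, hence are missable. *)
Lemma good_gap_missable a b k l x : 0 <= a -> b <= lam -> good_gap i j lam a b k l x ->
  (k \in missable_demands r x) && (l \in missable_demands r x).
Proof.
move=> a0 bl /and4P[kl /andP[h1 h2] _ /forallP far].
have iso q : demand x k <= demand x q <= demand x k + 2 * lam -> q \in missable_demands r x.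
  move=> /andP[q1 q2]; rewrite inE; apply: missable_isolated => i'; rewrite inE /=.
  have neg y : (`|y| <= -1 :> R) = false.
    by apply/negbTE; rewrite -ltNge; apply: lt_le_trans (normr_ge0 _); lra.
  have [->|i'i] := eqVneq i' i; first by rewrite ri neg.
  have [->|i'j] := eqVneq i' j; first by rewrite rj neg.
  have := far i'; rewrite i'i i'j /=; apply: contra => hq.
  have := le_trans hq (r_lam i'); rewrite ler_norml => /andP[? ?]; lra.
by apply/andP; split; apply: iso; lra.
Qed.

Lemma good_gap_unique a b k l l' x : 0 <= a -> b <= lam ->
  good_gap i j lam a b k l x -> good_gap i j lam a b k l' x -> l = l'.
Proof.
move=> a0 bl /and4P[kl _ /forallP far _] /and4P[kl' /andP[h1 h2] _ _].
apply/eqP/negPn/negP => ll'; have := far l'.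
by rewrite eq_sym kl' eq_sym ll' /= => /negP; apply; lra.
Qed.

(** A good gap is determined by its left end [k], and no other demand sits at the position of [k];
    so good gaps inject into the isolated gaps of the deduplicated list of positions. *)
Lemma count_good_gaps c e kap x : 0 <= c + e -> c + kap <= lam ->
  (\sum_k \sum_l (good_gap i j lam (c + e) (c + kap) k l x)%:R <=
   (count (isolated_gap (positions x (missable_demands r x)) c e kap)
      (positions x (missable_demands r x)))%:R :> R).
Proof.
move=> a0 bl; set U := missable_demands r x; set ps := positions x U.
pose G := [set k | [exists l, good_gap i j lam (c + e) (c + kap) k l x]]%SET.
apply: (@le_trans _ _ (#|G|%:R)).
  rewrite -sum1_card natr_sum [leRHS]big_mkcond; apply: ler_sum => k _.
  rewrite inE; case: (boolP [exists l, _]) => [/existsP [l gl]|/existsPn none].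
    rewrite (bigD1 l) //= gl big1 ?addr0 // => l' l'l.
    by case: (boolP (good_gap _ _ _ _ _ _ l' _)) => // /(good_gap_unique a0 bl gl) e'; rewrite e' eqxx in l'l.
  by rewrite big1 // => l _; rewrite (negbTE (none l)).
rewrite ler_nat -size_filter cardE -(size_map (demand x)); apply: uniq_leq_size.
  rewrite map_inj_in_uniq ?enum_uniq // => k k'; rewrite !mem_enum !inE.
  move=> /existsP [l gl] /existsP [l' gl'] dkk'.
  apply/eqP/negPn/negP => kk'.
  move: gl => /and4P[kl /andP[h1 h2] /forallP /(_ k') + _].
  rewrite eq_sym kk' /= -dkk'; have [k'l|_] := eqVneq k' l.
    by move: h1; rewrite -k'l -dkk'; lra.
  by move=> /= /negP; apply; lra.
move=> p /mapP [k]; rewrite mem_enum inE => /existsP [l gl] ->.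
have /andP[kU lU] := good_gap_missable a0 bl gl.
rewrite mem_filter; apply/andP; split; last by apply/positionsP; exists k.
apply/hasP; exists (demand x l); first by apply/positionsP; exists l.
move: gl => /and4P[kl /andP[h1 h2] /forallP far _]; rewrite h1 h2 /=.
apply/allP => t /positionsP [q _ ->]; have := far q.
have [->|qk] := eqVneq q k; first by rewrite ltxx.
have [->|ql] := eqVneq q l; first by rewrite ltxx andbF.
by move=> /=; apply: contra => /andP[? ?]; lra.
Qed.

(** The range -1 disconnects [i] and [j]: either can be resampled while the free demands stay
    fixed. *)
Lemma missable_update x a z : a = i \/ a = j ->
  missable_demands r (update x (inl a) z) = missable_demands r x.
Proof.
move=> aij; apply/finset.setP => k; rewrite !inE; congr (missable _ k).
apply/finset.setP => -[i' l]; rewrite !inE /=.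
have neg y : (`|y| <= -1 :> R) = false.
  by apply/negbTE; rewrite -ltNge; apply: lt_le_trans (normr_ge0 _); lra.
have ra : r a = -1 by case: aij => ->.
have [->|i'a] := eqVneq i' a; first by rewrite ra !neg.
by rewrite {1}/update; case: eqP => // -[e]; rewrite e eqxx in i'a.
Qed.
End GoodGaps.

Section Gain.
Variables (R : realType) (n m : nat).
Local Notation idx := ('I_n + 'I_m)%type.
Local Notation loc := (locspace R idx).
Variables (D1 D2 : probability R R) (L : probability loc R).
Hypothesis HL : product_law (loc_law D1 D2) L.
Variables (g1 g2 : R -> R) (eta : R).
Hypothesis eta_ge1 : 1 <= eta.
Hypothesis D1_density : has_density01 D1 g1.
Hypothesis D2_density : has_density01 D2 g2.
Hypothesis g1_lip : eta.-lipschitz_`[0, 1] g1.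
Hypothesis g2_lip : eta.-lipschitz_`[0, 1] g2.
Hypothesis g1_bounds : forall x : R, x \in `[0%R, 1%R] -> eta^-1 <= g1 x <= eta.
Hypothesis g2_bounds : forall x : R, x \in `[0%R, 1%R] -> eta^-1 <= g2 x <= eta.

Lemma loc_support (k : idx) : loc_law D1 D2 k `[0%R, 1%R]%classic = 1%E.
Proof. by case: k => k; [exact: density_support D1_density|exact: density_support D2_density]. Qed.

Let Pcube : L (@cube R idx) = 1%E := pr_cube HL loc_support.
Let mcube := @measurable_cube R idx.

Lemma measurable_good_gap (i j : 'I_n) lam a b (k l : 'I_m) :
  measurable_fun setT (fun x : loc => good_gap i j lam a b k l x).
Proof.
have md q := @measurable_demand R n m q.
have mD q c : measurable_fun setT (fun x : loc => demand x q + c).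
  by apply: measurable_funD; [exact: measurable_coordinate|exact: measurable_cst].
have mB q c : measurable_fun setT (fun x : loc => demand x q - c).
  by apply: measurable_funB; [exact: measurable_coordinate|exact: measurable_cst].
have mdiff : measurable_fun setT (fun x : loc => demand x l - demand x k).
  exact: measurable_funB (md l) (md k).
apply: measurable_and; first exact: measurable_cst.
apply: measurable_and.
  apply: measurable_and; first exact: measurable_fun_ltr (measurable_cst _) mdiff.
  exact: measurable_fun_ler mdiff (measurable_cst _).
apply: measurable_and; apply: measurable_fun_forall => q;
  (apply: measurable_fun_imply; first exact: measurable_cst);
  apply: measurable_neg; apply: measurable_and.
- exact: measurable_fun_ler (md _) (md _).
- exact: measurable_fun_ler (md _) (mD _ _).
- exact: measurable_fun_ler (mB _ _) (@measurable_coordinate R idx (inl q)).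
- exact: measurable_fun_ler (@measurable_coordinate R idx (inl q)) (mD _ _).
Qed.

(** Resampling [j] in one term and [i] in the other, both of law [D1], turns the difference into the
    second difference of annuli around one set of free demands, at fixed remaining locations. *)
Lemma pr_newly_reaches_difference r lam i j c e kap :
  (forall l, r l <= lam) -> r i = -1 -> r j = -1 ->
  0 <= c -> 0 <= e -> e <= kap -> c + kap <= lam ->
  e / eta * \sum_k \sum_l
      pr L [set x : loc | good_gap i j lam (c + e) (c + kap) k l x]
    - 6 * eta * e * kap * m%:R
  <= pr L [set x : loc | newly_reaches (missable_demands r x) x c e (x (inl j))]
     - pr L [set x : loc | newly_reaches (missable_demands r x) x (c + kap) e (x (inl i))].
Proof.
move=> r_lam ri rj c0 e0 ek ckl.
have eta0 : 0 <= eta by apply: le_trans eta_ge1.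
have kap0 : 0 <= kap by apply: le_trans ek.
have mn c' a := @measurable_newly_reaches R n m r c' e a.
have mg k l := @measurable_good_gap i j lam (c + e) (c + kap) k l.
have bg k l : bounded_measurable (fun x : loc => (good_gap i j lam (c + e) (c + kap) k l x)%:R : R).
  exact: bounded_measurable_bool.
have bg1 k : bounded_measurable (fun x : loc =>
    \sum_l (good_gap i j lam (c + e) (c + kap) k l x)%:R : R).
  by apply: bounded_measurable_sum => l; exact: bg.
have bg2 : bounded_measurable (fun x : loc =>
    \sum_k \sum_l (good_gap i j lam (c + e) (c + kap) k l x)%:R : R).
  by apply: bounded_measurable_sum => k; exact: bg1.
have -> : \sum_k \sum_l pr L [set x : loc | good_gap i j lam (c + e) (c + kap) k l x]
    = Ex L (@cube R idx) (fun x : loc =>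
        \sum_k \sum_l (good_gap i j lam (c + e) (c + kap) k l x)%:R).
  rewrite (Ex_sum mcube Pcube) //; apply: eq_bigr => k _.
  rewrite (Ex_sum mcube Pcube) //; apply: eq_bigr => l _.
  by rewrite (Ex_bool mcube Pcube).
rewrite (Ex_resample HL loc_support (inl j) (mn c (inl j))).
rewrite (Ex_resample HL loc_support (inl i) (mn (c + kap) (inl i))).
have bs c' a := bounded_measurable_section (loc_law D1 D2) (inl a) (mn c' (inl a)).
have bz := bounded_measurableZ (e / eta) bg2.
have bc := bounded_measurable_cst loc (6 * eta * e * kap * m%:R).
rewrite -ExZ // -{1}(Ex_cst mcube Pcube (6 * eta * e * kap * m%:R)) -!ExB //.
apply: (Ex_le L mcube); [exact: bounded_measurableB|exact: bounded_measurableB|].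
move=> x cx; set U := missable_demands r x; set ps := positions x U.
have sec a c' : a = i \/ a = j ->
    [set z | newly_reaches (missable_demands r (update x (inl a) z))
      (update x (inl a) z) c' e (update x (inl a) z (inl a))]
    = [set z | annulus ps c' e z].
  move=> aij; have ua z : update x (inl a) z (inl a) = z by rewrite /update eqxx.
  by apply/seteqP; split=> z; rewrite /= (missable_update ri rj _ _ aij)
    -newly_reaches_annulus ua.
rewrite !sec; [|by left|by right].
have ps01 p : p \in ps -> 0 <= p <= 1.
  by move=> /positionsP [k _ ->]; have := cx (inr k); rewrite /= in_itv.
have := @annulus_second_difference R D1 g1 eta eta_ge1 D1_density g1_lip g1_bounds
  ps (undup_uniq _) ps01 c e kap c0 e0 ek.
apply: le_trans; apply: lerB.
  apply: ler_wpM2l; first exact: divr_ge0.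
  by apply: count_good_gaps; rewrite ?addr_ge0.
apply: ler_wpM2l; first by rewrite !mulr_ge0.
by rewrite ler_nat size_positions.
Qed.

Lemma pr_setC_itv (k : idx) p e : 0 <= e ->
  1 - eta * e <= pr (loc_law D1 D2 k) (~` `[p, p + e]%classic).
Proof.
move=> e0; have mI : measurable (`[p, p + e]%classic : set R) by exact: measurable_itv.
have le1 : pr (loc_law D1 D2 k) `[p, p + e]%classic <= eta * e.
  case: k => _ /=.
    exact: (pr_itv_upper eta_ge1 D1_density g1_lip g1_bounds).
  exact: (pr_itv_upper eta_ge1 D2_density g2_lip g2_bounds).
by rewrite (pr_setC _ mI); lra.
Qed.

Lemma pr_good_gap (i j : 'I_n) lam a b (k l : 'I_m) : k != l ->
  0 <= a -> a <= b -> b <= lam -> 4 * (eta * lam) <= 1 ->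
  (b - a) / eta ^+ 2 * ((1 - 2 * (eta * lam)) ^+ m * (1 - 4 * (eta * lam)) ^+ n)
  <= pr L [set x : loc | good_gap i j lam a b k l x].
Proof.
move=> kl a0 ab bl etalam.
have eta0 : 0 < eta by apply: lt_le_trans eta_ge1.
have lam0 : 0 <= lam by lra.
have lam_small : lam <= 1 / 4.
  have : lam <= eta * lam by rewrite ler_peMl.
  by lra.
set p0 := _ ^+ m * _ ^+ n.
have p0_ge0 : 0 <= p0 by rewrite mulr_ge0 // exprn_ge0; lra.
pose c := 2 * (b - a) / eta * p0.
have c0 : 0 <= c.
  by apply: mulr_ge0 => //; rewrite !mulr_ge0 ?invr_ge0 ?subr_ge0 // ltW.
(* Demand [k] is placed in the left half: since [2 * lam <= 1 / 2], the target interval of [l] then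
   stays inside [0, 1]. The mass of [Z], at least 1 / (2 eta), times 2 (b - a) / eta for [l] gives
   (b - a) / eta^2. *)
pose Z : set R := [set` side true 0 0 (1 / 2)].
have mZ : measurable Z by exact: measurable_itv.
have D2Z : eta^-1 * (1 / 2) <= pr D2 Z.
  apply: (pr_side_lower eta_ge1 D2_density g2_lip); first by lra.
  move=> x; rewrite in_itv /= => xh; have x01 : 0 <= x <= 1 by lra.
  by split=> //; have /andP[] := g2_bounds x01.
suff : c * pr D2 Z <= pr L [set x : loc | good_gap i j lam a b k l x].
  apply: le_trans; apply: (@le_trans _ _ (c * (eta^-1 * (1 / 2)))).
    by rewrite /c le_eqVlt; apply/orP; left; apply/eqP; field; lra.
  exact: ler_wpM2l.
apply: (@resample_lower R idx (loc_law D1 D2) L HL (inr k) _ Z c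
  (measurable_good_gap i j lam a b k l) mZ c0) => z; rewrite /Z /= in_itv /= => zh.
pose A (s : idx) : set R :=
  match s with
  | inl i' => if (i' == i) || (i' == j) then setT
              else ~` `[z - lam, z - lam + 4 * lam]%classic
  | inr q => if q == k then setT
             else if q == l then [set` side true z (2 * a) (2 * (b - a))]
             else ~` `[z, z + 2 * lam]%classic
  end.
have mA s : measurable (A s).
  case: s => s /=; case: ifP => // _; first by apply: measurableC; exact: measurable_itv.
  by case: ifP => // _; apply: measurableC; exact: measurable_itv.
have mg := measurable_pred_loc (inr k) z (measurable_good_gap i j lam a b k l).
apply: (@le_trans _ _ (pr L (box A))); last first.
  apply: (le_pr L (measurable_box mA) (iffLR (measurable_predP _) mg)).
  move=> x xA /=.
  have dk : demand (update x (inr k) z) k = z by rewrite /demand /update eqxx.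
  have dq q : q != k -> demand (update x (inr k) z) q = demand x q.
    by move=> qk; rewrite /demand /update (_ : (inr q == inr k :> idx) = (q == k)) // (negbTE qk).
  have di i' : update x (inr k) z (inl i') = x (inl i') by [].
  rewrite /good_gap kl dk (dq l) 1?eq_sym //=.
  have := xA (inr l); rewrite /= eq_sym (negbTE kl) eqxx /= in_itv /= => hl.
  apply/and3P; split; first by rewrite /demand; lra.
    apply/forallP => q; apply/implyP => /andP[qk ql]; rewrite dq //.
    by have := xA (inr q); rewrite /= (negbTE qk) (negbTE ql) /= in_itv /= => /negP.
  apply/forallP => i'; apply/implyP => /andP[i'i i'j]; rewrite di.
  have := xA (inl i'); rewrite /= (negbTE i'i) (negbTE i'j) /= in_itv /= => /negP.
  by apply: contra; lra.
rewrite (pr_box HL mA) big_sumType /= [leRHS]mulrC.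
have side_l : 2 * (b - a) / eta <= pr D2 [set` side true z (2 * a) (2 * (b - a))].
  rewrite mulrC; apply: (pr_side_lower eta_ge1 D2_density g2_lip); first by lra.
  move=> x; rewrite in_itv /= => xh; have x01 : 0 <= x <= 1 by lra.
  by split=> //; have /andP[] := g2_bounds x01.
have eta2 : 0 <= 1 - eta * (2 * lam) by lra.
have eta4 : 0 <= 1 - eta * (4 * lam) by lra.
have supplies : (1 - 4 * (eta * lam)) ^+ n <= \prod_(i' < n) pr D1 (A (inl i')).
  rewrite -[n in _ ^+ n]card_ord -prodr_const; apply: ler_prod => i' _.
  rewrite mulrCA eta4 /=; case: ifP => _; last by apply: (pr_setC_itv (inl i')); lra.
  by rewrite /pr probability_setT /= lerBlDr lerDl !mulr_ge0 // ltW.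
have demands : (1 - 2 * (eta * lam)) ^+ m * (2 * (b - a) / eta)
    <= \prod_(q < m) pr D2 (A (inr q)).
  rewrite (bigD1 l) //= mulrC eq_sym (negbTE kl) eqxx; apply: ler_pM => //.
  - by rewrite !mulr_ge0 ?invr_ge0 ?subr_ge0 // ltW.
  - by rewrite exprn_ge0 //; lra.
  rewrite big_mkcond -[m in _ ^+ m]card_ord -prodr_const; apply: ler_prod => q _.
  rewrite mulrCA eta2 /=; case: (boolP (q == l)) => /= [_|_].
    by rewrite lerBlDr lerDl !mulr_ge0 // ltW.
  case: ifP => _; last by apply: (pr_setC_itv (inr q)); lra.
  by rewrite /pr probability_setT /= lerBlDr lerDl !mulr_ge0 // ltW.
apply: le_trans (ler_pM _ _ demands supplies).
- by rewrite le_eqVlt /c /p0; apply/orP; left; apply/eqP; ring.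
- by rewrite mulr_ge0 ?exprn_ge0 ?divr_ge0 ?mulr_ge0 ?subr_ge0 // ?(ltW eta0) //; lra.
- by rewrite exprn_ge0 //; lra.
Qed.
End Gain.

(** * The transfer inequality *)

Section TransferStep.
Variables (R : realType) (n m : nat).
Local Notation idx := ('I_n + 'I_m)%type.
Local Notation loc := (locspace R idx).
Variables (D1 D2 : probability R R) (L : probability loc R).
Hypothesis HL : product_law (loc_law D1 D2) L.
Variables (g1 g2 : R -> R) (eta : R).
Hypothesis eta_ge1 : 1 <= eta.
Hypothesis D1_density : has_density01 D1 g1.
Hypothesis D2_density : has_density01 D2 g2.
Hypothesis g1_lip : eta.-lipschitz_`[0, 1] g1.
Hypothesis g2_lip : eta.-lipschitz_`[0, 1] g2.
Hypothesis g1_bounds : forall x : R, x \in `[0%R, 1%R] -> eta^-1 <= g1 x <= eta.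
Hypothesis g2_bounds : forall x : R, x \in `[0%R, 1%R] -> eta^-1 <= g2 x <= eta.
Variables (lam q : R) (N : nat).
Hypothesis lam_gt0 : 0 < lam.
Hypothesis etalam : 4 * (eta * lam) <= 1.
Hypothesis N_large : 1 <= N%:R * (2 * lam).
Hypothesis q_gt0 : 0 < q.
Hypothesis q_le : q <= (1 - eta * (2 * lam)) ^+ m.

Definition run_factor : R := \sum_(t < N) (if t == 0%N :> nat then 1 else (t%:R * q)^-1).

(** One factor 1 / eta is the density of the supply in the annulus, the other two come from the
    demands of the gap; the powers bound the probability that everything else stays away. *)
Definition gain_rate : R := (m * m.-1)%:R / eta ^+ 3 *
  ((1 - 2 * (eta * lam)) ^+ m * (1 - 4 * (eta * lam)) ^+ n).

(** The first term is the variation of the density. The second is two run errors of 8 each: 2 for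
    the sides of the annulus, 2 for those of the run, 2 for the block width [2 * lam]. *)
Definition loss_rate : R :=
  6 * (m%:R * eta * lam) + 16 * eta * (m%:R * eta * lam) * run_factor.

Let loc01 := @loc_support R n m D1 D2 g1 g2 D1_density D2_density.
Let D1_itv p e := pr_itv_upper eta_ge1 D1_density g1_lip g1_bounds p (e := e).
Let D2_itv p e := pr_itv_upper eta_ge1 D2_density g2_lip g2_bounds p (e := e).
Let eta_gt0 : 0 < eta. Proof. exact: lt_le_trans eta_ge1. Qed.
Let etalam_gt0 : 0 < eta * lam. Proof. exact: mulr_gt0. Qed.

Lemma sum_run_annulus i j c e : 0 <= e -> i != j ->
  \sum_k pr L [set x : loc | (k \in run N (2 * lam) (x (inl i)) x) &&
                      (c < `|x (inl j) - demand x k| <= c + e)]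
  <= 8 * eta * (m%:R * eta * lam) * run_factor * e.
Proof.
move=> e0 ij.
apply: (@le_trans _ _ (\sum_(k < m) (2 * eta * e * (2 * (eta * (2 * lam)) * run_factor)))).
  apply: ler_sum => k _.
  apply: le_trans (pr_run_annulus HL loc01 D1_itv N (2 * lam) k c e0 ij) _.
  apply: ler_wpM2l; first by rewrite !mulr_ge0 // ltW.
  apply: (pr_in_run HL loc01 (ltW eta_gt0) D2_itv) => //; first by rewrite mulr_gt0.
  by have := etalam_gt0; have := etalam; lra.
by rewrite sumr_const card_ord -mulr_natl le_eqVlt; apply/orP; left; apply/eqP; ring.
Qed.

Lemma sum_good_gaps i j a b : 0 <= a -> a <= b -> b <= lam ->
  (m * m.-1)%:R * ((b - a) / eta ^+ 2 *
     ((1 - 2 * (eta * lam)) ^+ m * (1 - 4 * (eta * lam)) ^+ n))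
  <= \sum_k \sum_l pr L [set x : loc | good_gap i j lam a b k l x].
Proof.
move=> a0 ab bl; set v := (b - a) / _ * _.
apply: (@le_trans _ _ (\sum_(k < m) (m.-1%:R * v))).
  by rewrite sumr_const card_ord -[leRHS]mulr_natl mulrA natrM.
apply: ler_sum => k _; rewrite (bigD1 k) //=.
apply: (@le_trans _ _ (\sum_(l < m | l != k) v)).
  rewrite sumr_const -[leRHS]mulr_natl (eq_card (B := predC1 k)); last by move=> l; rewrite !inE.
  by rewrite cardC1 card_ord.
rewrite -[leLHS]add0r; apply: lerD; first exact: pr_ge0.
apply: ler_sum => l lk.
apply: (pr_good_gap HL eta_ge1 D1_density D2_density g1_lip g2_lip g1_bounds g2_bounds) => //.
by rewrite eq_sym.
Qed.

Lemma mean_matching_transfer r i j e :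
  i != j -> 0 <= e -> (forall k, 0 <= r k <= lam) -> 2 * e <= r i - r j ->
  mean_matching L r + gain_rate * e * (r i - r j - 2 * e) - loss_rate * e
    <= mean_matching L (transfer r i j e).
Proof.
move=> ij e0 r_range gap.
have /andP[i0 i1] := r_range i; have /andP[j0 j1] := r_range j.
(* With [c = r j], the second annulus starts at [c + kap = r i - e], and the useful half-gaps lie
   between [r j + e] and [r i - e], an interval of length [r i - r j - 2 * e]. *)
pose kap := r i - e - r j; pose r0 := update (update r i (-1)) j (-1).
have r0i : r0 i = -1 by rewrite /r0 /update (negbTE ij) eqxx.
have r0j : r0 j = -1 by rewrite /r0 /update eqxx.
have r0_lam l : r0 l <= lam.
  rewrite /r0 /update; case: ifP => _; first by lra.
  by case: ifP => _; [lra|have /andP[] := r_range l].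
have ek : e <= kap by rewrite /kap; lra.
have ckl : r j + kap <= lam by rewrite /kap; lra.
have M := mean_transfer HL loc01 N ij e0 r_range gap (erefl r0).
have ji : j != i by rewrite eq_sym.
have S1 := sum_run_annulus (r j) e0 ij.
have S2 := sum_run_annulus (r i - e) e0 ji.
have G := pr_newly_reaches_difference HL eta_ge1 D1_density D2_density g1_lip g1_bounds
  r0_lam r0i r0j j0 e0 ek ckl.
have T : 0 <= r j + e by lra.
have T1 : r j + e <= r j + kap by lra.
have S := sum_good_gaps i j T T1 ckl.
have ee : 0 <= e / eta by rewrite divr_ge0 // ltW.
have S' := ler_wpM2l ee S.
have rie : r j + kap = r i - e by rewrite /kap; ring.
rewrite rie in G S'.
have kl : 6 * eta * e * kap * m%:R <= 6 * (m%:R * eta * lam) * e.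
  rewrite [leRHS](_ : _ = 6 * eta * e * lam * m%:R); last by ring.
  apply: ler_wpM2r => //; apply: ler_wpM2l; first by rewrite !mulr_ge0 // ltW.
  by rewrite /kap; lra.
have gE : gain_rate * e * (r i - r j - 2 * e) = e / eta * ((m * m.-1)%:R *
    ((r i - e - (r j + e)) / eta ^+ 2 *
      ((1 - 2 * (eta * lam)) ^+ m * (1 - 4 * (eta * lam)) ^+ n))).
  rewrite /gain_rate; field; exact: lt0r_neq0.
rewrite gE /loss_rate; lra.
Qed.

Lemma gain_rate_ge0 : 0 <= gain_rate.
Proof.
rewrite /gain_rate mulr_ge0 ?divr_ge0 ?exprn_ge0 ?(ltW eta_gt0) //.
by rewrite mulr_ge0 // exprn_ge0 //; have := etalam_gt0; have := etalam; lra.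
Qed.

(* Moving [e] in two halves leaves room: the ranges stay apart by at least [e] after
   the first half, which bounds the gain by the decrease of the sum of squares. *)
Lemma mean_matching_transfer_sqsum r i j e :
  i != j -> 0 <= e -> (forall k, 0 <= r k <= lam) -> 2 * e <= r i - r j ->
  mean_matching L r + gain_rate / 4 * (sqsum r - sqsum (transfer r i j e)) - loss_rate * e
    <= mean_matching L (transfer r i j e).
Proof.
move=> ij e0 r_range gap.
have /andP[i0 i1] := r_range i; have /andP[j0 j1] := r_range j.
set r1 := transfer r i j (e / 2).
have r1i : r1 i = r i - e / 2 by rewrite /r1 /transfer eqxx.
have r1j : r1 j = r j + e / 2 by rewrite /r1 /transfer eq_sym (negbTE ij) eqxx.
have r1_range k : 0 <= r1 k <= lam.
  have [->|ki] := eqVneq k i; first by rewrite r1i; lra.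
  have [->|kj] := eqVneq k j; first by rewrite r1j; lra.
  by rewrite /r1 /transfer (negbTE ki) (negbTE kj).
have e20 : 0 <= e / 2 by lra.
have step1 := mean_matching_transfer ij e20 r_range; rewrite -/r1 in step1.
have {}step1 := step1 ltac:(lra).
have step2 := mean_matching_transfer ij e20 r1_range.
rewrite r1i r1j /r1 (transfer_half r e ij) in step2.
have {}step2 := step2 ltac:(lra).
rewrite (sqsum_transfer r e ij).
have : 0 <= gain_rate * e * (r i - r j - 2 * e).
  by apply: mulr_ge0; [exact: mulr_ge0 gain_rate_ge0 e0|lra].
move: step1 step2; move: gain_rate loss_rate => G C.
by lra.
Qed.

Lemma mean_matching_majorized (p p' : 'I_n -> R) :
  (forall k, 0 <= p k <= lam) -> (forall k, 0 <= p' k) ->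
  (forall i j : 'I_n, (i <= j)%N -> p' j <= p' i) ->
  (forall l, \sum_(k < n | (k < l)%N) p' k <= \sum_(k < n | (k < l)%N) p k) ->
  \sum_k p k = \sum_k p' k ->
  gain_rate / 4 * (\sum_k `|p k - p' k|) ^+ 2 - loss_rate / 2 * (n%:R * \sum_k `|p k - p' k|)
    <= n%:R * (mean_matching L p' - mean_matching L p).
Proof.
move=> p_range p'0 p'_sorted dom tot.
have T := transfer_majorized mean_matching_transfer_sqsum p_range p'_sorted dom tot.
have S := sqsum_majorized p'_sorted dom p'0.
have g0 : 0 <= gain_rate / 4 by rewrite divr_ge0 // gain_rate_ge0.
have S' := ler_wpM2l g0 S.
have T' := ler_wpM2l (ler0n R n) T.
lra.
Qed.
End TransferStep.

(** * Elementary inequalities behind the constants *)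

Section Constants.
Variable R : realType.
Implicit Types (x y p : R).

(** With u = p / (1 - p), one has 1 / (1 - p) = 1 + u <= exp u. *)
Lemma onem_ge_expR p c : 0 <= p -> p / (1 - p) <= c -> p < 1 -> expR (- c) <= 1 - p.
Proof.
move=> p0 pc p1.
have p1' : 0 < 1 - p by lra.
apply: (@le_trans _ _ (expR (- (p / (1 - p))))); first by rewrite ler_expR lerN2.
rewrite expRN -[leRHS]invrK lef_pV2 ?posrE ?expR_gt0 ?invr_gt0 //.
apply: le_trans (expR_ge1Dx _); rewrite le_eqVlt; apply/orP; left; apply/eqP.
by field; lra.
Qed.

Lemma onem_expR_half p : 0 <= p -> p <= 1 / 2 -> expR (- (2 * p)) <= 1 - p.
Proof.
move=> p0 p1; apply: onem_ge_expR; rewrite ?ler_pdivrMr; try lra.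
by nra.
Qed.

Lemma onem_expR_quarter p : 0 <= p -> p <= 1 / 4 -> expR (- (4 / 3 * p)) <= 1 - p.
Proof.
move=> p0 p1; apply: onem_ge_expR; rewrite ?ler_pdivrMr; try lra.
by nra.
Qed.

Lemma expR1_ge2 : 2 <= expR 1 :> R.
Proof. by apply: le_trans (expR_ge1Dx _); lra. Qed.

Lemma double_le_expR y : 2 * y <= expR y.
Proof.
have -> : expR y = expR 1 * expR (y - 1) by rewrite -expRD; congr expR; ring.
have := expR_ge1Dx (y - 1); have := expR1_ge2; have := expR_gt0 (y - 1); nra.
Qed.

Lemma ln_ge1 (n : nat) : (8 <= n)%N -> 1 <= ln (n%:R : R).
Proof.
move=> n8; have ln2 : 1 / 2 <= ln (2 : R).
  have := @le_ln1Dx R (- (1 / 2)) ltac:(lra).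
  by rewrite (_ : 1 + - (1 / 2) = 2^-1) ?lnV ?posrE //; [lra|field].
have : ln (8 : R) <= ln (n%:R : R).
  by rewrite ler_ln ?posrE ?ltr0n ?ler_nat // (leq_trans _ n8).
have -> : ln (8 : R) = ln 2 + ln 2 + ln 2.
  rewrite -!lnM ?posrE ?mulr_gt0 //; congr ln; ring.
by lra.
Qed.

Lemma harmonic_le (n : nat) : \sum_(t < n.+1) (t.+1%:R : R)^-1 <= 1 + ln (n.+1%:R).
Proof.
elim: n => [|n IH]; first by rewrite big_ord1 ln1 invr1 addr0.
rewrite big_ord_recr /=; apply: le_trans (lerD IH (lexx _)) _.
have n2 : 0 < n.+2%:R :> R by rewrite ltr0n.
have n1 : 0 < n.+1%:R :> R by rewrite ltr0n.
have e1 : 1 + - (n.+2%:R : R)^-1 = n.+1%:R / n.+2%:R.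
  have e2 : n.+2%:R = n.+1%:R + 1 :> R by rewrite natr1.
  by rewrite e2; field; lra.
have h := @le_ln1Dx R (- (n.+2%:R : R)^-1).
rewrite e1 ln_div ?posrE // in h.
have : ln (n.+1%:R : R) - ln n.+2%:R <= - (n.+2%:R)^-1.
  by apply: h; rewrite ltrN2 invf_lt1 // ltr1n.
set y := n.+2%:R^-1; set a := ln n.+1%:R; set b := ln n.+2%:R; lra.
Qed.

Lemma run_factor_le (n : nat) (q : R) : 0 < q -> (0 < n)%N ->
  run_factor q n <= 1 + (1 + ln (n%:R)) / q.
Proof.
move=> q0; case: n => // n _; rewrite /run_factor big_ord_recl /= lerD2l.
rewrite (eq_bigr (fun t : 'I_n => (t.+1%:R : R)^-1 / q)); last first.
  by move=> t _; rewrite /bump /= add1n invfM.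
rewrite -mulr_suml; apply: ler_wpM2r; first by rewrite invr_ge0 ltW.
case: n => [|n]; first by rewrite big_ord0 ln1 addr0.
by apply: le_trans (harmonic_le n) _; rewrite lerD2l ler_ln ?posrE ?ltr0n // ler_nat.
Qed.

(** Here x is [m * eta * lam] and E = exp (4 x). The inequality 2 y <= exp y absorbs the polynomial
    factors: 8 x <= E, and 8 x exp (8 x / 3) <= 3 E at y = 4 x / 3. This leaves 5 E + 3 E log n <= 8
    E log n, which is the 8 of [beta_const]. *)
Lemma loss_le (n : nat) (eta gamma x : R) : 1 <= eta -> 0 <= gamma -> 0 <= x -> (8 <= n)%N ->
  (6 * x + 16 * eta * x * run_factor (expR (- (8 / 3 * x))) n) / 2 * gamma
  <= (8 * expR (4 * x) * gamma * eta + 20 * gamma * eta) * ln n%:R.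
Proof.
move=> eta1 g0 x0 n8; have l1 := ln_ge1 n8; set l := ln n%:R in l1 *.
have n0 : (0 < n)%N by apply: leq_trans n8.
have H := run_factor_le (expR_gt0 (- (8 / 3 * x))) n0.
set h := run_factor _ _ in H *; rewrite -/l expRN invrK in H.
set E := expR (4 * x); set F := expR (8 / 3 * x) in H.
have xE : 8 * x <= E by have := double_le_expR (4 * x); rewrite -/E; lra.
have xF : 8 * (x * F) <= 3 * E.
  have -> : E = expR (4 / 3 * x) * F by rewrite -expRD; congr expR; lra.
  have := double_le_expR (4 / 3 * x); have : 0 < F by exact: expR_gt0.
  by nra.
have E0 : 0 < E by exact: expR_gt0.
have xh : 8 * (x * h) <= E + 3 * E * (1 + l).
  have := ler_wpM2l x0 H; have := ler_wpM2r (_ : 0 <= 1 + l) xF; lra.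
have ge : 0 <= gamma * (eta - 1) by rewrite mulr_ge0 //; lra.
have ge0 : 0 <= gamma * eta by lra.
have : 0 <= gamma * eta * l by rewrite mulr_ge0 //; lra.
have := ler_wpM2l ge0 xh.
have b1 : gamma * eta * (3 * x + E + 3 * E * (1 + l)) <= gamma * eta * (8 * E * l).
  apply: ler_wpM2l => //.
  have : 0 <= E * (l - 1) by rewrite mulr_ge0 //; lra.
  by lra.
have : 3 * x * gamma <= gamma * eta * (3 * x).
  have : 0 <= x * (gamma * (eta - 1)) by rewrite mulr_ge0.
  by lra.
move=> *; lra.
Qed.

Lemma ratio_le1 (eta : R) : 1 <= eta -> 0 <= 1 - (eta ^+ 4 + 1) / (eta ^+ 2 + 1) ^+ 2 <= 1.
Proof.
move=> eta1; have e2 : 0 < (eta ^+ 2 + 1) ^+ 2.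
  by rewrite exprn_gt0 // ltr_wpDl // sqr_ge0.
have e4 : 0 <= eta ^+ 4 by rewrite exprn_ge0 //; lra.
have ee : 0 <= eta ^+ 2 by exact: sqr_ge0.
apply/andP; split; last by rewrite lerBlDr lerDl divr_ge0 ?ltW //; lra.
by rewrite subr_ge0 ler_pdivrMr // mul1r; nra.
Qed.
End Constants.

(** * Invariance of the mean under permutations of the supplies *)

Section Exchangeability.
Variables (R : realType) (n m : nat).
Local Notation idx := ('I_n + 'I_m)%type.
Local Notation loc := (locspace R idx).
Variables (D1 D2 : probability R R) (L : probability loc R).
Hypothesis HL : product_law (loc_law D1 D2) L.
Hypothesis loc01 : forall k : idx, loc_law D1 D2 k `[0%R, 1%R]%classic = 1%E.

Definition permute (sigma : 'S_n) (x : loc) : loc :=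
  fun k => match k with inl i => x (inl ((sigma^-1)%g i)) | inr l => x (inr l) end.

Lemma measurable_permute sigma : measurable_fun setT (permute sigma).
Proof. by apply: measurable_fun_locspace => -[i|l]; exact: measurable_coordinate. Qed.

Lemma permute_law sigma A : measurable A -> L (permute sigma @^-1` A) = L A.
Proof.
have mP := measurable_permute sigma; move=> mA; apply/esym.
apply: (@product_law_unique R idx L (pushforward L (permute sigma))) => //.
  move=> B mB.
  pose B' (k : idx) := match k with inl i => B (inl (sigma i)) | inr l => B (inr l) end.
  have mB' k : measurable (B' k) by case: k => k; exact: mB.
  transitivity (\prod_k loc_law D1 D2 k (B k))%E; first exact: HL.
  transitivity (\prod_k loc_law D1 D2 k (B' k))%E.
    by rewrite !big_sumType /= (reindex_inj (@perm_inj _ sigma)).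
  transitivity (L (box B')); first exact/esym/HL.
  congr (L _); apply/seteqP; split=> x /= h.
    by case=> [i|l] /=; [have := h (inl ((sigma^-1)%g i)); rewrite /= permKV|exact: h (inr l)].
  by case=> [i|l] /=; [have := h (inl (sigma i)); rewrite /= permK|exact: h (inr l)].
by apply: le_lt_trans (probability_le1 L _) _; rewrite ?ltry.
Qed.

(** The supplies are i.i.d., so permuting their locations preserves the law, while relabelling them
    preserves the matching number. Hence the ranges may be sorted. *)
Lemma mean_matching_perm (sigma : 'S_n) r :
  mean_matching L (fun i => r (sigma i)) = mean_matching L r.
Proof.
have mcube := @measurable_cube R idx; have Pcube := pr_cube HL loc01.
have bg r' : bounded_measurable (fun x : loc => (matching_number (range_graph r' x))%:R : R).
  exact: (bounded_measurable_graph r' (fun E => (matching_number E)%:R)).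
rewrite /mean_matching !(Ex_setT mcube Pcube (bg _)) /Rintegral; congr fine.
have mP := measurable_permute sigma.
pose X : {RV L >-> loc} := mfun_Sub (mem_set mP).
pose f (x : loc) : \bar R := (matching_number (range_graph r x))%:R%:E.
have mf : measurable_fun setT f by apply/measurable_EFinP; have [] := bg r.
transitivity (\int[distribution L X]_x f x)%E; last first.
  by apply: eq_measure_integral => A mA _; exact: permute_law.
rewrite ge0_integral_distribution // => [|x]; last by rewrite /f lee_fin ler0n.
apply: eq_integral => x _; rewrite /f /=; congr (_%:R%:E).
rewrite -[in RHS](@matching_number_relabel _ _ sigma (sigma^-1)%g); [|exact: permK|exact: permKV].
congr matching_number; apply/finset.setP => -[i k]; rewrite !inE /=.
by rewrite permK.
Qed.
End Exchangeability.

(** * From the random variables of the statement to the product law *)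

Section JointLaw.
Context (R : realType) (disp : measure_display) (T : measurableType disp).
Variables (P : probability T R) (D1 D2 : probability R R) (n m : nat).
Variables (s : 'I_n -> {RV P >-> R}) (d : 'I_m -> {RV P >-> R}).
Local Notation idx := ('I_n + 'I_m)%type.
Local Notation loc := (locspace R idx).
Hypothesis s_law : forall i : 'I_n, has_law (s i) D1.
Hypothesis d_law : forall j : 'I_m, has_law (d j) D2.
Hypothesis sd_indep : mutually_independent (locations s d).
Hypothesis loc01 : forall k : idx, loc_law D1 D2 k `[0%R, 1%R]%classic = 1%E.

Definition joint (w : T) : loc := fun k => locations s d k w.

Lemma measurable_joint : measurable_fun setT joint.
Proof. by apply: measurable_fun_locspace => k; exact: measurable_funPT. Qed.

Definition joint_rv : {RV P >-> loc} := mfun_Sub (mem_set measurable_joint).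

Lemma joint_product_law : product_law (loc_law D1 D2) (distribution P joint_rv).
Proof.
move=> A mA; have := sd_indep (J := [set: idx]%SET) (A := A) (fun k _ => mA k).
rewrite /distribution /pushforward => E.
transitivity (P (\bigcap_(i in [set` [set: idx]%SET]) (locations s d i @^-1` A i))).
  congr (P _); apply/seteqP; split=> w /= h; first by move=> k _; exact: h.
  by move=> k; apply: h; rewrite /= inE.
rewrite E; apply: eq_big => [k|k _]; first by rewrite inE.
by case: k => k; [exact: s_law|exact: d_law].
Qed.

Lemma expected_matchingE (r : n.-tuple R) :
  expected_matching s d r =
  (mean_matching (distribution P joint_rv) (fun i => tnth r i / n%:R))%:E.
Proof.
have mcube := @measurable_cube R idx; have Pcube := pr_cube joint_product_law loc01.
pose r' (i : 'I_n) := tnth r i / n%:R; rewrite -/r'.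
have bg : bounded_measurable (fun x : loc => (matching_number (range_graph r' x))%:R : R).
  exact: (bounded_measurable_graph r' (fun E => (matching_number E)%:R)).
rewrite /mean_matching (Ex_setT mcube Pcube bg) /Rintegral.
pose f (x : loc) : \bar R := (matching_number (range_graph r' x))%:R%:E.
have mf : measurable_fun setT f by apply/measurable_EFinP; have [] := bg.
have int : (distribution P joint_rv).-integrable setT f.
  exact: (bounded_measurable_integrable (distribution P joint_rv) measurableT bg).
rewrite fineK; last exact: integrable_fin_num int.
rewrite ge0_integral_distribution //.
by rewrite /expected_matching unlock.
Qed.
End JointLaw.

(** * Comparison with [alpha_const] and [beta_const] *)

Section FinalBound.
Variables (R : realType) (n m : nat) (eta gamma xi theta : R).
Hypothesis eta_ge1 : 1 <= eta.
Hypothesis gamma_ge1 : 1 <= gamma.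
Hypothesis xi_def : xi = m%:R / n%:R.
Hypothesis n_ge8 : (8 <= n)%N.
Hypothesis theta_gt0 : 0 < theta.
Hypothesis theta_le : theta <= gamma.

(** The bracket of [alpha_const] is at most 1, and [theta <= gamma] trades one factor [theta] for
    [gamma], matching the quadratic gain. *)
Lemma alpha_const_le : 0 <= xi ->
  alpha_const xi gamma eta * theta ^+ 3 <=
  7 / 384 * (expR (- ((8 + 4 * xi) * gamma * eta)) * (gamma * eta) ^- 3) * (gamma * theta ^+ 2).
Proof.
move=> xi0; rewrite /alpha_const; set E := expR _.
have E0 : 0 <= E by exact: expR_ge0.
have c0 : 0 <= (gamma * eta) ^- 3.
  by rewrite invr_ge0 exprn_ge0 // mulr_ge0 //; [apply: le_trans gamma_ge1|apply: le_trans eta_ge1].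
have /andP[k0 k1] := ratio_le1 eta_ge1; set k := 1 - _ in k0 k1 *.
have t2 : 0 <= theta ^+ 2 by exact: sqr_ge0.
rewrite (_ : _ * theta ^+ 3 = 7 / 384 * (E * (gamma * eta) ^- 3) * (k * theta * theta ^+ 2)); last by ring.
apply: ler_wpM2l; first by apply: mulr_ge0; [lra|exact: mulr_ge0].
apply: ler_wpM2r => //; have := ler_wpM2r (ltW theta_gt0) k1; rewrite mul1r.
by move=> h; apply: (le_trans h).
Qed.

(** The gain term is at most n, while [20 * gamma * eta] exceeds 2n and log n >= 1. The result is
    trivial since a mean matching size lies between 0 and n. *)
Lemma trivial_bound : 0 <= xi -> n%:R < 8 * (gamma * eta) ->
  alpha_const xi gamma eta * theta ^+ 3 * n%:R - beta_const xi gamma eta * ln n%:R <= - n%:R.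
Proof.
move=> xi0 small; have l1 : 1 <= ln (n%:R : R) := ln_ge1 R n_ge8.
have n0 : 0 < n%:R :> R by rewrite ltr0n (leq_trans _ n_ge8).
have A := alpha_const_le xi0; set a := alpha_const _ _ _ * _ in A *.
have g0 : 0 < gamma by apply: lt_le_trans gamma_ge1.
have e0 : 0 < eta by apply: lt_le_trans eta_ge1.
have E1 : expR (- ((8 + 4 * xi) * gamma * eta)) <= 1.
  rewrite expR_le1 oppr_le0 !mulr_ge0 ?ltW //.
  by rewrite ltr_wpDr // mulr_ge0.
have inv1 : (gamma * eta) ^- 3 * (gamma * theta ^+ 2) <= 1.
  rewrite mulrC ler_pdivrMr ?exprn_gt0 ?mulr_gt0 // mul1r exprMn.
  have t2 : theta ^+ 2 <= gamma ^+ 2 by rewrite ler_sqr ?nnegrE // ltW.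
  apply: (@le_trans _ _ (gamma ^+ 3 * 1)).
    by rewrite mulr1 [gamma ^+ 3]exprS ler_pM2l.
  by apply: ler_wpM2l; rewrite ?exprn_ge0 ?exprn_ege1 // ltW.
have a1 : a <= 1.
  apply: (le_trans A); rewrite -!mulrA.
  set c := _ ^- 3 * _ in inv1 *.
  have c0 : 0 <= c by rewrite mulr_ge0 ?invr_ge0 ?exprn_ge0 ?mulr_ge0 ?sqr_ge0 // ltW.
  have := expR_ge0 (- ((8 + 4 * xi) * gamma * eta)).
  rewrite -!mulrA in E1 *; set E := expR _ in E1 *; nra.
have b : 20 * (gamma * eta) <= beta_const xi gamma eta.
  rewrite /beta_const mulrA lerDr !mulr_ge0 ?expR_ge0 // ltW //.
have ge0 : 0 <= gamma * eta by rewrite mulr_ge0 // ltW.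
have b0 : 20 * (gamma * eta) <= beta_const xi gamma eta * ln n%:R.
  by apply: (le_trans b); rewrite ler_peMr //; apply: (le_trans _ b); lra.
have : a * n%:R <= 1 * n%:R by rewrite ler_pM2r.
by lra.
Qed.

(** By 1 - p >= exp (-2 p), the n supplies avoiding a length [4 * lam] give the exponent 8 gamma
    eta, and the m demands avoiding [2 * lam] give 4 xi gamma eta. As m >= n / gamma >= 8, m (m - 1)
    >= 7 m^2 / 8 >= 7 n^2 / (8 gamma^2). *)
Lemma gain_rate_ge : 0 < xi -> xi^-1 <= gamma -> (0 < m)%N ->
  8 * gamma <= n%:R -> 8 * (gamma * eta) <= n%:R ->
  7 / 8 * n%:R ^+ 2 * gamma * (expR (- ((8 + 4 * xi) * gamma * eta)) * (gamma * eta) ^- 3)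
    <= gain_rate n m eta (gamma / n%:R).
Proof.
move=> xi0 xig m0 n8g n8ge.
have g0 : 0 < gamma by apply: lt_le_trans gamma_ge1.
have e0 : 0 < eta by apply: lt_le_trans eta_ge1.
have n0 : 0 < n%:R :> R by rewrite ltr0n (leq_trans _ n_ge8).
have mr0 : 0 < m%:R :> R by rewrite ltr0n.
have nm : n%:R <= gamma * m%:R.
  by move: xig; rewrite xi_def invf_div ler_pdivrMr.
have m8 : 8 <= m%:R :> R.
  by have := le_trans n8g nm; rewrite mulrC ler_pM2l.
have mm : 7 / 8 * m%:R ^+ 2 <= (m * m.-1)%:R :> R.
  have -> : (m * m.-1)%:R = m%:R * (m%:R - 1) :> R.
    by rewrite natrM; congr (_ * _); rewrite -[in RHS](prednK m0) -natr1 addrK.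
  by nra.
have nn : n%:R ^+ 2 <= gamma ^+ 2 * m%:R ^+ 2.
  by rewrite -exprMn ler_sqr ?nnegrE // ltW // mulr_gt0.
set lam := gamma / n%:R.
have lam0 : 0 <= eta * lam by rewrite mulr_ge0 ?divr_ge0 // ltW.
have lam8 : 8 * (eta * lam) <= 1.
  rewrite (_ : 8 * (eta * lam) = 8 * (gamma * eta) / n%:R); last by rewrite /lam; ring.
  by rewrite ler_pdivrMr // mul1r.
have p1 : expR (- (2 * (2 * (eta * lam)))) ^+ m <= (1 - 2 * (eta * lam)) ^+ m.
  apply: lerXn2r; rewrite ?nnegrE ?expR_ge0 //; first by lra.
  by apply: onem_expR_half; lra.
have p2 : expR (- (2 * (4 * (eta * lam)))) ^+ n <= (1 - 4 * (eta * lam)) ^+ n.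
  apply: lerXn2r; rewrite ?nnegrE ?expR_ge0 //; first by lra.
  by apply: onem_expR_half; lra.
have pp := ler_pM (exprn_ge0 _ (expR_ge0 _)) (exprn_ge0 _ (expR_ge0 _)) p1 p2.
have EE : expR (- ((8 + 4 * xi) * gamma * eta)) =
    expR (- (2 * (2 * (eta * lam)))) ^+ m * expR (- (2 * (4 * (eta * lam)))) ^+ n.
  rewrite -!expRM_natl -expRD; congr expR; rewrite xi_def /lam; field; lra.
rewrite -EE in pp; rewrite /gain_rate; set E := expR _ in pp *; set Q := _ * _ in pp.
have E0 : 0 <= E by exact: expR_ge0.
apply: (@le_trans _ _ ((m * m.-1)%:R / eta ^+ 3 * E)); last first.
  by apply: ler_wpM2l => //; rewrite divr_ge0 // exprn_ge0 // ltW.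
rewrite [leLHS](_ : _ = 7 / 8 * (n%:R ^+ 2 / gamma ^+ 2) / eta ^+ 3 * E); last by field; lra.
apply: ler_wpM2r => //; apply: ler_wpM2r; first by rewrite invr_ge0 exprn_ge0 // ltW.
apply: le_trans mm; apply: ler_wpM2l => //.
by rewrite ler_pdivrMr ?exprn_gt0 // mulrC.
Qed.

Lemma large_bound S Delta : 0 < xi -> xi^-1 <= gamma -> (0 < m)%N ->
  8 * gamma <= n%:R -> 8 * (gamma * eta) <= n%:R -> theta <= S -> S <= gamma ->
  gain_rate n m eta (gamma / n%:R) / 4 * S ^+ 2
    - loss_rate m eta (gamma / n%:R) (expR (- (8 / 3 * (m%:R * eta * (gamma / n%:R))))) n / 2
      * (n%:R * S) <= n%:R * Delta ->
  alpha_const xi gamma eta * theta ^+ 3 * n%:R - beta_const xi gamma eta * ln n%:R <= Delta.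
Proof.
move=> xi0 xig m0 n8g n8ge thS Sg.
have n0 : 0 < n%:R :> R by rewrite ltr0n (leq_trans _ n_ge8).
have g0 : 0 < gamma by apply: lt_le_trans gamma_ge1.
have e0 : 0 < eta by apply: lt_le_trans eta_ge1.
have A := alpha_const_le (ltW xi0); set a := alpha_const _ _ _ * _ in A *.
have G := gain_rate_ge xi0 xig m0 n8g n8ge.
set E := expR (- ((8 + 4 * xi) * gamma * eta)) * _ in A G; set gr := gain_rate _ _ _ _ in G *.
have E0 : 0 <= E.
  by rewrite mulr_ge0 ?expR_ge0 // invr_ge0 exprn_ge0 // mulr_ge0 // ltW.
set x := m%:R * eta * (gamma / n%:R).
have x0 : 0 <= x by rewrite !mulr_ge0 ?invr_ge0 // ltW.
have Lo := loss_le eta_ge1 (ltW g0) x0 n_ge8.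
rewrite /loss_rate -/x; set lo := _ + _ in Lo *.
have b : beta_const xi gamma eta = 8 * expR (4 * x) * gamma * eta + 20 * gamma * eta.
  rewrite /beta_const; congr (8 * expR _ * _ * _ + _); rewrite xi_def /x; field; lra.
rewrite -b in Lo; set be := _ * ln _ in Lo *.
have rf0 : 0 <= run_factor (expR (- (8 / 3 * x))) n.
  apply: sumr_ge0 => t _; case: ifP => _; first exact: ler01.
  by rewrite invr_ge0 mulr_ge0 // expR_ge0.
have lo0 : 0 <= lo.
  apply: addr_ge0; first exact: mulr_ge0.
  by apply: mulr_ge0 => //; rewrite !mulr_ge0 // ltW.
have S0 : 0 <= S by apply: le_trans thS; exact: ltW.
have th2 : theta ^+ 2 <= S ^+ 2 by rewrite ler_sqr ?nnegrE // ltW.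
(* The 7 / 8 of the number of pairs and the 1 / 4 of the transfer inequality give 7 / 32, which is
   above 7 / 384. *)
have gain : a * n%:R * n%:R <= gr / 4 * S ^+ 2.
  apply: (@le_trans _ _ (7 / 384 * E * (gamma * theta ^+ 2) * n%:R * n%:R)).
    by rewrite !ler_pM2r.
  apply: (@le_trans _ _ (7 / 8 * n%:R ^+ 2 * gamma * E / 4 * S ^+ 2)); last first.
    by apply: ler_wpM2r; [exact: sqr_ge0|lra].
  have c0 : 0 <= n%:R ^+ 2 * gamma * E.
    by apply: mulr_ge0 => //; rewrite mulr_ge0 ?sqr_ge0 // ltW.
  have := ler_wpM2l c0 th2.
  have : 0 <= n%:R ^+ 2 * gamma * E * theta ^+ 2 by rewrite mulr_ge0 ?sqr_ge0.
  by lra.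
have loss : lo / 2 * (n%:R * S) <= n%:R * be.
  rewrite mulrCA; apply: ler_wpM2l; first exact: ltW.
  by apply: le_trans Lo; apply: ler_wpM2l; rewrite ?divr_ge0.
move=> h; rewrite -(ler_pM2l n0); lra.
Qed.
End FinalBound.

Section Rearrangement.
Variables (R : realType) (n : nat).
Implicit Types r : n.-tuple R.

Lemma decreasing_rearrangement_perm r :
  exists sigma : 'S_n, forall i, tnth (decreasing_rearrangement r) i = tnth r (sigma i).
Proof.
have /tuple_permP [sigma E] : perm_eq (decreasing_rearrangement r) r.
  by rewrite perm_sort.
exists sigma => i; rewrite (tnth_nth (tnth r i)) E -(tnth_nth _ [tuple _ | _ < _]).
by rewrite tnth_mktuple.
Qed.

Lemma decreasing_rearrangement_sorted r (i j : 'I_n) : (i <= j)%N ->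
  tnth (decreasing_rearrangement r) j <= tnth (decreasing_rearrangement r) i.
Proof.
move=> ij; pose x0 := tnth r i.
have srt : sorted >=%R (decreasing_rearrangement r).
  by apply: sort_sorted => x y; exact: le_total.
have tr : transitive (>=%R : rel R) by move=> y x z xy yz; exact: le_trans yz xy.
rewrite !(tnth_nth x0).
by apply: (sorted_leq_nth tr _ x0 srt) => //; rewrite ?inE ?size_tuple //; exact: lexx.
Qed.

(** Extends domination to the empty prefix and, by equality of the totals, to all lengths from n
    on. *)
Lemma majorizes_prefix r r' l : majorizes r r' ->
  \sum_(k < n | (k < l)%N) tnth (decreasing_rearrangement r') k
    <= \sum_(k < n | (k < l)%N) tnth (decreasing_rearrangement r) k.
Proof.
move=> [dom tot]; case: l => [|l]; first by rewrite !big_pred0.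
have [ln|nl] := ltnP l n.-1; first by apply: dom; rewrite ltn0Sn.
have all_k (k : 'I_n) : (k < l.+1)%N = true.
  by rewrite ltnS; apply: leq_trans nl; rewrite -ltnS (leq_trans (ltn_ord k)) ?leqSpred.
by under eq_bigl do rewrite all_k; under [leRHS]eq_bigl do rewrite all_k; rewrite tot.
Qed.
End Rearrangement.

Theorem proposition1 (R : realType) (disp : measure_display)
    (T : measurableType disp) (P : probability T R)
    (D1 D2 : probability R R) (g1 g2 : R -> R) (eta : R)
    (eta_ge1 : 1 <= eta)
    (D1_density : has_density01 D1 g1)
    (D2_density : has_density01 D2 g2)
    (g1_lipschitz : eta.-lipschitz_`[0, 1] g1)
    (g2_lipschitz : eta.-lipschitz_`[0, 1] g2)
    (g1_bounds : forall x : R, x \in `[0, 1] -> eta^-1 <= g1 x <= eta)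
    (g2_bounds : forall x : R, x \in `[0, 1] -> eta^-1 <= g2 x <= eta)
    (n m : nat) (m_gt0 : (0 < m)%N)
    (s : 'I_n -> {RV P >-> R}) (d : 'I_m -> {RV P >-> R})
    (s_law : forall i : 'I_n, has_law (s i) D1)
    (d_law : forall j : 'I_m, has_law (d j) D2)
    (sd_indep : mutually_independent (locations s d))
    (xi : R) (xi_def : xi = m%:R / n%:R)
    (gamma : R) (gamma_ge : Num.max 1 xi^-1 <= gamma)
    (r r' : n.-tuple R)
    (r_range : forall i : 'I_n, 0 <= tnth r i <= gamma)
    (r'_range : forall i : 'I_n, 0 <= tnth r' i <= gamma)
    (r_maj : majorizes r r')
    (theta : R) (theta_gt0 : 0 < theta)
    (r_dist : theta * n%:R <
       l1_dist (decreasing_rearrangement r) (decreasing_rearrangement r'))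
    (n_ge : 8%:R * gamma <= n%:R) :
  ((alpha_const xi gamma eta * theta ^+ 3 * n%:R - beta_const xi gamma eta * ln n%:R)%:E
    <= expected_matching s d r' - expected_matching s d r)%E.
Proof.
have gamma_ge1 : 1 <= gamma by move: gamma_ge; rewrite ge_max => /andP[].
have xi_inv : xi^-1 <= gamma by move: gamma_ge; rewrite ge_max => /andP[].
have n8 : (8 <= n)%N.
  rewrite -(ler_nat R); apply: le_trans n_ge; rewrite -[leLHS]mulr1 ler_pM2l //.
have n0 : 0 < n%:R :> R by rewrite ltr0n (leq_trans _ n8).
have xi0 : 0 < xi by rewrite xi_def divr_gt0 // ltr0n.
have gamma0 : 0 < gamma by apply: lt_le_trans gamma_ge1.
have loc01 := loc_support D1_density D2_density (n := n) (m := m).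
have HL := joint_product_law s_law d_law sd_indep.
set L := distribution P (joint_rv s d) in HL.
set rd := decreasing_rearrangement r in r_dist *.
set rd' := decreasing_rearrangement r' in r_dist *.
pose p (i : 'I_n) := tnth rd i / n%:R; pose p' (i : 'I_n) := tnth rd' i / n%:R.
have sort_mean (v : n.-tuple R) : mean_matching L (fun i => tnth v i / n%:R)
    = mean_matching L (fun i => tnth (decreasing_rearrangement v) i / n%:R).
  have [sigma E] := decreasing_rearrangement_perm v.
  rewrite -(mean_matching_perm HL loc01 sigma (fun i => tnth v i / n%:R)).
  by congr mean_matching; apply/funext => i; rewrite E.
rewrite !(expected_matchingE s_law d_law sd_indep loc01) -/L (sort_mean r) (sort_mean r') -EFinB lee_fin.
rewrite -/rd -/rd' -/p -/p'.
have range (v : n.-tuple R) k : (forall i, 0 <= tnth v i <= gamma) ->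
    0 <= tnth (decreasing_rearrangement v) k <= gamma.
  by move=> h; have [sigma ->] := decreasing_rearrangement_perm v.
have p_range k : 0 <= p k <= gamma / n%:R.
  have /andP[a b] := range r k r_range.
  by rewrite /p divr_ge0 ?(ltW n0) //= ler_pM2r ?invr_gt0.
have p'_ge0 k : 0 <= p' k.
  by have /andP[a b] := range r' k r'_range; rewrite /p' divr_ge0 ?(ltW n0).
pose S := \sum_k `|p k - p' k|.
have SE : S = l1_dist rd rd' / n%:R.
  rewrite /S /l1_dist mulr_suml; apply: eq_bigr => k _.
  by rewrite /p /p' -mulrBl normrM [X in _ * X]gtr0_norm ?invr_gt0.
have thetaS : theta <= S by rewrite SE ler_pdivlMr // ltW.
have S_le : S <= gamma.
  rewrite SE ler_pdivrMr // /l1_dist.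
  apply: (@le_trans _ _ (\sum_(k < n) gamma)); last by rewrite sumr_const card_ord mulr_natr.
  apply: ler_sum => k _; have /andP[a b] := range r k r_range.
  have /andP[a' b'] := range r' k r'_range.
  by rewrite ler_norml -/rd -/rd' in a b a' b' *; lra.
have theta_le := le_trans thetaS S_le.
(* The probability estimates need [8 * (eta * lam) <= 1], that is, n >= 8 gamma eta. *)
have [large|small] := leP (8 * (gamma * eta)) n%:R; last first.
  have mean_bounds v : 0 <= mean_matching L v <= n%:R.
    have mcube := @measurable_cube R ('I_n + 'I_m)%type.
    have Pcube := pr_cube HL loc01.
    have bg := @bounded_measurable_graph R n m v (fun E => (matching_number E)%:R).
    have bc c := bounded_measurable_cst (locspace R ('I_n + 'I_m)%type) (c : R).
    apply/andP; split.
      rewrite -(Ex_cst mcube Pcube 0); apply: (Ex_le L mcube (bc 0) bg) => x _.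
      exact: ler0n.
    rewrite -[leRHS](Ex_cst mcube Pcube n%:R); apply: (Ex_le L mcube bg (bc n%:R)) => x _.
    by rewrite ler_nat -[leqRHS]card_ord matching_number_leq_card.
  have := trivial_bound eta_ge1 gamma_ge1 n8 theta_gt0 theta_le (ltW xi0) small.
  have /andP[a b] := mean_bounds p; have /andP[a' b'] := mean_bounds p'.
  by move=> h; apply: (le_trans h); lra.
apply: (large_bound eta_ge1 gamma_ge1 xi_def n8 theta_gt0 theta_le xi0 xi_inv m_gt0
  n_ge large thetaS S_le).
set lam := gamma / n%:R in p_range *.
have eta0 : 0 < eta by apply: lt_le_trans eta_ge1.
have lam0 : 0 < lam by rewrite divr_gt0.
have etalam : 8 * (eta * lam) <= 1.
  rewrite (_ : 8 * (eta * lam) = 8 * (gamma * eta) / n%:R); last by rewrite /lam; ring.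
  by rewrite ler_pdivrMr // mul1r.
have etalam0 : 0 < eta * lam by rewrite mulr_gt0.
apply: (mean_matching_majorized HL eta_ge1 D1_density D2_density g1_lipschitz
  g2_lipschitz g1_bounds g2_bounds) => //.
- by lra.
(* There are [n] blocks of width [2 * lam]; they span 2 gamma >= 1. *)
- by rewrite /lam (_ : n%:R * _ = 2 * gamma); [lra|field; lra].
- exact: expR_gt0.
(* A block is missed by one demand with probability at least 1 - p, where p = 2 eta lam <= 1 / 4.
   The sharper exponent 4 / 3 leaves room under exp (4 x) to absorb the factor x in [loss_le]. *)
- rewrite (_ : - (8 / 3 * _) = m%:R * - (4 / 3 * (eta * (2 * lam)))); last by field.
  rewrite expRM_natl; apply: lerXn2r; rewrite ?nnegrE ?expR_ge0 //; first by lra.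
  by apply: onem_expR_quarter; lra.
- move=> i j ij; rewrite /p' ler_pM2r ?invr_gt0 //.
  exact: decreasing_rearrangement_sorted.
- move=> l; rewrite /p /p' -!mulr_suml ler_pM2r ?invr_gt0 //.
  exact: majorizes_prefix.
- by rewrite /p /p' -!mulr_suml; congr (_ / _); case: r_maj.
Qed.
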